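(* Let $M$ be a smooth manifold and let $\mathcal U=\{f_i:U_i\to M\mid i\in I\}$ be the family of charts of a smooth atlas for $M$. Then there is an equivalence of tangent categories $$\bigl(\mathbf{SMan}_{/M},\mathbb T_{\mathbf{Smooth}/M}\bigr)\simeq\operatorname{pseudolim}\bigl(\mathbf{SMan}_{/U_i},\mathbb T_{\mathbf{Smooth}/U_i}\bigr),$$ where the pseudolimit is that of the pseudofunctor $V\mapsto(\mathbf{SMan}_{/V},\mathbb T_{\mathbf{Smooth}/V})$, $g\mapsto g^*$ (pullback along open inclusions), on the opposite of the sublattice of the lattice of open subsets of $M$ generated by the (images of the) $U_i$.
   Context: Tangent categories. A tangent structure $\mathbb T=(T,p,0,+,\ell,c)$ on a category $\mathscr D$ consists of a functor $T:\mathscr D\to\mathscr D$ and natural transformations $p:T\Rightarrow\mathrm{id}$, $0:\mathrm{id}\Rightarrow T$, $+:T_2\Rightarrow T$, $\ell:T\Rightarrow T^2$, $c:T^2\Rightarrow T^2$ such that: (1) for every object $A$ and $n\in\mathbb N$ the $n$-fold pullback power $T_nA$ of $p_A:TA\to A$ exists and is preserved by all $T^m$; (2) $(p_A,+_A,0_A)$ is a commutative monoid in $\mathscr D_{/A}$; (3) $T(p_A)\ell_A=0_Ap_A$, $\ell_A\circ{+_A}=T(+_A)\circ\langle\ell_A\pi_1,\ell_A\pi_2\rangle$, $\ell_A0_A=T(0_A)0_A$; (4) $p_{TA}c_A=T(p_A)$, $c_A\circ T(+_A)={+_{TA}}\circ\langle c_AT(\pi_1),c_AT(\pi_2)\rangle$,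 $c_AT(0_A)=0_{TA}$; (5) $c_Ac_A=\mathrm{id}$, $c_A\ell_A=\ell_A$, $T(\ell_A)\ell_A=\ell_{TA}\ell_A$, $c_{TA}T(c_A)c_{TA}=T(c_A)c_{TA}T(c_A)$, $c_{TA}T(c_A)\ell_{TA}=T(\ell_A)c_A$; (6) $T(+_A)\circ\langle\ell_A\pi_1,0_{TA}\pi_2\rangle:T_2A\to T^2A$ is an equalizer of $T(p_A)$ and $0_A\,p_A\,p_{TA}:T^2A\rightrightarrows TA$. $\mathfrak{Tan}$: $1$-cells $(\mathscr D,\mathbb T)\to(\mathscr E,\mathbb S)$, $\mathbb S=(S,q,0',\oplus,\ell',c')$, are pairs $(H,\alpha)$, $H$ a functor and $\alpha:HT\Rightarrow SH$ natural with $(q H)\alpha=Hp$, $\alpha (H0)=0'H$, $\alpha (H{+})=(\oplus H)\alpha_2$, $(\ell' H)\alpha=(S\alpha)(\alpha T)(H\ell)$, $(c'H)(S\alpha)(\alpha T)=(S\alpha)(\alpha T)(Hc)$; $2$-cells $(H,\alpha)\Rightarrow(K,\beta)$ are natural $\rho:H\Rightarrow K$ with $(S\rho)\alpha=\beta(\rho T)$. Strong: $\alpha$ invertible and $H$ preserves the pullbacks and equalizers of the tangent structure. Equivalence of tangent categories means equivalence in this $2$-category. The pseudolimit of a pseudofunctor $F$ on $\mathbb U^{\mathrm{op}}$ into tangent categories and strong morphisms is the category of families ${}_VA\in F(V)$ with coherent isomorphisms $F(g)({}_WA)\cong{}_VA$ for $g:V\to W$, with componentwise tangent structure. $\mathbf{SMan}$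 is the category of smooth real manifolds with its usual tangent structure $T$. $\mathbb T_{\mathbf{Smooth}/M}$ denotes the relative (vertical) tangent structure on $\mathbf{SMan}_{/M}$: its tangent functor sends $g:Z\to M$ to the relative tangent bundle $V_g(Z)=\{(z,v)\in TZ\mid D[g](z)v=0\}$, the pullback of $Tg:TZ\to TM$ along the zero section $0_M:M\to TM$, with projection $V_g(Z)\to TZ\xrightarrow{p_Z}Z$, zero section induced by $0_Z$, and the remaining structure restricted from $T$. The paper takes as standing that every morphism of $\mathbf{SMan}$ admits a relative tangent bundle. Pullback along a submersion $f:X\to Y$ is a strong tangent morphism $\mathbf{SMan}_{/Y}\to\mathbf{SMan}_{/X}$ via the isomorphism $f^*(V_g(Z))\cong V_{\pi_0}(f^*Z)$.
   Formalization: Not every smooth map admits a relative tangent bundle (x ↦ x² on the line does not), so each SMan/M is taken as the full subcategory of maps Z→M that admit one, preserved by all powers of T; these are the maps of locally constant rank. *)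

(* Defs.v *)
From HB Require Import structures.
From mathcomp Require Import all_boot all_order all_algebra.
From mathcomp Require Import boolp classical_sets functions cardinality.
From mathcomp Require Import set_interval reals topology normedtype landau derive.

Set Implicit Arguments.
Unset Strict Implicit.
Unset Printing Implicit Defensive.
Import Order.TTheory GRing.Theory Num.Theory.
Import numFieldNormedType.Exports.

Local Obligation Tactic := idtac.

Declare Scope cat_scope.
Delimit Scope cat_scope with cat.
Local Open Scope cat_scope.

Reserved Notation "g ∘ f" (at level 40, left associativity).

Record category := Category {
  obj :> Type;
  hom : obj -> obj -> Type;
  idm : forall A, hom A A;
  compm : forall A B C, hom B C -> hom A B -> hom A C;
  compm1 : forall A B (f : hom A B), compm f (idm A) = f;
  comp1m : forall A B (f : hom A B), compm (idm B) f = f;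
  compmA : forall A B C D (h : hom C D) (g : hom B C) (f : hom A B),
    compm h (compm g f) = compm (compm h g) f }.

Arguments hom {c} _ _.
Arguments idm {c} A.
Arguments compm {c A B C} _ _.
Notation "g ∘ f" := (compm g f) : cat_scope.

Section Limits.
Variable C : category.

Definition is_iso (A B : C) (f : hom A B) : Prop :=
  exists g : hom B A, g ∘ f = idm A /\ f ∘ g = idm B.

Definition is_equalizer (E A B : C) (e : hom E A) (f g : hom A B) : Prop :=
  f ∘ e = g ∘ e /\
  forall X (h : hom X A), f ∘ h = g ∘ h -> exists! k : hom X E, e ∘ k = h.

Definition is_pullback (P A B Z : C) (f : hom A Z) (g : hom B Z)
    (u : hom P A) (v : hom P B) : Prop :=
  f ∘ u = g ∘ v /\
  forall X (a : hom X A) (b : hom X B), f ∘ a = g ∘ b ->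
    exists! k : hom X P, u ∘ k = a /\ v ∘ k = b.

(* The base leg [b] is recorded so that the 0-fold pullback power is [A]. *)
Definition is_pbpower (A E : C) (p : hom E A) (n : nat) (P : C)
    (pr : 'I_n -> hom P E) (b : hom P A) : Prop :=
  (forall i, p ∘ pr i = b) /\
  forall X (f : 'I_n -> hom X E) (x : hom X A), (forall i, p ∘ f i = x) ->
    exists! k : hom X P, (forall i, pr i ∘ k = f i) /\ b ∘ k = x.

End Limits.

Record functor (C D : category) := Functor {
  fobj :> C -> D;
  fmap : forall A B : C, hom A B -> hom (fobj A) (fobj B);
  fmap1 : forall A : C, fmap (idm A) = idm (fobj A);
  fmapM : forall (A B B' : C) (g : hom B B') (f : hom A B),
    fmap (g ∘ f) = fmap g ∘ fmap f }.

Arguments fmap {C D} _ {A B} _.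

Definition id_functor (C : category) : functor C C :=
  @Functor C C (fun A => A) (fun A B f => f) (fun=> erefl) (fun _ _ _ _ _ => erefl).

Program Definition comp_functor (C D E : category) (G : functor D E)
    (F : functor C D) : functor C E :=
  @Functor C E (fun A => G (F A)) (fun A B f => fmap G (fmap F f)) _ _.
Next Obligation. by move=> C D E G F A /=; rewrite !fmap1. Qed.
Next Obligation. by move=> C D E G F A B B' g f /=; rewrite !fmapM. Qed.

Definition natural (C D : category) (F G : functor C D)
    (t : forall A, hom (F A) (G A)) : Prop :=
  forall (A B : C) (f : hom A B), t B ∘ fmap F f = fmap G f ∘ t A.

(* [m]-fold images of a (co)cone under an endofunctor, used to say that a
   limit is preserved by every power [T^m]. *)
Fixpoint is_pbpower_iter (C : category) (T : functor C C) (m : nat)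
    (A E : C) (p : hom E A) (n : nat) (P : C) (pr : 'I_n -> hom P E)
    (b : hom P A) : Prop :=
  if m is m'.+1
  then is_pbpower_iter T m' (fmap T p) (fun i => fmap T (pr i)) (fmap T b)
  else is_pbpower p pr b.

Fixpoint is_pullback_iter (C : category) (T : functor C C) (m : nat)
    (P A B Z : C) (f : hom A Z) (g : hom B Z) (u : hom P A) (v : hom P B) : Prop :=
  if m is m'.+1
  then is_pullback_iter T m' (fmap T f) (fmap T g) (fmap T u) (fmap T v)
  else is_pullback f g u v.

Definition i0 : 'I_2 := ord0.
Definition i1 : 'I_2 := ord_max.

(* A morphism <x, y> into a pullback power [T_2 A] is introduced throughout as
   a morphism [u] with [tpr i0 ∘ u = x] and [tpr i1 ∘ u = y]; by the axiom
   [tpow_pb] such a [u] exists and is unique as soon as [p ∘ x = p ∘ y]. *)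
Record tangent_structure (C : category) := TangentStructure {
  tfun : functor C C;
  tp : forall A, hom (tfun A) A;
  tzero : forall A, hom A (tfun A);
  tpow : nat -> C -> C;
  tpr : forall n A, 'I_n -> hom (tpow n A) (tfun A);
  tbase : forall n A, hom (tpow n A) A;
  tplus : forall A, hom (tpow 2 A) (tfun A);
  tlift : forall A, hom (tfun A) (tfun (tfun A));
  tflip : forall A, hom (tfun (tfun A)) (tfun (tfun A));
  tp_nat : natural (F := tfun) (G := id_functor C) tp;
  tzero_nat : natural (F := id_functor C) (G := tfun) tzero;
  tplus_nat : forall (A B : C) (f : hom A B) (f2 : hom (tpow 2 A) (tpow 2 B)),
    (forall i, tpr B i ∘ f2 = fmap tfun f ∘ tpr A i) ->
    tplus B ∘ f2 = fmap tfun f ∘ tplus A;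
  tlift_nat : natural (F := tfun) (G := comp_functor tfun tfun) tlift;
  tflip_nat : natural (F := comp_functor tfun tfun) (G := comp_functor tfun tfun) tflip;
  tpow_pb : forall m n A, is_pbpower_iter tfun m (tp A) (@tpr n A) (tbase n A);
  tzero_over : forall A, tp A ∘ tzero A = idm A;
  tplus_over : forall A, tp A ∘ tplus A = tbase 2 A;
  tplusA : forall A X (x y z : hom X (tfun A)) (xy yz xyz xyz' : hom X (tpow 2 A)),
    tpr A i0 ∘ xy = x -> tpr A i1 ∘ xy = y ->
    tpr A i0 ∘ yz = y -> tpr A i1 ∘ yz = z ->
    tpr A i0 ∘ xyz = tplus A ∘ xy -> tpr A i1 ∘ xyz = z ->
    tpr A i0 ∘ xyz' = x -> tpr A i1 ∘ xyz' = tplus A ∘ yz ->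
    tplus A ∘ xyz = tplus A ∘ xyz';
  tplusC : forall A X (xy yx : hom X (tpow 2 A)),
    tpr A i0 ∘ yx = tpr A i1 ∘ xy -> tpr A i1 ∘ yx = tpr A i0 ∘ xy ->
    tplus A ∘ yx = tplus A ∘ xy;
  tplus0 : forall A (u : hom (tfun A) (tpow 2 A)),
    tpr A i0 ∘ u = tzero A ∘ tp A -> tpr A i1 ∘ u = idm (tfun A) ->
    tplus A ∘ u = idm (tfun A);
  tlift_p : forall A, fmap tfun (tp A) ∘ tlift A = tzero A ∘ tp A;
  tlift_plus : forall A (u : hom (tpow 2 A) (tfun (tpow 2 A))),
    (forall i, fmap tfun (tpr A i) ∘ u = tlift A ∘ tpr A i) ->
    tlift A ∘ tplus A = fmap tfun (tplus A) ∘ u;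
  tlift_zero : forall A, tlift A ∘ tzero A = fmap tfun (tzero A) ∘ tzero A;
  tflip_p : forall A, tp (tfun A) ∘ tflip A = fmap tfun (tp A);
  tflip_plus : forall A (u : hom (tfun (tpow 2 A)) (tpow 2 (tfun A))),
    (forall i, tpr (tfun A) i ∘ u = tflip A ∘ fmap tfun (tpr A i)) ->
    tflip A ∘ fmap tfun (tplus A) = tplus (tfun A) ∘ u;
  tflip_zero : forall A, tflip A ∘ fmap tfun (tzero A) = tzero (tfun A);
  tflip_flip : forall A, tflip A ∘ tflip A = idm _;
  tflip_lift : forall A, tflip A ∘ tlift A = tlift A;
  tlift_lift : forall A,
    fmap tfun (tlift A) ∘ tlift A = tlift (tfun A) ∘ tlift A;
  tflip_braid : forall A,
    tflip (tfun A) ∘ fmap tfun (tflip A) ∘ tflip (tfun A) =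
    fmap tfun (tflip A) ∘ tflip (tfun A) ∘ fmap tfun (tflip A);
  tflip_flip_lift : forall A,
    tflip (tfun A) ∘ fmap tfun (tflip A) ∘ tlift (tfun A) =
    fmap tfun (tlift A) ∘ tflip A;
  tlift_eq : forall A (u : hom (tpow 2 A) (tfun (tpow 2 A))),
    fmap tfun (tpr A i0) ∘ u = tlift A ∘ tpr A i0 ->
    fmap tfun (tpr A i1) ∘ u = tzero (tfun A) ∘ tpr A i1 ->
    is_equalizer (fmap tfun (tplus A) ∘ u)
      (fmap tfun (tp A)) (tzero A ∘ tp A ∘ tp (tfun A)) }.

Record tancat := TanCat {
  tc_cat :> category;
  tc_str : tangent_structure tc_cat }.

Local Notation tanf X := (tfun (tc_str X)).

Arguments tp {C} _ A.
Arguments tzero {C} _ A.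
Arguments tpow {C} _ n A.
Arguments tpr {C} _ {n} A i.
Arguments tbase {C} _ n A.
Arguments tplus {C} _ A.
Arguments tlift {C} _ A.
Arguments tflip {C} _ A.

Record tan_mor (X Y : tancat) := TanMor {
  tm_fun :> functor X Y;
  tm_dist : forall A : X, hom (tm_fun (tanf X A)) (tanf Y (tm_fun A));
  tm_nat : natural (F := comp_functor tm_fun (tanf X))
                   (G := comp_functor (tanf Y) tm_fun) tm_dist;
  tm_p : forall A, tp (tc_str Y) (tm_fun A) ∘ tm_dist A =
                   fmap tm_fun (tp (tc_str X) A);
  tm_zero : forall A, tm_dist A ∘ fmap tm_fun (tzero (tc_str X) A) =
                      tzero (tc_str Y) (tm_fun A);
  tm_plus : forall A (u : hom (tm_fun (tpow (tc_str X) 2 A))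
                              (tpow (tc_str Y) 2 (tm_fun A))),
    (forall i, tpr (tc_str Y) (tm_fun A) i ∘ u =
               tm_dist A ∘ fmap tm_fun (tpr (tc_str X) A i)) ->
    tm_dist A ∘ fmap tm_fun (tplus (tc_str X) A) =
    tplus (tc_str Y) (tm_fun A) ∘ u;
  tm_lift : forall A, tlift (tc_str Y) (tm_fun A) ∘ tm_dist A =
    fmap (tanf Y) (tm_dist A) ∘ tm_dist (tanf X A) ∘ fmap tm_fun (tlift (tc_str X) A);
  tm_flip : forall A,
    tflip (tc_str Y) (tm_fun A) ∘ fmap (tanf Y) (tm_dist A) ∘ tm_dist (tanf X A) =
    fmap (tanf Y) (tm_dist A) ∘ tm_dist (tanf X A) ∘ fmap tm_fun (tflip (tc_str X) A) }.

Arguments tm_dist {X Y} _ A.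

Definition strong (X Y : tancat) (H : tan_mor X Y) : Prop :=
  [/\ forall A, is_iso (tm_dist H A),
      forall n A, is_pbpower (fmap H (tp (tc_str X) A))
        (fun i => fmap H (tpr (tc_str X) A i)) (fmap H (tbase (tc_str X) n A)) &
      forall A (u : hom (tpow (tc_str X) 2 A) (tanf X (tpow (tc_str X) 2 A))),
        fmap (tanf X) (tpr (tc_str X) A i0) ∘ u =
          tlift (tc_str X) A ∘ tpr (tc_str X) A i0 ->
        fmap (tanf X) (tpr (tc_str X) A i1) ∘ u =
          tzero (tc_str X) (tanf X A) ∘ tpr (tc_str X) A i1 ->
        is_equalizer (fmap H (fmap (tanf X) (tplus (tc_str X) A) ∘ u))
          (fmap H (fmap (tanf X) (tp (tc_str X) A)))
          (fmap H (tzero (tc_str X) A ∘ tp (tc_str X) A ∘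
                   tp (tc_str X) (tanf X A)))].

Section OneCells.

Lemma tpow_pb0 (X : tancat) n A :
  is_pbpower (tp (tc_str X) A) (@tpr _ (tc_str X) n A) (tbase (tc_str X) n A).
Proof. exact: (tpow_pb (tc_str X) 0 n A). Qed.

Lemma tpr_p (X : tancat) n A (i : 'I_n) :
  tp (tc_str X) A ∘ tpr (tc_str X) A i = tbase (tc_str X) n A.
Proof. by have [] := tpow_pb0 (X := X) n A. Qed.

Lemma tpow_lift (X : tancat) n A B (f : 'I_n -> hom B (tanf X A)) (x : hom B A) :
  (forall i, tp (tc_str X) A ∘ f i = x) ->
  exists u, (forall i, tpr (tc_str X) A i ∘ u = f i) /\
            tbase (tc_str X) n A ∘ u = x.
Proof.
move=> e; have [_ /(_ _ _ _ e) [u [ue _]]] := tpow_pb0 (X := X) n A.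
by exists u.
Qed.

Lemma tpow_ext (X : tancat) n A B (u v : hom B (tpow (tc_str X) n A)) :
  (forall i, tpr (tc_str X) A i ∘ u = tpr (tc_str X) A i ∘ v) ->
  tbase (tc_str X) n A ∘ u = tbase (tc_str X) n A ∘ v -> u = v.
Proof.
move=> e eb.
have [_ /(_ B (fun i => tpr (tc_str X) A i ∘ v)
  (tbase (tc_str X) n A ∘ v)) []] := tpow_pb0 (X := X) n A.
  by move=> i; rewrite compmA tpr_p.
by move=> w [_ wu]; rewrite -(wu u) ?(wu v).
Qed.

Lemma tm_dist_tpr (X Y : tancat) (H : tan_mor X Y) n A (i : 'I_n) :
  tp (tc_str Y) (H A) ∘ (tm_dist H A ∘ fmap H (tpr (tc_str X) A i)) =
  fmap H (tbase (tc_str X) n A).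
Proof. by rewrite compmA tm_p -fmapM tpr_p. Qed.

Program Definition tan_id (X : tancat) : tan_mor X X :=
  @TanMor X X (id_functor X) (fun A => idm (tanf X A)) _ _ _ _ _ _.
Next Obligation. by move=> X A B f; rewrite /= comp1m compm1. Qed.
Next Obligation. by move=> X A; rewrite compm1. Qed.
Next Obligation. by move=> X A; rewrite comp1m. Qed.
Next Obligation.
move=> X A u /= e; rewrite comp1m; have -> : u = idm _; last by rewrite compm1.
apply: tpow_ext => [i|]; first by rewrite e comp1m compm1.
by rewrite -(tpr_p _ i0) -!compmA e comp1m compm1.
Qed.
Next Obligation. by move=> X A; rewrite /= fmap1 !comp1m compm1. Qed.
Next Obligation. by move=> X A; rewrite /= fmap1 !comp1m !compm1. Qed.

Program Definition tan_comp (X Y Z : tancat) (K : tan_mor Y Z) (H : tan_mor X Y) :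
    tan_mor X Z :=
  @TanMor X Z (comp_functor K H)
    (fun A => tm_dist K (H A) ∘ fmap K (tm_dist H A)) _ _ _ _ _ _.
Next Obligation.
move=> X Y Z K H A B f /=; rewrite -compmA -fmapM.
have /= -> := tm_nat H f.
by rewrite fmapM !compmA; have /= -> := tm_nat K (fmap H f).
Qed.
Next Obligation. by move=> X Y Z K H A; rewrite /= compmA tm_p -fmapM tm_p. Qed.
Next Obligation.
by move=> X Y Z K H A; rewrite /= -compmA -fmapM tm_zero tm_zero.
Qed.
Next Obligation.
move=> X Y Z K H A u /= e.
have [v [ve vb]] := @tpow_lift Y 2 (H A) _ _ _ (tm_dist_tpr H A (n := 2)).
have [w [we wb]] := @tpow_lift Z 2 (K (H A)) _ _ _ (tm_dist_tpr K (H A) (n := 2)).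
have -> : u = w ∘ fmap K v.
  have E i : tpr (tc_str Z) (K (H A)) i ∘ u =
             tpr (tc_str Z) (K (H A)) i ∘ (w ∘ fmap K v).
    by rewrite e compmA we -[RHS]compmA -fmapM ve fmapM compmA.
  apply: (@tpow_ext Z 2 (K (H A)) _ u (w ∘ fmap K v) E).
  by rewrite -(tpr_p _ i0) -![LHS]compmA -![RHS]compmA E.
rewrite -compmA -fmapM (tm_plus ve) fmapM compmA (tm_plus we).
by rewrite compmA.
Qed.
Next Obligation.
move=> X Y Z K H A /=.
rewrite compmA tm_lift -!compmA -fmapM tm_lift !fmapM !compmA.
congr (_ ∘ _); congr (_ ∘ _); rewrite -!compmA; congr (_ ∘ _).
by have /= -> := tm_nat K (tm_dist H A).
Qed.
Next Obligation.
move=> X Y Z K H A /=; rewrite !fmapM.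
have /= N := tm_nat K (tm_dist H A).
rewrite -!compmA (compmA _ (tm_dist K _)) -N -!compmA (compmA _ (fmap (tanf Z) _)).
rewrite (compmA _ (tm_dist K _)) tm_flip.
rewrite -!compmA; congr (_ ∘ _).
rewrite (compmA _ (tm_dist K _) (fmap K _ ∘ _)) -N -!compmA; congr (_ ∘ _).
by rewrite -!fmapM compmA tm_flip -compmA.
Qed.

End OneCells.

Record tan_cell (X Y : tancat) (H K : tan_mor X Y) := TanCell {
  tcell :> forall A : X, hom (H A) (K A);
  tcell_nat : natural (F := H) (G := K) tcell;
  tcell_dist : forall A, fmap (tanf Y) (tcell A) ∘ tm_dist H A =
                         tm_dist K A ∘ tcell (tanf X A) }.

Definition tan_iso (X Y : tancat) (H K : tan_mor X Y) : Type :=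
  {rho : tan_cell H K | forall A, is_iso (rho A)}.

Coercion tan_iso_cell X Y (H K : tan_mor X Y) (r : tan_iso H K) : tan_cell H K :=
  sval r.

Definition tan_equivalent (X Y : tancat) : Prop :=
  exists (H : tan_mor X Y) (K : tan_mor Y X),
    inhabited (tan_iso (tan_comp K H) (tan_id X)) /\
    inhabited (tan_iso (tan_comp H K) (tan_id Y)).

(* Pseudofunctors U^op -> (tangent categories, strong morphisms). The triangle
   [k = h ∘ g] is an argument of the compositor so that no transport along
   equalities of morphisms of [U] is needed. *)
Record pseudofunctor (U : category) (X : U -> tancat) := Pseudofunctor {
  pf_mor : forall V W : U, hom V W -> tan_mor (X W) (X V);
  pf_strong : forall V W (g : hom V W), strong (pf_mor g);
  pf_id : forall V (i : hom V V), i = idm V -> tan_iso (pf_mor i) (tan_id (X V));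
  pf_comp : forall V W Y (g : hom V W) (h : hom W Y) (k : hom V Y), k = h ∘ g ->
    tan_iso (tan_comp (pf_mor g) (pf_mor h)) (pf_mor k);
  pf_unitl : forall V W (i : hom V V) (g : hom V W) (ei : i = idm V)
      (e : g = g ∘ i) (A : X W),
    pf_comp e A = pf_id ei (pf_mor g A);
  pf_unitr : forall V W (g : hom V W) (i : hom W W) (ei : i = idm W)
      (e : g = i ∘ g) (A : X W),
    pf_comp e A = fmap (pf_mor g) (pf_id ei A);
  pf_assoc : forall V W Y Z (g : hom V W) (h : hom W Y) (k : hom Y Z)
      (hg : hom V Y) (kh : hom W Z) (khg : hom V Z)
      (ehg : hg = h ∘ g) (ekh : kh = k ∘ h)
      (e1 : khg = k ∘ hg) (e2 : khg = kh ∘ g) (A : X Z),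
    pf_comp e1 A ∘ pf_comp ehg (pf_mor k A) =
    pf_comp e2 A ∘ fmap (pf_mor g) (pf_comp ekh A) }.

Section Uniqueness.
Variable C : category.

Lemma pbpower_ext (A E : C) (p : hom E A) n (P : C) (pr : 'I_n -> hom P E) b
    (X : C) (u v : hom X P) : is_pbpower p pr b ->
  (forall i, pr i ∘ u = pr i ∘ v) -> b ∘ u = b ∘ v -> u = v.
Proof.
move=> [pE univ] e eb.
have [i|w [_ wu]] := univ X (fun i => pr i ∘ v) (b ∘ v).
  by rewrite compmA pE.
by rewrite -(wu u) ?(wu v).
Qed.

Lemma equalizer_ext (E A B : C) (e : hom E A) (f g : hom A B) (X : C)
    (u v : hom X E) : is_equalizer e f g -> e ∘ u = e ∘ v -> u = v.
Proof.
move=> [fg univ] uv; have [|w [_ wu]] := univ X (e ∘ v).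
  by rewrite !compmA fg.
by rewrite -(wu u) ?(wu v).
Qed.

Lemma is_iso_comp (A B D : C) (g : hom B D) (f : hom A B) :
  is_iso g -> is_iso f -> is_iso (g ∘ f).
Proof.
move=> [g' [g1 g2]] [f' [f1 f2]]; exists (f' ∘ g'); split.
  by rewrite -compmA (compmA g') g1 comp1m.
by rewrite -compmA (compmA f) f2 comp1m.
Qed.

Lemma pbpower_iso (A E : C) (p : hom E A) n (P : C) (pr : 'I_n -> hom P E) b
    (A' E' : C) (p' : hom E' A') (P' : C) (pr' : 'I_n -> hom P' E') b'
    (u : hom P P') (e : hom E E') (a : hom A A') :
  is_pbpower p pr b -> is_pbpower p' pr' b' -> is_iso e -> is_iso a ->
  p' ∘ e = a ∘ p -> (forall i, pr' i ∘ u = e ∘ pr i) -> b' ∘ u = a ∘ b ->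
  is_iso u.
Proof.
move=> HP HP' [e' [e1 e2]] [a' [a1 a2]] pe pru bu.
have p'e' : p ∘ e' = a' ∘ p'.
  rewrite -[LHS]comp1m -a1 -!compmA (compmA a p e') -pe -compmA e2 compm1.
  by [].
have [pE univ] := HP; have [pE' _] := HP'.
have [i|k [[k1 k2] _]] := univ P' (fun i => e' ∘ pr' i) (a' ∘ b').
  by rewrite compmA p'e' -compmA pE'.
exists k; split.
  apply: (pbpower_ext HP) => [i|]; rewrite compmA compm1.
    by rewrite k1 -compmA pru compmA e1 comp1m.
  by rewrite k2 -compmA bu compmA a1 comp1m.
apply: (pbpower_ext HP') => [i|]; rewrite compmA compm1.
  by rewrite pru -compmA k1 compmA e2 comp1m.
by rewrite bu -compmA k2 compmA a2 comp1m.
Qed.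

End Uniqueness.

Lemma is_iso_fmap (C D : category) (F : functor C D) (A B : C) (f : hom A B) :
  is_iso f -> is_iso (fmap F f).
Proof.
by move=> [g [g1 g2]]; exists (fmap F g); rewrite -!fmapM g1 g2 !fmap1.
Qed.

Section PseudoLimit.
Variables (U : category) (X : U -> tancat) (F : pseudofunctor X).

Record lim_obj := LimObj {
  lo_at :> forall V : U, X V;
  lo_tr : forall V W (g : hom V W), hom (pf_mor F g (lo_at W)) (lo_at V);
  lo_iso : forall V W (g : hom V W), is_iso (lo_tr g);
  lo_id : forall V (i : hom V V) (ei : i = idm V),
    lo_tr i = pf_id F ei (lo_at V);
  lo_comp : forall V W Y (g : hom V W) (h : hom W Y) (k : hom V Y) (e : k = h ∘ g),
    lo_tr k ∘ pf_comp F e (lo_at Y) = lo_tr g ∘ fmap (pf_mor F g) (lo_tr h) }.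

Record lim_hom (A B : lim_obj) := LimHom {
  lh_at :> forall V, hom (A V) (B V);
  lh_tr : forall V W (g : hom V W),
    lh_at V ∘ lo_tr A g = lo_tr B g ∘ fmap (pf_mor F g) (lh_at W) }.

Lemma lim_hom_eq (A B : lim_obj) (u v : lim_hom A B) :
  (forall V, u V = v V) -> u = v.
Proof.
case: u v => [u Hu] [v Hv] /= e.
have {}e : u = v by apply: functional_extensionality_dep.
by case: v / e Hv => Hv; congr LimHom; exact: Prop_irrelevance.
Qed.

Program Definition lim_idm (A : lim_obj) : lim_hom A A :=
  @LimHom A A (fun V => idm (A V)) _.
Next Obligation. by move=> A V W g; rewrite fmap1 comp1m compm1. Qed.

Program Definition lim_compm (A B C : lim_obj) (v : lim_hom B C) (u : lim_hom A B) :
    lim_hom A C := @LimHom A C (fun V => v V ∘ u V) _.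
Next Obligation.
by move=> A B C v u V W g; rewrite fmapM -compmA lh_tr compmA lh_tr -compmA.
Qed.

Program Definition lim_cat : category :=
  @Category lim_obj lim_hom lim_idm lim_compm _ _ _.
Next Obligation. by move=> A B f; apply: lim_hom_eq => V; exact: compm1. Qed.
Next Obligation. by move=> A B f; apply: lim_hom_eq => V; exact: comp1m. Qed.
Next Obligation.
by move=> A B C D h g f; apply: lim_hom_eq => V; exact: compmA.
Qed.

Notation ts V := (tc_str (X V)).
Notation Fg g := (pf_mor F g).

Definition limT_tr (A : lim_obj) V W (g : hom V W) :
    hom (Fg g (tanf (X W) (A W))) (tanf (X V) (A V)) :=
  fmap (tanf (X V)) (lo_tr A g) ∘ tm_dist (Fg g) (A W).

Program Definition limT_obj (A : lim_obj) : lim_obj :=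
  @LimObj (fun V => tanf (X V) (A V)) (limT_tr A) _ _ _.
Next Obligation.
move=> A V W g; apply: is_iso_comp; first exact/is_iso_fmap/lo_iso.
by have [+ _ _] := pf_strong F g; apply.
Qed.
Next Obligation.
move=> A V i ei; rewrite /limT_tr (lo_id _ ei).
by have /= -> := tcell_dist (pf_id F ei) (A V); rewrite comp1m.
Qed.
Next Obligation.
move=> A V W Y g h k e /=; rewrite /limT_tr -compmA.
have /= <- := tcell_dist (pf_comp F e) (A Y); rewrite compmA -fmapM lo_comp !fmapM -!compmA; congr (_ ∘ _); rewrite !compmA.
by have /= -> := tm_nat (Fg g) (lo_tr A h).
Qed.

Program Definition limT_map (A B : lim_obj) (u : lim_hom A B) :
    lim_hom (limT_obj A) (limT_obj B) :=
  @LimHom (limT_obj A) (limT_obj B) (fun V => fmap (tanf (X V)) (u V)) _.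
Next Obligation.
move=> A B u V W g; rewrite /= /limT_tr compmA -fmapM lh_tr fmapM -!compmA.
by have /= -> := tm_nat (Fg g) (u W).
Qed.

Program Definition limT : functor lim_cat lim_cat :=
  @Functor lim_cat lim_cat limT_obj limT_map _ _.
Next Obligation. by move=> A; apply: lim_hom_eq => V; exact: fmap1. Qed.
Next Obligation. by move=> A B C g f; apply: lim_hom_eq => V; exact: fmapM. Qed.

Lemma limT_tr_p (A : lim_obj) V W (g : hom V W) :
  tp (ts V) (A V) ∘ limT_tr A g = lo_tr A g ∘ fmap (Fg g) (tp (ts W) (A W)).
Proof.
rewrite /limT_tr compmA; have /= -> := tp_nat (ts V) (lo_tr A g).
by rewrite -compmA tm_p.
Qed.

Lemma limpow_tr_ex n (A : lim_obj) V W (g : hom V W) :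
  exists u : hom (Fg g (tpow (ts W) n (A W))) (tpow (ts V) n (A V)),
    (forall i, tpr (ts V) (A V) i ∘ u =
               limT_tr A g ∘ fmap (Fg g) (tpr (ts W) (A W) i)) /\
    tbase (ts V) n (A V) ∘ u =
    lo_tr A g ∘ fmap (Fg g) (tbase (ts W) n (A W)).
Proof.
by apply: tpow_lift => i; rewrite compmA limT_tr_p -compmA -fmapM tpr_p.
Qed.

Definition limpow_tr n (A : lim_obj) V W (g : hom V W) := sval (cid (limpow_tr_ex n A g)).

Lemma limpow_trE n (A : lim_obj) V W (g : hom V W) (i : 'I_n) :
  tpr (ts V) (A V) i ∘ limpow_tr n A g =
  limT_tr A g ∘ fmap (Fg g) (tpr (ts W) (A W) i).
Proof. by rewrite /limpow_tr; case: cid => u [/= ue _]; exact: ue. Qed.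

Lemma limpow_tr_base n (A : lim_obj) V W (g : hom V W) :
  tbase (ts V) n (A V) ∘ limpow_tr n A g =
  lo_tr A g ∘ fmap (Fg g) (tbase (ts W) n (A W)).
Proof. by rewrite /limpow_tr; case: cid => u []. Qed.

Program Definition limpow n (A : lim_obj) : lim_obj :=
  @LimObj (fun V => tpow (ts V) n (A V)) (limpow_tr n A) _ _ _.
Next Obligation.
move=> n A V W g; have [_ Hp _] := pf_strong F g.
apply: (@pbpower_iso _ _ _ _ _ _ _ _ _ _ _ _ _ _ _ (limT_tr A g) (lo_tr A g)
  (Hp n (A W)) (tpow_pb0 (X := X V) n (A V))).
- exact: (lo_iso (limT_obj A)).
- exact: lo_iso.
- exact: limT_tr_p.
- exact: limpow_trE.
- exact: limpow_tr_base.
Qed.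
Next Obligation.
move=> n A V i ei; apply: (@tpow_ext (X V)) => [j|].
  rewrite limpow_trE; have /= -> := lo_id (limT_obj A) ei.
  by have /= <- := tcell_nat (pf_id F ei) (tpr (ts V) (A V) j).
rewrite limpow_tr_base (lo_id A ei).
by have /= <- := tcell_nat (pf_id F ei) (tbase (ts V) n (A V)).
Qed.
Next Obligation.
move=> n A V W Y g h k e /=; apply: (@tpow_ext (X V)) => [j|].
  rewrite !compmA !limpow_trE -!compmA -fmapM limpow_trE.
  have /= <- := tcell_nat (pf_comp F e) (tpr (ts Y) (A Y) j).
  by rewrite fmapM !compmA; congr (_ ∘ _); exact: (lo_comp (limT_obj A)).
rewrite !compmA !limpow_tr_base -!compmA -fmapM limpow_tr_base.
have /= <- := tcell_nat (pf_comp F e) (tbase (ts Y) n (A Y)).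
by rewrite fmapM !compmA; congr (_ ∘ _); exact: lo_comp.
Qed.

Program Definition lim_p (A : lim_obj) : lim_hom (limT_obj A) A :=
  @LimHom (limT_obj A) A (fun V => tp (ts V) (A V)) _.
Next Obligation. by move=> A V W g; exact: limT_tr_p. Qed.

Program Definition lim_zero (A : lim_obj) : lim_hom A (limT_obj A) :=
  @LimHom A (limT_obj A) (fun V => tzero (ts V) (A V)) _.
Next Obligation.
move=> A V W g /=; have /= -> := tzero_nat (ts V) (lo_tr A g).
by rewrite /limT_tr -compmA tm_zero.
Qed.

Program Definition lim_pr n (A : lim_obj) (i : 'I_n) : lim_hom (limpow n A) (limT_obj A) :=
  @LimHom (limpow n A) (limT_obj A) (fun V => tpr (ts V) (A V) i) _.
Next Obligation. by move=> n A i V W g; exact: limpow_trE. Qed.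

Program Definition lim_base n (A : lim_obj) : lim_hom (limpow n A) A :=
  @LimHom (limpow n A) A (fun V => tbase (ts V) n (A V)) _.
Next Obligation. by move=> n A V W g; exact: limpow_tr_base. Qed.

Program Definition lim_plus (A : lim_obj) : lim_hom (limpow 2 A) (limT_obj A) :=
  @LimHom (limpow 2 A) (limT_obj A) (fun V => tplus (ts V) (A V)) _.
Next Obligation.
move=> A V W g /=.
have [u [ue ub]] := @tpow_lift (X V) 2 _ _ _ _ (tm_dist_tpr (Fg g) (A W) (n := 2)).
have [f2 [f2e f2b]] := @tpow_lift (X V) 2 (A V) (tpow (ts V) 2 (Fg g (A W)))
  (fun i => fmap (tanf (X V)) (lo_tr A g) ∘ tpr (ts V) _ i)
  (lo_tr A g ∘ tbase (ts V) 2 _) (fun i => ltac:(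
    by rewrite compmA; have /= -> := tp_nat (ts V) (lo_tr A g);
       rewrite -compmA tpr_p)).
rewrite /limT_tr -compmA (tm_plus ue) compmA -(tplus_nat f2e) -compmA.
congr (_ ∘ _); apply: (@tpow_ext (X V)) => [i|].
  by rewrite limpow_trE compmA f2e -compmA ue /limT_tr compmA.
by rewrite limpow_tr_base compmA f2b -compmA ub.
Qed.

Program Definition lim_lift (A : lim_obj) :
    lim_hom (limT_obj A) (limT_obj (limT_obj A)) :=
  @LimHom (limT_obj A) (limT_obj (limT_obj A)) (fun V => tlift (ts V) (A V)) _.
Next Obligation.
move=> A V W g; rewrite /= /limT_tr /= /limT_tr.
rewrite compmA; have /= -> := tlift_nat (ts V) (lo_tr A g).
by rewrite -compmA tm_lift fmapM -!compmA.
Qed.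

Program Definition lim_flip (A : lim_obj) :
    lim_hom (limT_obj (limT_obj A)) (limT_obj (limT_obj A)) :=
  @LimHom (limT_obj (limT_obj A)) (limT_obj (limT_obj A))
    (fun V => tflip (ts V) (A V)) _.
Next Obligation.
move=> A V W g; rewrite /= /limT_tr /= /limT_tr fmapM.
rewrite !compmA; have /= -> := tflip_nat (ts V) (lo_tr A g).
rewrite -!compmA; congr (_ ∘ _).
by have := tm_flip (Fg g) (A W); rewrite -!compmA.
Qed.

Lemma lim_pbpower (A E P : lim_cat) (p : hom E A) n (pr : 'I_n -> hom P E)
    (b : hom P A) :
  (forall V, is_pbpower (p V) (fun i => pr i V) (b V)) -> is_pbpower p pr b.
Proof.
move=> H; split=> [i|Y f x e].
  by apply: lim_hom_eq => V; have [+ _] := H V; apply.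
have ex V : exists k : hom (Y V) (P V),
    (forall i, pr i V ∘ k = f i V) /\ b V ∘ k = x V.
  have [_ /(_ (Y V) (fun i => f i V) (x V)) []] := H V.
    by move=> i; rewrite -(e i).
  by move=> k [? _]; exists k.
pose k V := sval (cid (ex V)).
have kE V i : pr i V ∘ k V = f i V by rewrite /k; case: cid => ? [].
have kb V : b V ∘ k V = x V by rewrite /k; case: cid => ? [].
have ktr V W (g : hom V W) : k V ∘ lo_tr Y g = lo_tr P g ∘ fmap (Fg g) (k W).
  apply: (pbpower_ext (H V)) => [i|].
    by rewrite !compmA kE !lh_tr -compmA -fmapM kE.
  by rewrite !compmA kb !lh_tr -compmA -fmapM kb.
exists (LimHom ktr); split; first split.
- by move=> i; apply: lim_hom_eq => V; exact: kE.
- by apply: lim_hom_eq => V; exact: kb.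
move=> k' [k'E k'b]; apply: lim_hom_eq => V; apply: (pbpower_ext (H V)) => [i|].
  by rewrite kE -(k'E i).
by rewrite kb -k'b.
Qed.

Lemma lim_pbpower_iter m (A E P : lim_cat) (p : hom E A) n (pr : 'I_n -> hom P E)
    (b : hom P A) :
  (forall V, is_pbpower_iter (tanf (X V)) m (p V) (fun i => pr i V) (b V)) ->
  is_pbpower_iter limT m p pr b.
Proof.
elim: m A E P p pr b => [|m IH] A E P p pr b H; first exact: lim_pbpower.
by apply: IH => V; exact: (H V).
Qed.

Lemma lim_equalizer (E A B : lim_cat) (e : hom E A) (f g : hom A B) :
  (forall V, is_equalizer (e V) (f V) (g V)) -> is_equalizer e f g.
Proof.
move=> H; split=> [|Y h fgh].
  by apply: lim_hom_eq => V; have [] := H V.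
have ex V : exists k : hom (Y V) (E V), e V ∘ k = h V.
  have [_ /(_ (Y V) (h V)) []] := H V.
    by have := congr1 (fun u : lim_hom _ _ => u V) fgh.
  by move=> k [? _]; exists k.
pose k V := sval (cid (ex V)).
have kE V : e V ∘ k V = h V by rewrite /k; case: cid.
have ktr V W (g' : hom V W) : k V ∘ lo_tr Y g' = lo_tr E g' ∘ fmap (Fg g') (k W).
  apply: (equalizer_ext (H V)).
  by rewrite !compmA kE !lh_tr -compmA -fmapM kE.
exists (LimHom ktr); split; first by apply: lim_hom_eq => V; exact: kE.
move=> k' k'E; apply: lim_hom_eq => V; apply: (equalizer_ext (H V)).
by rewrite kE -k'E.
Qed.

Lemma lim_homE (A B : lim_cat) (u v : hom A B) (V : U) : u = v -> u V = v V.
Proof. by move->. Qed.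

Program Definition lim_str : tangent_structure lim_cat :=
  @TangentStructure lim_cat limT lim_p lim_zero limpow (fun n A => @lim_pr n A)
    lim_base lim_plus lim_lift lim_flip
    _ _ _ _ _ _ _ _ _ _ _ _ _ _ _ _ _ _ _ _ _ _ _.
Next Obligation. by move=> A B f; apply: lim_hom_eq => V; exact: tp_nat. Qed.
Next Obligation. by move=> A B f; apply: lim_hom_eq => V; exact: tzero_nat. Qed.
Next Obligation.
move=> A B f f2 e; apply: lim_hom_eq => V; apply: tplus_nat => i.
exact: (lim_homE V (e i)).
Qed.
Next Obligation. by move=> A B f; apply: lim_hom_eq => V; exact: tlift_nat. Qed.
Next Obligation. by move=> A B f; apply: lim_hom_eq => V; exact: tflip_nat. Qed.
Next Obligation.
by move=> m n A; apply: lim_pbpower_iter => V; exact: tpow_pb.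
Qed.
Next Obligation. by move=> A; apply: lim_hom_eq => V; exact: tzero_over. Qed.
Next Obligation. by move=> A; apply: lim_hom_eq => V; exact: tplus_over. Qed.
Next Obligation.
move=> A Y x y z xy yz xyz xyz' e1 e2 e3 e4 e5 e6 e7 e8.
apply: lim_hom_eq => V.
exact: (tplusA (lim_homE V e1) (lim_homE V e2) (lim_homE V e3) (lim_homE V e4)
               (lim_homE V e5) (lim_homE V e6) (lim_homE V e7) (lim_homE V e8)).
Qed.
Next Obligation.
move=> A Y xy yx e1 e2; apply: lim_hom_eq => V.
exact: (tplusC (lim_homE V e1) (lim_homE V e2)).
Qed.
Next Obligation.
move=> A u e1 e2; apply: lim_hom_eq => V.
exact: (tplus0 (lim_homE V e1) (lim_homE V e2)).
Qed.
Next Obligation. by move=> A; apply: lim_hom_eq => V; exact: tlift_p. Qed.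
Next Obligation.
move=> A u e; apply: lim_hom_eq => V; apply: tlift_plus => i.
exact: (lim_homE V (e i)).
Qed.
Next Obligation. by move=> A; apply: lim_hom_eq => V; exact: tlift_zero. Qed.
Next Obligation. by move=> A; apply: lim_hom_eq => V; exact: tflip_p. Qed.
Next Obligation.
move=> A u e; apply: lim_hom_eq => V; apply: tflip_plus => i.
exact: (lim_homE V (e i)).
Qed.
Next Obligation. by move=> A; apply: lim_hom_eq => V; exact: tflip_zero. Qed.
Next Obligation. by move=> A; apply: lim_hom_eq => V; exact: tflip_flip. Qed.
Next Obligation. by move=> A; apply: lim_hom_eq => V; exact: tflip_lift. Qed.
Next Obligation. by move=> A; apply: lim_hom_eq => V; exact: tlift_lift. Qed.
Next Obligation. by move=> A; apply: lim_hom_eq => V; exact: tflip_braid. Qed.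
Next Obligation. by move=> A; apply: lim_hom_eq => V; exact: tflip_flip_lift. Qed.
Next Obligation.
move=> A u e1 e2; apply: lim_equalizer => V.
exact: (tlift_eq (lim_homE V e1) (lim_homE V e2)).
Qed.

Definition pseudolim : tancat := TanCat lim_str.

End PseudoLimit.

Local Open Scope classical_set_scope.
Local Open Scope ring_scope.

Section Smooth.
Context {R : realType}.
Implicit Types V W : normedModType R.

Fixpoint Ck V W (k : nat) (U : set V) (f : V -> W) : Prop :=
  if k is k'.+1 then
    (forall x, U x -> differentiable f x) /\
    forall v, Ck k' U (fun x => 'D_v f x)
  else forall x, U x -> {for x, continuous f}.

Definition smooth_on V W (U : set V) (f : V -> W) : Prop := forall k, Ck k U f.

Lemma CkW V W k (U : set V) (f : V -> W) : Ck k.+1 U f -> Ck k U f.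
Proof.
elim: k f => [|k IH] f [Df Hf]; first by move=> x /Df /differentiable_continuous.
by split=> // v; apply: IH; exact: Hf.
Qed.

Lemma Ck_cont V W k (U : set V) (f : V -> W) :
  Ck k U f -> forall x, U x -> {for x, continuous f}.
Proof. by elim: k => // k IH /CkW. Qed.

Lemma Ck_local V W k (U : set V) (f : V -> W) :
  (forall x, U x -> exists2 D, D x & Ck k D f) -> Ck k U f.
Proof.
elim: k f => [|k IH] f H; first by move=> x /H [D Dx]; apply.
split=> [x Ux|v]; first by have [D Dx [DD _]] := H x Ux; exact: DD x Dx.
by apply: IH => x /H [D Dx [_ Hv]]; exists D => //; exact: Hv.
Qed.

Lemma Ck_sub V W k (U O : set V) (f : V -> W) : O `<=` U -> Ck k U f -> Ck k O f.
Proof. by move=> OU H; apply: Ck_local => x /OU Ux; exists U. Qed.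

Lemma near_eq_diff V W (f g : V -> W) x :
  (\near x, f x = g x) -> differentiable f x -> differentiable g x.
Proof.
move=> fg /diff_locallyP[cd /eqaddoP ld].
have lg : g \o shift x = cst (g x) + 'd f x +o_ 0 id.
  apply/eqaddoP => e e0.
  have fg0 : \forall h \near (0 : V), f (h + x) = g (h + x).
    by have := fg; rewrite (near_shift 0) subr0.
  near=> h; rewrite -[X in `|X| <= _]/(g (h + x) - (g x + 'd f x h)).
  rewrite -(nbhs_singleton fg).
  have <- : f (h + x) = g (h + x) by near: h; exact: fg0.
  by near: h; exact: ld.
apply/diff_locallyP; rewrite (diff_unique cd lg); split => //.
Unshelve. all: by end_near. Qed.

Lemma Ck_eq V W k (U : set V) (f g : V -> W) : open U ->
  (forall x, U x -> f x = g x) -> Ck k U f -> Ck k U g.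
Proof.
move=> oU; elim: k f g => [|k IH] f g fg.
  move=> H x Ux; have fgx : \near x, f x = g x.
    by apply: filterS fg _; exact: open_nbhs_nbhs.
  have -> : {for x, continuous g} = (g y @[y --> x] --> f x) by rewrite (fg x Ux).
  apply: cvg_trans (H x Ux).
  by apply: near_eq_cvg; apply: filterS fgx => y /= ->.
move=> [Df Hf]; split=> [x Ux|v].
  apply: near_eq_diff (Df x Ux).
  by apply: filterS fg _; exact: open_nbhs_nbhs.
apply: IH (Hf v) => x Ux; apply: near_eq_derive.
by apply: filterS fg _; exact: open_nbhs_nbhs.
Unshelve. all: by end_near. Qed.

Lemma Ck_cst V W k (U : set V) (a : W) : Ck k U (cst a).
Proof.
elim: k a => [|k IH] a; first by move=> x _; exact: cst_continuous.
split=> [x _|v]; first exact: differentiable_cst.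
rewrite (_ : (fun x => _) = cst 0) //.
by apply/funext => x; rewrite derive_cst.
Qed.

Lemma CkD V W k (U : set V) (f g : V -> W) : open U ->
  Ck k U f -> Ck k U g -> Ck k U (fun x => f x + g x).
Proof.
move=> oU; elim: k f g => [|k IH] f g.
  by move=> Hf Hg x Ux; apply: continuousD; [exact: Hf|exact: Hg].
move=> [Df Hf] [Dg Hg]; split=> [x Ux|v].
  by apply: differentiableD; [exact: Df|exact: Dg].
apply: Ck_eq (IH _ _ (Hf v) (Hg v)) => // x Ux.
by rewrite deriveD //; apply: diff_derivable; [exact: Df|exact: Dg].
Qed.

Lemma Ck_sum V W k (U : set V) n (f : 'I_n -> V -> W) : open U ->
  (forall i, Ck k U (f i)) -> Ck k U (fun x => \sum_i f i x).
Proof.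
move=> oU H.
have -> : (fun x => \sum_i f i x) = \sum_i f i by apply/funext => x; rewrite fct_sumE.
apply: big_rec => [|i g _ Hg]; first exact: Ck_cst.
exact: CkD.
Qed.

Lemma Ck_linear V V' W k (U : set V) (f : V -> V') (L : {linear V' -> W}) : open U ->
  continuous L -> Ck k U f -> Ck k U (fun x => L (f x)).
Proof.
move=> oU cL; elim: k f => [|k IH] f.
  by move=> Hf x Ux; apply: continuous_comp; [exact: Hf|exact: cL].
have dL y : differentiable L y by exact: linear_differentiable.
move=> [Df Hf]; split=> [x Ux|v].
  by apply: differentiable_comp; [exact: Df|exact: dL].
apply: Ck_eq (IH _ (Hf v)) => // x Ux.
rewrite !deriveE; [|exact: differentiable_comp (Df x Ux) (dL _)|exact: Df].
by rewrite (diff_comp (Df x Ux) (dL _)) /= diff_lin.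
Qed.

Lemma Ck_lin V V' W k (U : set V) (f : V -> V') (L : V' -> W) : open U ->
  linear L -> continuous L -> Ck k U f -> Ck k U (fun x => L (f x)).
Proof.
move=> oU lL; pose LM := GRing.isLinear.Build _ _ _ _ _ lL.
pose L' : {linear _ -> _} := HB.pack L LM.
exact: (@Ck_linear _ _ _ _ _ _ L').
Qed.

Lemma CkM V k (U : set V) (f g : V -> R) : open U ->
  Ck k U f -> Ck k U g -> Ck k U (fun x => f x * g x).
Proof.
move=> oU; elim: k f g => [|k IH] f g.
  by move=> Hf Hg x Ux; apply: continuousM; [exact: Hf|exact: Hg].
move=> Hf Hg; have [Df H'f] := Hf; have [Dg H'g] := Hg; split=> [x Ux|v].
  by apply: differentiableM; [exact: Df|exact: Dg].
have := CkD oU (IH _ _ (CkW Hf) (H'g v)) (IH _ _ (CkW Hg) (H'f v)).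
apply: Ck_eq => // x Ux.
by rewrite deriveM //; apply: diff_derivable; [exact: Df|exact: Dg].
Qed.

Lemma Ck_coord V m k (U : set V) (f : V -> 'rV[R]_m) j : open U ->
  Ck k U f -> Ck k U (fun x => f x ord0 j).
Proof.
move=> oU; apply: (@Ck_lin V _ _ k U f (fun N => N ord0 j)) => //.
  by move=> a x y; rewrite !mxE.
exact: coord_continuous.
Qed.

Lemma Ck_row V m k (U : set V) (f : V -> 'rV[R]_m) : open U ->
  (forall j, Ck k U (fun x => f x ord0 j)) -> Ck k U f.
Proof.
move=> oU H.
have -> : f = fun x => \sum_j f x ord0 j *: delta_mx ord0 j.
  by apply/funext => x; exact: row_sum_delta.
apply: Ck_sum => // j.
apply: (@Ck_lin V _ _ k U (fun x => f x ord0 j) (fun a : R => a *: delta_mx ord0 j)) => //.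
  by move=> a x y; rewrite scalerDl scalerA.
exact: scalel_continuous.
Qed.

Lemma CkZ V m k (U : set V) (a : V -> R) (f : V -> 'rV[R]_m) : open U ->
  Ck k U a -> Ck k U f -> Ck k U (fun x => a x *: f x).
Proof.
move=> oU Ha Hf; apply: Ck_row => // j.
rewrite (_ : (fun x => _) = fun x => a x * f x ord0 j).
  by apply: CkM => //; exact: Ck_coord.
by apply/funext => x; rewrite mxE.
Qed.

Lemma derive_row n W (f : 'rV[R]_n -> W) x v : differentiable f x ->
  'D_v f x = \sum_j v ord0 j *: 'D_(delta_mx ord0 j) f x.
Proof.
move=> Df; rewrite deriveE // {1}[v]row_sum_delta linear_sum.
by apply: eq_bigr => j _; rewrite linearZ /= deriveE.
Qed.

Lemma Ck_comp V n m k (U : set V) (U' : set 'rV[R]_n) (g : V -> 'rV[R]_n)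
    (f : 'rV[R]_n -> 'rV[R]_m) : open U ->
  (forall x, U x -> U' (g x)) -> Ck k U' f -> Ck k U g -> Ck k U (f \o g).
Proof.
move=> oU UU'; elim: k f => [|k IH] f.
  move=> Hf Hg x Ux; apply: continuous_comp; first exact: Hg.
  exact/Hf/UU'.
move=> [Df Hf] Hg; have [Dg H'g] := Hg.
split=> [x Ux|v]; first exact: differentiable_comp (Dg x Ux) (Df _ (UU' x Ux)).
apply: (@Ck_eq _ _ _ _ (fun x => \sum_j ('D_v g x) ord0 j *:
   ('D_(delta_mx ord0 j) f \o g) x)) => // [x Ux|].
  rewrite [RHS]deriveE; last exact: differentiable_comp (Dg x Ux) (Df _ (UU' x Ux)).
  rewrite (diff_comp (Dg x Ux) (Df _ (UU' x Ux))) /=.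
  rewrite -(deriveE v (Dg x Ux)) -(deriveE _ (Df _ (UU' x Ux))).
  by rewrite derive_row //; exact/Df/UU'.
apply: Ck_sum => // j; apply: CkZ => //; first exact: (Ck_coord j oU (H'g v)).
by apply: IH; [exact: Hf|exact: CkW].
Qed.

Lemma Ck_row_mx V n m k (U : set V) (f : V -> 'rV[R]_n) (g : V -> 'rV[R]_m) :
  open U -> Ck k U f -> Ck k U g -> Ck k U (fun x => row_mx (f x) (g x)).
Proof.
move=> oU Hf Hg; apply: Ck_row => // j; case: (split_ordP j) => i ->.
  rewrite (_ : (fun x => _) = fun x => f x ord0 i); first exact: Ck_coord.
  by apply/funext => x; rewrite row_mxEl.
rewrite (_ : (fun x => _) = fun x => g x ord0 i); first exact: Ck_coord.
by apply/funext => x; rewrite row_mxEr.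
Qed.

Lemma Ck_id V k (U : set V) : Ck k U id.
Proof.
case: k => [|k]; first by move=> x _.
split=> [x _|v]; first exact: ex_diff.
rewrite (_ : (fun x => _) = cst v); first exact: Ck_cst.
by apply/funext => x; rewrite derive_id.
Qed.

Lemma Ck_lsubmx n m k (U : set 'rV[R]_(n + m)) : open U ->
  Ck k U (lsubmx : 'rV[R]_(n + m) -> 'rV[R]_n).
Proof.
move=> oU; have lL : linear (lsubmx : 'rV[R]_(n + m) -> _).
  by move=> a x y; rewrite linearP.
exact: (Ck_lin oU lL (@continuous_lsubmx _ _ _ _) (@Ck_id _ k U)).
Qed.

Lemma Ck_rsubmx n m k (U : set 'rV[R]_(n + m)) : open U ->
  Ck k U (rsubmx : 'rV[R]_(n + m) -> 'rV[R]_m).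
Proof.
move=> oU; have lL : linear (rsubmx : 'rV[R]_(n + m) -> _).
  by move=> a x y; rewrite linearP.
exact: (Ck_lin oU lL (@continuous_rsubmx _ _ _ _) (@Ck_id _ k U)).
Qed.

Definition tangent_map n m (f : 'rV[R]_n -> 'rV[R]_m) (y : 'rV[R]_(n + n)) :
    'rV[R]_(m + m) :=
  row_mx (f (lsubmx y)) ('D_(rsubmx y) f (lsubmx y)).

Lemma open_lsubmx n m (U : set 'rV[R]_n) : open U ->
  open [set y : 'rV[R]_(n + m) | U (lsubmx y)].
Proof.
by move=> oU; apply: open_comp oU => y _; exact: continuous_lsubmx.
Qed.

Lemma smooth_tangent_map n m (U : set 'rV[R]_n) (f : 'rV[R]_n -> 'rV[R]_m) :
  open U -> smooth_on U f ->
  smooth_on [set y : 'rV[R]_(n + n) | U (lsubmx y)] (tangent_map f).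
Proof.
move=> oU Hf k; have oTU := open_lsubmx (m := n) oU.
apply: Ck_row_mx => //.
  by apply: Ck_comp (Hf k) (Ck_lsubmx _ oTU).
apply: (@Ck_eq _ _ _ _ (fun y => \sum_j (rsubmx y) ord0 j *:
   ('D_(delta_mx ord0 j) f \o lsubmx) y)) => // [y Uy|].
  by rewrite derive_row //; have [+ _] := Hf 1%N; apply.
apply: Ck_sum => // j; apply: CkZ => //; first exact/Ck_coord/Ck_rsubmx.
have [_ Hj] := Hf k.+1.
by apply: Ck_comp (Hj _) (Ck_lsubmx _ oTU).
Qed.

End Smooth.

Section Charts.
Context {R : realType}.

(* The coordinate expression of [f] with respect to a chart [cX] with domain [dX]
   and a chart [cY] with domain [dY]; it is meaningful on [chart_dom]. *)
Section Expr.
Variables (X Y : Type) (n m : nat).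
Variables (dX : set X) (cX : X -> 'rV[R]_n) (dY : set Y) (cY : Y -> 'rV[R]_m).

Definition chart_dom (f : X -> Y) : set 'rV[R]_n := cX @` (dX `&` f @^-1` dY).

Definition chart_expr (f : X -> Y) (y : 'rV[R]_n) : 'rV[R]_m :=
  xget 0 [set z | exists x, [/\ dX x, dY (f x), cX x = y & z = cY (f x)]].

Definition smooth_in_charts (f : X -> Y) : Prop :=
  open (chart_dom f) /\ smooth_on (chart_dom f) (chart_expr f).

Hypothesis cX_inj : forall x y, dX x -> dX y -> cX x = cX y -> x = y.

Lemma chart_exprE f x : dX x -> dY (f x) -> chart_expr f (cX x) = cY (f x).
Proof.
move=> dx dy; rewrite /chart_expr; case: xgetP => [_ -> [z [dz dfz czx ->]]|].
  by rewrite (cX_inj dz dx czx).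
by move=> /(_ (cY (f x))) []; exists x.
Qed.

Lemma smooth_in_charts_local f :
  (forall x, dX x -> dY (f x) -> exists (W : set 'rV[R]_n) phi,
    [/\ open W, W (cX x), W `<=` cX @` dX,
        forall y, dX y -> W (cX y) -> dY (f y) /\ phi (cX y) = cY (f y) &
        smooth_on W phi]) ->
  smooth_in_charts f.
Proof.
move=> H.
have sub W phi : W `<=` cX @` dX ->
    (forall y, dX y -> W (cX y) -> dY (f y) /\ phi (cX y) = cY (f y)) ->
    W `<=` chart_dom f.
  by move=> Wd We z Wz; have [y dy yz] := Wd z Wz; exists y => //;
     split=> //; have [] := We y dy; rewrite ?yz.
split.
  rewrite openE => _ [x [dx dfx] <-]; have [W [phi [oW Wx Wd We _]]] := H x dx dfx.
  by rewrite /interior; apply: filterS (sub _ _ Wd We) _; exact: open_nbhs_nbhs.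
move=> k; apply: Ck_local => _ [x [dx dfx] <-].
have [W [phi [oW Wx Wd We Sphi]]] := H x dx dfx.
exists W => //; apply: Ck_eq (Sphi k) => // z Wz.
have [y dy yz] := Wd z Wz; rewrite -yz in Wz *.
by have [dfy ->] := We y dy Wz; rewrite chart_exprE.
Qed.

End Expr.

Lemma open_preimage_cont (V W : normedModType R) (U : set V) (D : set W) (f : V -> W) :
  open U -> (forall x, U x -> {for x, continuous f}) -> open D ->
  open (U `&` f @^-1` D).
Proof.
move=> oU cf oD; rewrite openE => x [Ux Dx]; apply: filterI.
  exact: open_nbhs_nbhs.
by apply: (cf x Ux); exact: open_nbhs_nbhs.
Qed.

Section Comp.
Variables (X Y Z : Type) (n m p : nat).
Variables (dX : set X) (cX : X -> 'rV[R]_n) (dY : set Y) (cY : Y -> 'rV[R]_m)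
  (dZ : set Z) (cZ : Z -> 'rV[R]_p).
Hypothesis cX_inj : forall x y, dX x -> dX y -> cX x = cX y -> x = y.
Hypothesis cY_inj : forall x y, dY x -> dY y -> cY x = cY y -> x = y.
Variables (f : X -> Y) (g : Y -> Z).
Hypothesis sf : smooth_in_charts dX cX dY cY f.
Hypothesis sg : smooth_in_charts dY cY dZ cZ g.

Let W := chart_dom dX cX dY f `&`
  chart_expr dX cX dY cY f @^-1` chart_dom dY cY dZ g.
Let phi := chart_expr dY cY dZ cZ g \o chart_expr dX cX dY cY f.

Lemma chart_comp_local x : dX x -> dY (f x) -> dZ (g (f x)) ->
  [/\ open W, W (cX x), W `<=` cX @` dX,
      forall y, dX y -> W (cX y) -> dZ (g (f y)) /\ phi (cX y) = cZ (g (f y)) &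
      smooth_on W phi].
Proof.
move=> dx dfx dgx; have [of_ sf'] := sf; have [og sg'] := sg.
have oW : open W by apply: open_preimage_cont => //; exact: (Ck_cont (sf' 0%N)).
split=> //.
- split; first by exists x.
  by rewrite /preimage /= chart_exprE //; exists (f x).
- by move=> _ [[y [dy _] <-] _]; exists y.
- move=> y dy [[y' [dy' dfy'] e]]; have e' := cX_inj dy' dy e; subst y'.
  rewrite /preimage /= chart_exprE // => -[z [dz dgz] ze].
  have e' := cY_inj dz dfy' ze; subst z; split=> //.
  by rewrite /phi /= !chart_exprE.
move=> k; apply: (@Ck_comp _ _ _ _ _ W (chart_dom dY cY dZ g)) => //.
- by move=> y [].
- by apply: Ck_sub (sf' k) => y [].
Qed.

Lemma derive_chart_comp x v : dX x -> dY (f x) -> dZ (g (f x)) ->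
  'D_v (chart_expr dX cX dZ cZ (g \o f)) (cX x) =
  'D_('D_v (chart_expr dX cX dY cY f) (cX x)) (chart_expr dY cY dZ cZ g) (cY (f x)).
Proof.
move=> dx dfx dgx; have [oW Wx Wd We Sphi] := chart_comp_local dx dfx dgx.
have -> : 'D_v (chart_expr dX cX dZ cZ (g \o f)) (cX x) = 'D_v phi (cX x).
  apply: near_eq_derive; apply: filterS (open_nbhs_nbhs (conj oW Wx)) => z Wz.
  have [y dy yz] := Wd z Wz; rewrite -yz in Wz *; have [dgy ->] := We y dy Wz.
  by rewrite (chart_exprE _ cX_inj (f := g \o f)).
have [_ sf'] := sf; have [_ sg'] := sg.
have [Df _] := sf' 1%N; have [Dg _] := sg' 1%N.
have {}Df : differentiable (chart_expr dX cX dY cY f) (cX x) by apply: Df; exists x.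
have ex : chart_expr dX cX dY cY f (cX x) = cY (f x) by rewrite chart_exprE.
have {}Dg : differentiable (chart_expr dY cY dZ cZ g) (chart_expr dX cX dY cY f (cX x)).
  by rewrite ex; apply: Dg; exists (f x).
rewrite /phi -ex (deriveE _ (differentiable_comp Df Dg)) (diff_comp Df Dg) /=.
by rewrite -(deriveE _ Df) -(deriveE _ Dg).
Qed.

End Comp.
End Charts.

(* A manifold is given by a set with an atlas, from which it takes its topology;
   the dimension is only locally constant. *)
Record atlas (R : realType) := Atlas {
  pts :> Type;
  cidx : Type;
  cdim : cidx -> nat;
  cdom : cidx -> set pts;
  cmap : forall i, pts -> 'rV[R]_(cdim i);
  cmap_inj : forall i x y, cdom i x -> cdom i y -> cmap i x = cmap i y -> x = y;
  cdom_cover : forall x, exists i, cdom i x;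
  cmap_compat : forall i j,
    smooth_in_charts (cdom i) (cmap i) (cdom j) (cmap j) id }.

Arguments cdom {R} _ _.
Arguments cmap {R} _ _.

Section AtlasTopology.
Context {R : realType}.
Variable M : atlas R.

HB.instance Definition _ := gen_eqMixin (pts M).
HB.instance Definition _ := gen_choiceMixin (pts M).

Definition atlas_open (A : set M) : Prop :=
  forall i, open (cmap M i @` (A `&` cdom M i)).

Lemma atlas_openT : atlas_open setT.
Proof.
move=> i; rewrite setTI; have [+ _] := cmap_compat i i.
by rewrite /chart_dom preimage_id setIid.
Qed.

Lemma atlas_openI : setI_closed atlas_open.
Proof.
move=> A B oA oB i.
suff -> : cmap M i @` (A `&` B `&` cdom M i) =
  cmap M i @` (A `&` cdom M i) `&` cmap M i @` (B `&` cdom M i) by exact: openI.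
apply/seteqP; split=> [_ [x [[Ax Bx] dx] <-]|_ [[x [Ax dx] <-] [y [By dy] e]]].
  by split; exists x.
by have e' := cmap_inj dy dx e; subst y; exists x.
Qed.

Lemma atlas_open_bigcup (I : Type) (f : I -> set M) :
  (forall i, atlas_open (f i)) -> atlas_open (\bigcup_i f i).
Proof.
move=> H i.
suff -> : cmap M i @` ((\bigcup_k f k) `&` cdom M i) =
  \bigcup_k (cmap M i @` (f k `&` cdom M i)).
  by apply: bigcup_open => k _; exact: H.
apply/seteqP; split=> [_ [x [[k _ fx] dx] <-]|_ [k _ [x [fx dx] <-]]].
  by exists k => //; exists x.
by exists x => //; split=> //; exists k.
Qed.

HB.instance Definition _ := isOpenTopological.Build (pts M)
  atlas_openT atlas_openI atlas_open_bigcup.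

Lemma atlas_openE (A : set M) : open A = atlas_open A.
Proof. by []. Qed.

End AtlasTopology.

Record manifold (R : realType) := Manifold {
  man_atlas :> atlas R;
  man_hausdorff : hausdorff_space man_atlas;
  man_second_countable : @second_countable man_atlas }.

Section AtlasFacts.
Context {R : realType}.
Implicit Types M N P : atlas R.

Definition smooth_map M N (f : M -> N) : Prop :=
  forall i j, smooth_in_charts (cdom M i) (cmap M i) (cdom N j) (cmap N j) f.

Lemma smooth_map_comp M N P (f : M -> N) (g : N -> P) :
  smooth_map f -> smooth_map g -> smooth_map (g \o f).
Proof.
move=> sf sg i k; apply: smooth_in_charts_local => [|x dx dgf].
  exact: cmap_inj.
have [j dfx] := cdom_cover (f x).
by do 2!eexists; exact: (chart_comp_local (@cmap_inj _ _ _) (@cmap_inj _ _ _)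
  (sf i j) (sg j k) dx dfx dgf).
Qed.

Lemma smooth_map_id M : smooth_map (@id M).
Proof. exact: cmap_compat. Qed.

Lemma open_cdom M i : open (cmap M i @` cdom M i).
Proof.
have [+ _] := cmap_compat i i.
by rewrite /chart_dom preimage_id setIid.
Qed.

Lemma smooth_map_open M N (f : M -> N) (A : set N) :
  smooth_map f -> open A -> open (f @^-1` A).
Proof.
move=> sf oA; rewrite atlas_openE => i; rewrite openE => _ [x [Ax dx] <-].
have [j dfx] := cdom_cover (f x).
have [p1 s1] := sf i j.
have := open_preimage_cont p1 (Ck_cont (s1 0%N)) (oA j).
set D := (X in open X) => oD; rewrite /interior.
have Dx : D (cmap M i x).
  split; first by exists x.
  by rewrite /preimage /= (chart_exprE _ (@cmap_inj _ _ _)) //; exists (f x).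
apply: filterS (open_nbhs_nbhs (conj oD Dx)).
move=> _ [[y [dy dfy] <-]].
rewrite /preimage /= (chart_exprE _ (@cmap_inj _ _ _)) // => -[z [Az dz] e].
by exists y => //; split=> //; rewrite /preimage /= -(cmap_inj dz dfy e).
Qed.

Lemma open_chart_preimage M i (W : set 'rV[R]_(cdim i)) :
  open W -> open (cdom M i `&` cmap M i @^-1` W).
Proof.
move=> oW; rewrite atlas_openE => j; rewrite openE => _ [x [[dx Wx] dxj] <-].
have [p1 s1] := cmap_compat (a := M) j i.
have := open_preimage_cont p1 (Ck_cont (s1 0%N)) oW.
set D := (X in open X) => oD; rewrite /interior.
have Dx : D (cmap M j x).
  split; first by exists x.
  by rewrite /preimage /= (chart_exprE _ (@cmap_inj _ _ _) (f := id)).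
apply: filterS (open_nbhs_nbhs (conj oD Dx)).
move=> _ [[y [dy dfy] <-]].
by rewrite /preimage /= (chart_exprE _ (@cmap_inj _ _ _) (f := id)) //; exists y.
Qed.

Lemma open_cdom_set M i : open (cdom M i).
Proof. by have := @open_chart_preimage M i _ (@openT _); rewrite preimage_setT setIT. Qed.

Lemma derive_comp M N P (f : M -> N) (g : N -> P) i j k x v :
  smooth_map f -> smooth_map g ->
  cdom M i x -> cdom N j (f x) -> cdom P k (g (f x)) ->
  'D_v (chart_expr (cdom M i) (cmap M i) (cdom P k) (cmap P k) (g \o f)) (cmap M i x) =
  'D_('D_v (chart_expr (cdom M i) (cmap M i) (cdom N j) (cmap N j) f) (cmap M i x))
     (chart_expr (cdom N j) (cmap N j) (cdom P k) (cmap P k) g) (cmap N j (f x)).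
Proof.
move=> sf sg; apply: derive_chart_comp; try exact: cmap_inj.
  exact: sf.
exact: sg.
Qed.

Lemma derive_id_chart M i x v : cdom M i x ->
  'D_v (chart_expr (cdom M i) (cmap M i) (cdom M i) (cmap M i) id) (cmap M i x) = v.
Proof.
move=> dx; rewrite -[RHS](derive_id (cmap M i x) v); apply: near_eq_derive.
have Hx : (cmap M i @` cdom M i) (cmap M i x) by exists x.
apply: filterS (open_nbhs_nbhs (conj (@open_cdom M i) Hx)) => _ [y dy <-].
by rewrite (chart_exprE _ (@cmap_inj _ _ _) (f := id)).
Qed.

Lemma atlas_hausdorff M :
  (forall x y : M, x <> y -> exists A B : set M,
     [/\ open A, open B, A x, B y & A `&` B = set0]) ->
  hausdorff_space M.
Proof.
move=> H; rewrite open_hausdorff => x y /eqP /H [A [B [opA opB Ax By AB]]].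
by exists (A, B); rewrite ?inE //= AB eqxx.
Qed.

Lemma hausdorff_sep M (x y : M) : hausdorff_space M -> x <> y ->
  exists A B : set M, [/\ open A, open B, A x, B y & A `&` B = set0].
Proof.
rewrite open_hausdorff => H /eqP /H [[A B] /= [Ax By] [opA opB /eqP AB]].
by exists A, B; rewrite !inE in Ax By *.
Qed.

Lemma rV_sep n (x y : 'rV[R]_n) : x <> y -> exists A B : set 'rV[R]_n,
     [/\ open A, open B, A x, B y & A `&` B = set0].
Proof.
move=> /eqP; have := @norm_hausdorff _ 'rV[R]_n; rewrite open_hausdorff => H /H.
move=> [[A B] /= [Ax By] [opA opB /eqP AB]].
by exists A, B; rewrite !inE in Ax By *.
Qed.

Definition rat_box n (q : 'rV[rat]_n * 'rV[rat]_n) : set 'rV[R]_n :=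
  [set v | forall j, ratr (q.1 ord0 j) < v ord0 j < ratr (q.2 ord0 j)].

Lemma open_rat_box n (q : 'rV[rat]_n * 'rV[rat]_n) : open (rat_box q).
Proof.
rewrite openE => v bv.
rewrite /interior -[nbhs v]/(nbhs (v : 'M[R]_(1, n))).
exists (fun i j => `]ratr (q.1 ord0 j), ratr (q.2 ord0 j)[%classic) => [i j|w Hw j].
  apply: open_nbhs_nbhs; split; first exact: interval_open.
  by rewrite /= in_itv /= !ord1; exact: (bv j).
by have := Hw ord0 j; rewrite /= in_itv.
Qed.

Lemma rat_box_basis n (v : 'rV[R]_n) (A : set 'rV[R]_n) : nbhs v A ->
  exists q, rat_box q v /\ rat_box q `<=` A.
Proof.
move=> /nbhs_ballP [e /= e0 sub].
have lt1 j : v ord0 j - e < v ord0 j by rewrite ltrBlDr ltrDl.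
have lt2 j : v ord0 j < v ord0 j + e by rewrite ltrDl.
pose a j := sval (cid (rat_in_itvoo (lt1 j))).
pose b j := sval (cid (rat_in_itvoo (lt2 j))).
have aP j : v ord0 j - e < ratr (a j) < v ord0 j.
  by rewrite /a; case: cid => q /=; rewrite in_itv.
have bP j : v ord0 j < ratr (b j) < v ord0 j + e.
  by rewrite /b; case: cid => q /=; rewrite in_itv.
exists (\row_j a j, \row_j b j); split=> [j|w Hw].
  by rewrite /= !mxE; have /andP[_ ->] := aP j; have /andP[-> _] := bP j.
apply: sub; split=> // i j; rewrite ord1 /ball /= ltr_distlC.
have /= := Hw j; rewrite !mxE => /andP[aw wb].
have /andP[va _] := aP j; have /andP[_ bv] := bP j.
by rewrite (lt_trans va aw) (lt_trans wb bv).
Qed.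

Lemma second_countable_charts M : @second_countable M <->
  exists2 C : set (cidx M), countable C & forall x, exists2 i, C i & cdom M i x.
Proof.
split=> [[B cB [oB bB]]|[C cC Ccover]].
  pose pick (A : set M) : option (cidx M) :=
    if pselect (exists j, A `<=` cdom M j) is left e then Some (sval (cid e)) else None.
  exists (\bigcup_(A in B) [set i | pick A = Some i]).
    apply: bigcup_countable => // A _; case: (pick A) => [j|].
      by apply: (@sub_countable _ _ _ [set j]) => //; apply: subset_card_le => k [->].
    by apply: (@sub_countable _ _ _ set0) => //; apply: subset_card_le => k.
  move=> x; have [i dx] := cdom_cover x.
  have [|A [BA Ax] Ai] := bB x (cdom M i).
    by apply: open_nbhs_nbhs; split=> //; exact: open_cdom_set.
  exists (sval (cid (ex_intro (fun j => A `<=` cdom M j) i Ai))); last first.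
    by case: cid => j /= ; exact.
  exists A => //=; rewrite /pick; case: pselect => [e|[]]; last by exists i.
  by congr (Some (sval (cid _))); exact: Prop_irrelevance.
pose bas i (q : 'rV[rat]_(cdim i) * 'rV[rat]_(cdim i)) :=
  cdom M i `&` cmap M i @^-1` rat_box q.
exists (\bigcup_(i in C) range (bas i)).
  apply: bigcup_countable => // i _.
  apply: (@sub_countable _ _ _ [set: _]); [exact: card_image_le|exact: countableP].
split=> [_ [i _ [q _ <-]]|x A /= nA].
  exact/open_chart_preimage/open_rat_box.
have [i Ci dx] := Ccover x.
rewrite nbhsE /= in nA; have [A' [oA' A'x] A'A] := nA.
have : nbhs (cmap M i x) (cmap M i @` (A' `&` cdom M i)).
  by apply: open_nbhs_nbhs; split; [exact: oA'|exists x].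
move=> /rat_box_basis [q [qx qA]].
exists (bas i q); first by split=> //; exists i => //; exists q.
move=> y [dy /qA [z [A'z dz] e]]; apply: A'A.
by rewrite -(cmap_inj dz dy e).
Qed.

End AtlasFacts.

Section SMan.
Context {R : realType}.
Implicit Types M N P : manifold R.

Record smap M N := Smap {
  smap_fun :> M -> N;
  smap_smooth : smooth_map smap_fun }.

Lemma smap_eq M N (f g : smap M N) : (forall x, f x = g x) -> f = g.
Proof.
case: f g => [f sf] [g sg] /= /funext e; case: g / e sg => sg.
by congr Smap; exact: Prop_irrelevance.
Qed.

Definition smap_id M : smap M M := Smap (@smooth_map_id _ M).

Definition smap_comp M N P (g : smap N P) (f : smap M N) : smap M P :=
  Smap (smooth_map_comp (smap_smooth f) (smap_smooth g)).

Program Definition SMan : category :=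
  @Category (manifold R) smap smap_id smap_comp _ _ _.
Next Obligation. by move=> M N f; exact: smap_eq. Qed.
Next Obligation. by move=> M N f; exact: smap_eq. Qed.
Next Obligation. by move=> M N P Q h g f; exact: smap_eq. Qed.

End SMan.
Arguments SMan : clear implicits.

Section OpenSubmanifold.
Context {R : realType}.
Variable M : manifold R.

Record opens := Opens {
  oset :> set M;
  oset_open : open oset }.
Arguments oset_open _ : clear implicits.

Section Sub.
Variable V : opens.

Let sdom (i : cidx M) : set {x : M | oset V x} := fun x => cdom M i (sval x).
Let smapc (i : cidx M) (x : {x : M | oset V x}) := cmap M i (sval x).

Let sval_eq (x y : {x : M | oset V x}) : sval x = sval y -> x = y.
Proof.
by case: x y => [x Vx] [y Vy] /= e; subst y; congr exist; exact: Prop_irrelevance.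
Qed.

Let smapc_inj i x y : sdom i x -> sdom i y -> smapc i x = smapc i y -> x = y.
Proof. by move=> dx dy e; exact/sval_eq/(cmap_inj dx dy e). Qed.

Lemma smooth_restrict (N : manifold R) (f : M -> N) i j : smooth_map f ->
  smooth_in_charts (sdom i) (smapc i) (cdom N j) (cmap N j) (f \o sval).
Proof.
move=> sf; apply: smooth_in_charts_local => [|x dx dfx]; first exact: smapc_inj.
have [p1 s1] := sf i j.
exists (chart_dom (cdom M i) (cmap M i) (cdom N j) f `&` cmap M i @` (oset V `&` cdom M i)).
exists (chart_expr (cdom M i) (cmap M i) (cdom N j) (cmap N j) f).
split.
- by apply: openI => //; have := oset_open V; rewrite atlas_openE; apply.
- by split; [exists (sval x)|exists (sval x) => //; split=> //; exact: svalP].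
- by move=> _ [_ [y [Vy dy] <-]]; exists (exist _ y Vy).
- move=> y dy [[z [dz dfz] e] _]; have e' := cmap_inj dz dy e; subst z.
  by split=> //; rewrite /smapc chart_exprE //; exact: cmap_inj.
- by move=> k; apply: Ck_sub (s1 k) => y [].
Qed.

Lemma opensub_compat i j : smooth_in_charts (sdom i) (smapc i) (sdom j) (smapc j) id.
Proof.
exact: (@smooth_restrict M id i j (@smooth_map_id _ M)).
Qed.

Lemma opensub_cover (x : {x : M | oset V x}) : exists i, sdom i x.
Proof. exact: cdom_cover. Qed.

Definition opensub_atlas : atlas R := Atlas smapc_inj opensub_cover opensub_compat.

Lemma sval_smooth : smooth_map (sval : opensub_atlas -> M).
Proof. by move=> i j; exact: (@smooth_restrict M id i j (@smooth_map_id _ M)). Qed.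

Lemma opensub_hausdorff : hausdorff_space opensub_atlas.
Proof.
apply: atlas_hausdorff => x y xy.
have [|A [B [opA opB Ax By AB]]] := @hausdorff_sep _ M (sval x) (sval y) (@man_hausdorff _ M).
  by move=> /sval_eq.
exists (sval @^-1` A), (sval @^-1` B); split=> //.
- exact: smooth_map_open sval_smooth opA.
- exact: smooth_map_open sval_smooth opB.
by rewrite -preimage_setI AB preimage_set0.
Qed.

Lemma opensub_second_countable : @second_countable opensub_atlas.
Proof.
have /second_countable_charts[C cC CP] := @man_second_countable _ M.
by apply/second_countable_charts; exists C => // x; exact: CP.
Qed.

Definition opensub : manifold R := Manifold opensub_hausdorff opensub_second_countable.

Definition opensub_in : smap opensub M := Smap (sval_smooth : @smooth_map _ opensub M _).

End Sub.

Lemma opensub_incl_smooth (V W : opens) (VW : V `<=` W) :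
  @smooth_map _ (opensub V) (opensub W)
    (fun x => exist _ (sval x) (VW _ (svalP x))).
Proof. by move=> i j; exact: (@smooth_restrict V M id i j (@smooth_map_id _ M)). Qed.

Definition opensub_incl (V W : opens) (VW : V `<=` W) : smap (opensub V) (opensub W) :=
  Smap (opensub_incl_smooth VW).

Definition opens_cap (V W : opens) : opens := Opens (openI (oset_open V) (oset_open W)).

Definition opens_cup (V W : opens) : opens := Opens (openU (oset_open V) (oset_open W)).

End OpenSubmanifold.
Arguments oset_open {R M} _.

Section Euclidean.
Context {R : realType}.
Variable n : nat.

Let edom (i : unit) : set 'rV[R]_n := setT.
Let ecmap (i : unit) (x : 'rV[R]_n) := x.

Lemma euclid_compat i j : smooth_in_charts (edom i) (ecmap i) (edom j) (ecmap j) id.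
Proof.
apply: smooth_in_charts_local => // x _ _; exists setT, id; split=> //.
- exact: openT.
- by move=> y _; exists y.
- by move=> k; exact: Ck_id.
Qed.

Lemma euclid_inj i x y : edom i x -> edom i y -> ecmap i x = ecmap i y -> x = y.
Proof. by []. Qed.

Lemma euclid_cover x : exists i, edom i x.
Proof. by exists tt. Qed.

Definition euclid_atlas : atlas R :=
  @Atlas R 'rV[R]_n unit (fun=> n) edom ecmap euclid_inj euclid_cover euclid_compat.

Lemma euclid_openE (A : set euclid_atlas) : open A = open (A : set 'rV[R]_n).
Proof.
rewrite atlas_openE; apply/propext; split=> [/(_ tt)|H i]; rewrite /= setIT image_id //.
Qed.

Lemma euclid_hausdorff : hausdorff_space euclid_atlas.
Proof.
apply: atlas_hausdorff => x y xy; have [A [B [opA opB Ax By AB]]] := rV_sep xy.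
by exists A, B; split=> //; rewrite euclid_openE.
Qed.

Lemma euclid_second_countable : @second_countable euclid_atlas.
Proof.
apply/second_countable_charts; exists setT => [|x]; first exact: countableP.
by exists tt.
Qed.

Definition euclid : manifold R := Manifold euclid_hausdorff euclid_second_countable.

End Euclidean.
Arguments euclid R n : clear implicits.

Section TangentVectors.
Context {R : realType}.
Implicit Types M N P : manifold R.

Notation expr M N i j f :=
  (chart_expr (cdom M i) (cmap M i) (cdom N j) (cmap N j) f).

(* A tangent vector at [tfoot] is a family of coordinate vectors, one for each
   chart around [tfoot], related by the derivatives of the transition maps. *)
Record tvec M := TVec {
  tfoot : M;
  tcoord : forall i : cidx M, 'rV[R]_(cdim i);
  tcoord_out : forall i, ~ cdom M i tfoot -> tcoord i = 0;
  tcoord_compat : forall i j, cdom M i tfoot -> cdom M j tfoot ->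
    tcoord j = 'D_(tcoord i) (expr M M i j id) (cmap M i tfoot) }.

Lemma tvec_eq M (v w : tvec M) :
  tfoot v = tfoot w -> (forall i, tcoord v i = tcoord w i) -> v = w.
Proof.
case: v w => [x a oa ca] [y b ob cb] /= exy eab; subst y.
have {}eab : a = b by apply: functional_extensionality_dep.
by subst b; congr TVec; exact: Prop_irrelevance.
Qed.

Lemma tvec_eq_chart M (v w : tvec M) i : cdom M i (tfoot v) ->
  tfoot v = tfoot w -> tcoord v i = tcoord w i -> v = w.
Proof.
move=> dv e ei; apply: tvec_eq => // j.
have [dj|dj] := pselect (cdom M j (tfoot v)).
  rewrite (tcoord_compat dv dj) ei e.
  by rewrite -tcoord_compat // -e.
by rewrite !tcoord_out // -?e.
Qed.

Section Make.
Variables (M N : manifold R) (f : smap M N).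
Variables (i : cidx M) (x : M) (a : 'rV[R]_(cdim i)) (dx : cdom M i x).

Let co (j : cidx N) : 'rV[R]_(cdim j) :=
  if pselect (cdom N j (f x)) is left _ then 'D_a (expr M N i j f) (cmap M i x) else 0.

Lemma push_out j : ~ cdom N j (f x) -> co j = 0.
Proof. by rewrite /co; case: pselect. Qed.

Lemma push_in j : cdom N j (f x) -> co j = 'D_a (expr M N i j f) (cmap M i x).
Proof. by rewrite /co; case: pselect. Qed.

Lemma push_compat j k : cdom N j (f x) -> cdom N k (f x) ->
  co k = 'D_(co j) (expr N N j k id) (cmap N j (f x)).
Proof.
move=> dj dk; rewrite !push_in //.
exact: (derive_comp a (smap_smooth f) (@smooth_map_id _ N) dx dj dk).
Qed.

Definition push : tvec N := TVec push_out push_compat.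

End Make.

Lemma push_coordE M N (f : smap M N) i x a (dx : cdom M i x) j :
  cdom N j (f x) -> tcoord (push f a dx) j = 'D_a (expr M N i j f) (cmap M i x).
Proof. exact: push_in. Qed.

Definition tvec_map M N (f : smap M N) (v : tvec M) : tvec N :=
  push f (tcoord v _) (svalP (cid (cdom_cover (tfoot v)))).

Lemma tvec_map_foot M N (f : smap M N) v : tfoot (tvec_map f v) = f (tfoot v).
Proof. by []. Qed.

Lemma tvec_map_coord M N (f : smap M N) v i j :
  cdom M i (tfoot v) -> cdom N j (f (tfoot v)) ->
  tcoord (tvec_map f v) j = 'D_(tcoord v i) (expr M N i j f) (cmap M i (tfoot v)).
Proof.
rewrite /tvec_map; case: cid => i' /= di' di dj.
rewrite push_in // (tcoord_compat di di').
by rewrite -(derive_comp _ (@smooth_map_id _ M) (smap_smooth f) di di' dj).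
Qed.

Lemma tvec_map_id M (v : tvec M) : tvec_map (smap_id M) v = v.
Proof.
have [i di] := cdom_cover (tfoot v).
apply: (@tvec_eq_chart _ _ _ i) => //.
by rewrite (tvec_map_coord (i := i)) // derive_id_chart.
Qed.

Lemma tvec_map_comp M N P (g : smap N P) (f : smap M N) v :
  tvec_map (smap_comp g f) v = tvec_map g (tvec_map f v).
Proof.
have [i di] := cdom_cover (tfoot v).
have [j dj] := cdom_cover (f (tfoot v)).
have [k dk] := cdom_cover (g (f (tfoot v))).
apply: (@tvec_eq_chart _ _ _ k) => //.
rewrite (tvec_map_coord (i := i)) // (tvec_map_coord (i := j)) //.
rewrite (tvec_map_coord (i := i)) //=.
exact: (derive_comp _ (smap_smooth f) (smap_smooth g) di dj dk).
Qed.

Section Bundle.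
Variable M : manifold R.

Definition tdom (i : cidx M) : set (tvec M) := fun v => cdom M i (tfoot v).

Definition tcmap (i : cidx M) (v : tvec M) : 'rV[R]_(cdim i + cdim i) :=
  row_mx (cmap M i (tfoot v)) (tcoord v i).

Lemma tcmap_inj i v w : tdom i v -> tdom i w -> tcmap i v = tcmap i w -> v = w.
Proof.
move=> dv dw /eq_row_mx [e1 e2]; apply: (@tvec_eq_chart _ _ _ i) => //.
exact: cmap_inj e1.
Qed.

Lemma tdom_cover v : exists i, tdom i v.
Proof. exact: cdom_cover. Qed.

Lemma tcmap_image i :
  [set y | (cmap M i @` cdom M i) (lsubmx y)] `<=` tcmap i @` tdom i.
Proof.
move=> y [x dx xy]; exists (push (smap_id M) (rsubmx y) dx) => //.
rewrite /tcmap push_coordE // derive_id_chart //=.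
by rewrite xy hsubmxK.
Qed.

End Bundle.

Lemma tcmap_smooth M N (f : smap M N) i j :
  smooth_in_charts (@tdom M i) (@tcmap M i) (@tdom N j) (@tcmap N j) (tvec_map f).
Proof.
apply: smooth_in_charts_local => [|v dv dfv]; first exact: tcmap_inj.
have [p1 s1] := smap_smooth f i j.
exists [set y | chart_dom (cdom M i) (cmap M i) (cdom N j) f (lsubmx y)].
exists (tangent_map (expr M N i j f)); split.
- exact: open_lsubmx.
- by rewrite /= /tcmap row_mxKl; exists (tfoot v).
- by move=> y [x [dx _] e]; apply: tcmap_image; exists x.
- move=> w dw [x [dx dfx]]; rewrite /tcmap row_mxKl => e.
  have {e dx} e := cmap_inj dx dw e; subst x; split=> //.
  rewrite /tangent_map row_mxKl row_mxKr (tvec_map_coord (i := i)) //.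
  by rewrite chart_exprE //; exact: cmap_inj.
- exact: smooth_tangent_map.
Qed.

Section BundleManifold.
Variable M : manifold R.

Lemma tcmap_compat i j :
  smooth_in_charts (@tdom M i) (@tcmap M i) (@tdom M j) (@tcmap M j) id.
Proof.
have := tcmap_smooth (smap_id M) i j.
by rewrite (_ : tvec_map _ = id) //; apply/funext => v; exact: tvec_map_id.
Qed.

Definition tangent_atlas : atlas R :=
  @Atlas R (tvec M) (cidx M) (fun i => (cdim i + cdim i)%N) (@tdom M) (@tcmap M)
    (@tcmap_inj M) (@tdom_cover M) tcmap_compat.

Lemma tfoot_smooth : smooth_map (@tfoot M : tangent_atlas -> M).
Proof.
move=> i j; apply: smooth_in_charts_local => [|v dv dfv]; first exact: tcmap_inj.
have [p1 s1] := @smooth_map_id _ M i j.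
exists [set y | chart_dom (cdom M i) (cmap M i) (cdom M j) id (lsubmx y)].
exists (expr M M i j id \o lsubmx); split.
- exact: open_lsubmx.
- by rewrite /= /tcmap row_mxKl; exists (tfoot v).
- by move=> y [x [dx _] e]; apply: tcmap_image; exists x.
- move=> w dw [x [dx dfx]]; rewrite /= /tcmap row_mxKl => e.
  have {e dx} e := cmap_inj dx dw e; subst x; split=> //.
  by rewrite (chart_exprE _ _ (f := id)) //; exact: cmap_inj.
- by move=> k; apply: Ck_comp (s1 k) (Ck_lsubmx _ _) => //; exact: open_lsubmx.
Qed.

Lemma tangent_hausdorff : hausdorff_space tangent_atlas.
Proof.
apply: atlas_hausdorff => v w vw.
have [e|ne] := pselect (tfoot v = tfoot w); last first.
  have [A [B [opA opB Ax By AB]]] := @hausdorff_sep _ M _ _ (@man_hausdorff _ M) ne.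
  exists (@tfoot M @^-1` A), (@tfoot M @^-1` B); split=> //.
  - exact: smooth_map_open tfoot_smooth opA.
  - exact: smooth_map_open tfoot_smooth opB.
  by rewrite -preimage_setI AB preimage_set0.
have [i dv] := cdom_cover (tfoot v).
have dw : cdom M i (tfoot w) by rewrite -e.
have nvw : tcmap i v <> tcmap i w by move=> /(tcmap_inj dv dw).
have [A [B [opA opB Ax By AB]]] := rV_sep nvw.
exists (@tdom M i `&` tcmap i @^-1` A), (@tdom M i `&` tcmap i @^-1` B); split=> //.
- exact: (@open_chart_preimage _ tangent_atlas i).
- exact: (@open_chart_preimage _ tangent_atlas i).
by rewrite -setIIr -preimage_setI AB preimage_set0 setI0.
Qed.

Lemma tangent_second_countable : @second_countable tangent_atlas.
Proof.
have /second_countable_charts[C cC CP] := @man_second_countable _ M.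
by apply/second_countable_charts; exists C => // v; exact: CP.
Qed.

Definition tangent_bundle : manifold R :=
  Manifold tangent_hausdorff tangent_second_countable.

Definition tangent_proj : smap tangent_bundle M :=
  Smap (tfoot_smooth : @smooth_map _ tangent_bundle M _).

Program Definition zero_vec (x : M) : tvec M := @TVec M x (fun=> 0) _ _.
Next Obligation. by []. Qed.
Next Obligation. by move=> x i j dx dy; rewrite derive0. Qed.

Lemma zero_vec_smooth : @smooth_map _ M tangent_bundle zero_vec.
Proof.
move=> i j; apply: smooth_in_charts_local => [|x dx dfx]; first exact: cmap_inj.
have [p1 s1] := @smooth_map_id _ M i j.
exists (chart_dom (cdom M i) (cmap M i) (cdom M j) id).
exists (fun y => row_mx (expr M M i j id y) 0); split=> //.
- by exists x.
- by move=> _ [y [dy _] <-]; exists y.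
- move=> y dy [z [dz djz] e]; have {e dz} e := cmap_inj dz dy e; subst z; split=> //.
  by rewrite (chart_exprE _ _ (f := id)) //; exact: cmap_inj.
- by move=> k; apply: Ck_row_mx => //; exact: Ck_cst.
Qed.

Definition zero_section : smap M tangent_bundle := Smap zero_vec_smooth.

End BundleManifold.

Definition tangent_smap M N (f : smap M N) : smap (tangent_bundle M) (tangent_bundle N) :=
  Smap (tcmap_smooth f : @smooth_map _ (tangent_bundle M) (tangent_bundle N) _).

Program Definition tangent_functor : functor (SMan R) (SMan R) :=
  @Functor (SMan R) (SMan R) tangent_bundle tangent_smap _ _.
Next Obligation. by move=> M; apply: smap_eq => v; exact: tvec_map_id. Qed.
Next Obligation.
by move=> M N P g f; apply: smap_eq => v; exact: tvec_map_comp.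
Qed.

End TangentVectors.

(* The addition, vertical lift and canonical flip of the usual tangent structure
   on [SMan], as relations: in the charts induced by a chart of [M] they are
   (x, v), (x, w) |-> (x, v + w), (x, v) |-> (x, 0, 0, v) and
   (x, v, a, b) |-> (x, a, v, b). *)
Section UsualStructure.
Context {R : realType}.
Variable M : manifold R.
Notation TM := (tangent_bundle M).
Notation TTM := (tangent_bundle TM).

Definition is_tsum (v w s : TM) : Prop :=
  [/\ tfoot w = tfoot v, tfoot s = tfoot v &
      forall i, tcoord s i = tcoord v i + tcoord w i].

Definition is_tlift (v : TM) (w : TTM) : Prop :=
  tfoot w = zero_vec (tfoot v) /\
  forall i : cidx M, cdom M i (tfoot v) ->
    tcoord w i = row_mx 0 (tcoord v i) :> 'rV_(cdim i + cdim i).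

Definition is_tflip (w w' : TTM) : Prop :=
  tfoot (tfoot w') = tfoot (tfoot w) /\
  forall i : cidx M, cdom M i (tfoot (tfoot w)) ->
    tcoord (tfoot w') i = lsubmx (tcoord w i : 'rV_(cdim i + cdim i)) /\
    tcoord w' i =
      row_mx (tcoord (tfoot w) i) (rsubmx (tcoord w i : 'rV_(cdim i + cdim i))).

End UsualStructure.

Section Slice.
Context {R : realType}.
Variable M : manifold R.

(* [V] with [iota : V -> TZ] and [q : V -> M] is the pullback of [Tg] along the
   zero section, and this pullback is preserved by all powers of [T]. *)
Definition is_rel_tangent_bundle (Z V : manifold R) (g : smap Z M)
    (iota : smap V (tangent_bundle Z)) (q : smap V M) : Prop :=
  forall m, is_pullback_iter tangent_functor m
    (tangent_smap g : @hom (SMan R) _ _) (zero_section M : @hom (SMan R) _ _)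
    (iota : @hom (SMan R) _ _) (q : @hom (SMan R) _ _).

(* The slice over [M], on the maps which admit a relative tangent bundle. Maps whose
   rank jumps do not: for x |-> x^2 on the line, {(x, v) | 2xv = 0} is a cross. *)
Record slice_obj := SliceObj {
  sl_dom :> manifold R;
  sl_map : smap sl_dom M;
  sl_rel : exists V iota q, @is_rel_tangent_bundle sl_dom V sl_map iota q }.

Record slice_hom (A B : slice_obj) := SliceHom {
  sh_map :> smap A B;
  sh_over : smap_comp (sl_map B) sh_map = sl_map A }.

Lemma slice_hom_eq (A B : slice_obj) (f g : slice_hom A B) :
  (forall x, f x = g x) -> f = g.
Proof.
case: f g => [f ef] [g eg] /= /smap_eq e; subst g.
by congr SliceHom; exact: Prop_irrelevance.
Qed.

Program Definition slice_id (A : slice_obj) : slice_hom A A :=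
  @SliceHom A A (smap_id A) _.
Next Obligation. by move=> A; exact: smap_eq. Qed.

Program Definition slice_comp (A B C : slice_obj) (g : slice_hom B C)
    (f : slice_hom A B) : slice_hom A C := @SliceHom A C (smap_comp g f) _.
Next Obligation.
move=> A B C g f; rewrite -(sh_over f) -(sh_over g).
exact: smap_eq.
Qed.

Program Definition slice : category :=
  @Category slice_obj slice_hom slice_id slice_comp _ _ _.
Next Obligation. by move=> A B f; exact: slice_hom_eq. Qed.
Next Obligation. by move=> A B f; exact: slice_hom_eq. Qed.
Next Obligation. by move=> A B C D h g f; exact: slice_hom_eq. Qed.

(* The relative tangent structure on the slice: a choice, for every object
   [g : Z -> M], of the relative tangent bundle, with inclusion [rt_in] into
   [TZ], along which all the structure is restricted from that of [SMan]. *)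
Record rel_tangent := RelTangent {
  rt_str :> tangent_structure slice;
  rt_in : forall A : slice, smap (tfun rt_str A) (tangent_bundle A);
  rt_pullback : forall A : slice,
    is_rel_tangent_bundle (sl_map A) (rt_in A) (sl_map (tfun rt_str A));
  rt_nat : forall (A B : slice) (h : hom A B) (v : tfun rt_str A),
    rt_in B (fmap (tfun rt_str) h v) = tangent_smap h (rt_in A v);
  rt_p : forall (A : slice) (v : tfun rt_str A),
    tp rt_str A v = tfoot (rt_in A v);
  rt_zero : forall (A : slice) (x : A),
    rt_in A (tzero rt_str A x) = zero_section A x;
  rt_plus : forall (A : slice) (u : tpow rt_str 2 A),
    is_tsum (rt_in A (tpr rt_str A i0 u)) (rt_in A (tpr rt_str A i1 u))
            (rt_in A (tplus rt_str A u));
  rt_lift : forall (A : slice) (v : tfun rt_str A),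
    is_tlift (rt_in A v)
      (tangent_smap (rt_in A) (rt_in (tfun rt_str A) (tlift rt_str A v)));
  rt_flip : forall (A : slice) (w : tfun rt_str (tfun rt_str A)),
    is_tflip (tangent_smap (rt_in A) (rt_in (tfun rt_str A) w))
      (tangent_smap (rt_in A) (rt_in (tfun rt_str A) (tflip rt_str A w))) }.

Definition slice_tan (TT : rel_tangent) : tancat := TanCat (rt_str TT).

End Slice.

Section Sublattice.
Context {R : realType}.
Variables (M : manifold R) (I : Type) (B : I -> opens M).

Inductive generated : opens M -> Prop :=
| generated_base i : generated (B i)
| generated_cap V W : generated V -> generated W -> generated (opens_cap V W)
| generated_cup V W : generated V -> generated W -> generated (opens_cup V W).

Record lat_obj := LatObj {
  lat_set :> opens M;
  lat_in : generated lat_set }.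

Program Definition sublattice : category :=
  @Category lat_obj (fun V W => oset V `<=` oset W) (fun V => @subset_refl _ V)
    (fun V W Y h g => subset_trans g h) _ _ _.
Next Obligation. by move=> *; exact: Prop_irrelevance. Qed.
Next Obligation. by move=> *; exact: Prop_irrelevance. Qed.
Next Obligation. by move=> *; exact: Prop_irrelevance. Qed.

End Sublattice.

Section Pullback.
Context {R : realType}.
Variables (M : manifold R) (I : Type) (B : I -> opens M).
Variable TT : forall N : manifold R, rel_tangent N.

Definition slice_over (V : sublattice B) : tancat := slice_tan (TT (opensub V)).

(* [F] is V |-> (SMan/V, T), g |-> g^*, for some choice of the pullbacks [g^*A];
   [pp_pr] is the projection g^*A -> A. *)
Record pullback_pseudofunctor (F : pseudofunctor slice_over) := PullbackPseudofunctor {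
  pp_pr : forall (V W : sublattice B) (g : hom V W) (A : slice_over W),
    smap (sl_dom (pf_mor F g A)) (sl_dom A);
  pp_pullback : forall (V W : sublattice B) (g : hom V W) (A : slice_over W),
    is_pullback (C := SMan R) (sl_map A) (opensub_incl g)
      (pp_pr g A) (sl_map (pf_mor F g A));
  pp_map : forall (V W : sublattice B) (g : hom V W) (A A' : slice_over W)
      (h : hom A A') x,
    pp_pr g A' (sh_map (fmap (pf_mor F g) h) x) = sh_map h (pp_pr g A x);
  (* the isomorphism g^*(T A) = T (g^*A) *)
  pp_dist : forall (V W : sublattice B) (g : hom V W) (A : slice_over W) x,
    tangent_smap (pp_pr g A)
      (rt_in (TT (opensub V)) (pf_mor F g A) (sh_map (tm_dist (pf_mor F g) A) x)) =
    rt_in (TT (opensub W)) A (pp_pr g (tfun (TT (opensub W)) A) x);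
  pp_id : forall (V : sublattice B) (i : hom V V) (e : i = idm V)
      (A : slice_over V) x,
    sh_map (pf_id F e A) x = pp_pr i A x;
  pp_comp : forall (V W Y : sublattice B) (g : hom V W) (h : hom W Y) (k : hom V Y)
      (e : k = h ∘ g) (A : slice_over Y) x,
    pp_pr k A (sh_map (pf_comp F e A) x) = pp_pr h A (pp_pr g (pf_mor F h A) x) }.

End Pullback.

Section Charts.
Context {R : realType}.
Variable M : manifold R.

(* A chart U -> M, with U open in R^n: a diffeomorphism onto an open subset. *)
Record chart := Chart {
  ch_dim : nat;
  ch_dom : opens (euclid R ch_dim);
  ch_map :> smap (opensub ch_dom) M;
  ch_img : opens M;
  ch_iso : exists e : @hom (SMan R) (opensub ch_dom) (opensub ch_img),
    is_iso e /\ smap_comp (opensub_in ch_img) e = ch_map }.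

Definition smooth_atlas (I : Type) (U : I -> chart) : Prop :=
  forall x : M, exists i, oset (ch_img (U i)) x.

End Charts.

(* Main.v *)
(** Restriction to the open sets of the lattice is a tangent functor H from the slice over M
    to the pseudolimit, and it is enough to show that H is fully faithful and essentially
    surjective with an invertible distributive law: the inverse equivalence then carries a
    unique compatible distributive law.  An object L of the pseudolimit amounts to manifolds
    L V over V with open embeddings L V -> L W for V <= W, each identifying L V with the part
    of L W over V.  Morphisms glue because smoothness is local.  Objects glue to the colimit
    of the L V: it is Hausdorff because points over distinct points of M are separated in M
    and points of one fibre lie in a common L V, and it is second countable because M is
    Lindelöf.  The relative tangent bundles of the L V form again an object of the
    pseudolimit, and the manifold glued from them is the relative tangent bundle of the glued
    object: T preserves open embeddings, so the iterates T^m of the pullback square can be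
    tested over the open sets of the cover. *)

From mathcomp Require Import all_boot all_order all_algebra.
From mathcomp Require Import boolp classical_sets functions cardinality.
From mathcomp Require Import reals topology normedtype derive.
Require Import Defs.

Set Implicit Arguments.
Unset Strict Implicit.
Unset Printing Implicit Defensive.

Local Obligation Tactic := idtac.
Local Open Scope cat_scope.
Import Order.TTheory GRing.Theory Num.Theory.
Import numFieldNormedType.Exports.
Local Open Scope classical_set_scope.
Local Open Scope ring_scope.

(** * Fully faithful, essentially surjective tangent functors with invertible distributive law are
    equivalences *)

Section EquivalenceCriterion.
Variables (X Y : tancat) (H : tan_mor X Y).
Local Notation SX := (tc_str X).
Local Notation SY := (tc_str Y).
Local Notation TX := (tfun SX).
Local Notation TY := (tfun SY).
Local Notation "'α' A" := (tm_dist H A) (at level 9, A at level 9).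

Hypothesis dist_iso : forall A, is_iso (α A).
Hypothesis faithful : forall (A B : X) (f g : hom A B), fmap H f = fmap H g -> f = g.
Hypothesis full : forall (A B : X) (g : hom (H A) (H B)), exists f, fmap H f = g.
Hypothesis ess : forall B : Y, exists (A : X) (e : hom (H A) B), is_iso e.

Lemma iso_mono (C : category) (A B D : C) (e : hom B D) (f g : hom A B) :
  is_iso e -> e ∘ f = e ∘ g -> f = g.
Proof. by move=> [e' [e1 _]] fg; rewrite -[f]comp1m -[g]comp1m -e1 -!compmA fg. Qed.

Let K0 (B : Y) : X := sval (cid (ess B)).
Let eps (B : Y) : hom (H (K0 B)) B := sval (cid (svalP (cid (ess B)))).
Let eps_iso B : is_iso (eps B). Proof. exact: svalP (cid (svalP (cid (ess B)))). Qed.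

(** Source of every component of the inverse: with [e] a counit [eps] it gives the action on
    morphisms, with [e] the isomorphism [theta] it gives the distributive law. *)
Let lift_ex (A : X) (B D : Y) (e : hom (H A) D) (f : hom B D) (i : is_iso e) :
  exists k : hom (K0 B) A, e ∘ fmap H k = f ∘ eps B.
Proof.
have [e' [_ e2]] := i; have [k kE] := full (e' ∘ (f ∘ eps B)).
by exists k; rewrite kE compmA e2 comp1m.
Qed.

Let K1 (B B' : Y) (f : hom B B') : hom (K0 B) (K0 B') :=
  sval (cid (lift_ex f (eps_iso B'))).
Let K1E B B' (f : hom B B') : eps B' ∘ fmap H (K1 f) = f ∘ eps B.
Proof. exact: svalP (cid (lift_ex f (eps_iso B'))). Qed.

Program Definition inverse_functor : functor Y X := @Functor Y X K0 K1 _ _.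
Next Obligation.
move=> B; apply/faithful/(iso_mono (eps_iso _)).
by rewrite K1E fmap1 compm1 comp1m.
Qed.
Next Obligation.
move=> B B' B'' g f; apply/faithful/(iso_mono (eps_iso _)).
by rewrite K1E fmapM compmA K1E -!compmA K1E.
Qed.
Local Notation K := inverse_functor.

Let theta (B : Y) := fmap TY (eps B) ∘ α (K B).
Let theta_iso B : is_iso (theta B).
Proof. exact: is_iso_comp (is_iso_fmap _ (eps_iso B)) (dist_iso _). Qed.

(** The equation imposed on [beta] is exactly the condition for [eps] to be a 2-cell from [H K] to
    the identity; since [theta] is invertible and [H] faithful, it determines [beta]. *)
Let beta_ex (B : Y) : exists b : hom (K (TY B)) (TX (K B)),
  theta B ∘ fmap H b = eps (TY B).
Proof. by have [b bE] := lift_ex (idm _) (theta_iso B); exists b; rewrite bE comp1m. Qed.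
Let beta B := sval (cid (beta_ex B)).
Let betaE B : fmap TY (eps B) ∘ (α (K B) ∘ fmap H (beta B)) = eps (TY B).
Proof. by rewrite compmA; exact: svalP (cid (beta_ex B)). Qed.

Let theta2 (B : Y) := fmap TY (theta B) ∘ α (TX (K B)).
Let theta2_iso B : is_iso (theta2 B).
Proof. exact: is_iso_comp (is_iso_fmap _ (theta_iso B)) (dist_iso _). Qed.

(** The analogue of [betaE] over [T^2], where the axioms for lift and flip take place. *)
Let beta2E B : theta2 B ∘ fmap H (fmap TX (beta B) ∘ beta (TY B)) = eps (TY (TY B)).
Proof.
rewrite /theta2 fmapM -!compmA (compmA _ (fmap H (fmap TX _))).
have /= -> := tm_nat H (beta B).
by rewrite -compmA (compmA (fmap TY (theta B))) -fmapM /theta -compmA betaE betaE.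
Qed.

Let K1E' (B B' D : Y) (f : hom B B') (g : hom D (H (K B))) :
  eps B' ∘ (fmap H (K1 f) ∘ g) = f ∘ (eps B ∘ g).
Proof. by rewrite compmA K1E -compmA. Qed.

Let betaE' (B D : Y) (g : hom D (H (K (TY B)))) :
  fmap TY (eps B) ∘ (α (K B) ∘ (fmap H (beta B) ∘ g)) = eps (TY B) ∘ g.
Proof. by rewrite -betaE -!compmA. Qed.

Let alphaE (A B : X) (D : Y) (f : hom A B) (g : hom D (H (TX A))) :
  α B ∘ (fmap H (fmap TX f) ∘ g) = fmap TY (fmap H f) ∘ (α A ∘ g).
Proof. by rewrite !compmA; have /= -> := tm_nat H f. Qed.

Let fmapE (C D : category) (F : functor C D) (A B B' : C) (Z : D)
    (g : hom B B') (f : hom A B) (h : hom Z (F A)) :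
  fmap F g ∘ (fmap F f ∘ h) = fmap F (g ∘ f) ∘ h.
Proof. by rewrite fmapM -compmA. Qed.

(** Each axiom is tested after applying the faithful [H] and composing with one of the isomorphisms
    [eps], [theta], [theta2]. There it reduces to the same axiom for [H] and naturality of the
    structure of [Y] at [eps]. *)
Program Definition inverse_tan_mor : tan_mor Y X := @TanMor Y X K beta _ _ _ _ _ _.
Next Obligation.
move=> B B' f /=; apply/faithful/(iso_mono (theta_iso _)).
rewrite /theta -!compmA !fmapM betaE' K1E alphaE fmapE K1E fmapM.
by rewrite -compmA betaE.
Qed.
Next Obligation.
move=> B /=; apply/faithful/(iso_mono (eps_iso _)).
rewrite K1E fmapM -(tm_p H) -compmA compmA.
by have /= <- := tp_nat SY (eps B); rewrite -compmA betaE.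
Qed.
Next Obligation.
move=> B /=; apply/faithful/(iso_mono (theta_iso _)).
rewrite /theta -!compmA !fmapM betaE' K1E tm_zero.
by have /= -> := tzero_nat SY (eps B).
Qed.
Next Obligation.
move=> B u /= ue; apply/faithful/(iso_mono (theta_iso _)).
rewrite /theta -!compmA !fmapM betaE' K1E.
(* [w] is the comparison from [H] of the pullback power to the pullback power in [Y], and [f2] is
   [T_2] applied to [eps B]; the counit at [T_2 B] factors through both. *)
have [w [we wb]] := @tpow_lift Y 2 (H (K B)) _ _ _ (tm_dist_tpr H (K B) (n := 2)).
have [f2 [f2e f2b]] := @tpow_lift Y 2 B (tpow SY 2 (H (K B)))
  (fun i => fmap TY (eps B) ∘ tpr SY _ i) (eps B ∘ tbase SY 2 _) (fun i => ltac:(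
    by rewrite compmA; have /= -> := tp_nat SY (eps B); rewrite -compmA tpr_p)).
rewrite (compmA (α _)) (tm_plus we) !compmA -(tplus_nat f2e) -!compmA; congr (_ ∘ _).
have E i : tpr SY B i ∘ eps (tpow SY 2 B) = tpr SY B i ∘ (f2 ∘ (w ∘ fmap H u)).
  rewrite (compmA (tpr SY B i)) f2e -compmA (compmA (tpr SY _ i)) we -!compmA -fmapM ue.
  by rewrite fmapM betaE' K1E.
by apply: tpow_ext => //; rewrite -(tpr_p _ i0) -![LHS]compmA -![RHS]compmA E.
Qed.
Next Obligation.
move=> B /=; apply/faithful/(iso_mono (theta2_iso _)).
rewrite [RHS](_ : _ = tlift SY B ∘ eps (TY B)); last first.
  by rewrite fmapM compmA beta2E K1E.
rewrite /theta2 /theta !fmapM -!compmA.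
have := tm_lift H (K B); rewrite -!compmA => E.
rewrite (compmA (α (TX _))) (compmA (fmap TY (α _))) -E.
rewrite -[_ ∘ _ ∘ fmap H (beta B)]compmA [LHS]compmA.
by have /= <- := tlift_nat SY (eps B); rewrite -compmA betaE.
Qed.
Next Obligation.
move=> B /=; apply/faithful/(iso_mono (theta2_iso _)).
rewrite [RHS](_ : _ = tflip SY B ∘ eps (TY (TY B))); last first.
  by rewrite fmapM compmA beta2E K1E.
rewrite -beta2E -[tflip _ _ ∘ _ ∘ _]compmA fmapM !compmA; congr (_ ∘ _).
rewrite /theta2 /theta !fmapM -!compmA.
have := tm_flip H (K B); rewrite -!compmA => <-.
rewrite !compmA; congr (_ ∘ _); congr (_ ∘ _); exact/esym/(tflip_nat SY (eps B)).
Qed.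

(** The counit is [eps], a 2-cell by [betaE]. The other isomorphism is the preimage under [H] of
    [eps (H A)], and its inverse is the preimage of the inverse. *)
Lemma tan_equivalent_of_ff : tan_equivalent X Y.
Proof.
have sig_ex A : exists s : hom (K (H A)) A, fmap H s = eps (H A) by exact: full.
pose s A := sval (cid (sig_ex A)).
have sE A : fmap H (s A) = eps (H A) by exact: svalP (cid (sig_ex A)).
exists H, inverse_tan_mor; split; constructor.
  have n : natural (F := tan_comp inverse_tan_mor H) (G := tan_id X) s.
    by move=> A B f /=; apply: faithful; rewrite !fmapM !sE K1E.
  have d A : fmap TX (s A) ∘ tm_dist (tan_comp inverse_tan_mor H) A =
             tm_dist (tan_id X) A ∘ s (TX A).
    apply/faithful/(iso_mono (dist_iso _)); rewrite /= comp1m !fmapM sE compmA.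
    have /= -> := tm_nat H (s A).
    by rewrite sE -compmA (compmA (α _)) compmA betaE K1E.
  exists (TanCell n d) => A; have [e [e1 e2]] := eps_iso (H A).
  have [t tE] := full e; exists t; split; apply: faithful.
    by rewrite fmapM tE sE e1 fmap1.
  by rewrite fmapM tE sE e2 fmap1.
have n : natural (F := tan_comp H inverse_tan_mor) (G := tan_id Y) eps.
  by move=> A B f /=; exact: K1E.
have d B : fmap TY (eps B) ∘ tm_dist (tan_comp H inverse_tan_mor) B =
             tm_dist (tan_id Y) B ∘ eps (TY B).
  by rewrite /= comp1m betaE.
by exists (TanCell n d).
Qed.

End EquivalenceCriterion.

(** * Open embeddings and their tangent maps *)

Section SmoothMaps.
Context {R : realType}.
Implicit Types (M N P X : manifold R).

(** [opensub O] keeps the charts of [N], so the coordinate expression of [f \o sval] is a local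
    coordinate expression of [f]. *)
Lemma smooth_map_local N P (f : N -> P) :
  (forall x, exists O : opens N,
     oset O x /\ smooth_map (f \o sval : opensub O -> P)) -> smooth_map f.
Proof.
move=> H i j; apply: smooth_in_charts_local => [|x dx dfx]; first exact: cmap_inj.
have [O [Ox sf]] := H x; have [oW sW] := sf i j.
do 2!eexists; split; [exact: oW | | | | exact: sW].
- by exists (exist _ x Ox).
- by move=> _ [y [dy _] <-]; exists (sval y).
move=> y dy [z [dz dfz] e]; have e' := @cmap_inj _ N i (sval z) y dz dy e; subst y; split=> //.
by rewrite -[cmap N i (sval z)]/(cmap (opensub O) i z) chart_exprE //; exact: cmap_inj.
Qed.

Lemma smooth_map_opensub N M (V : opens M) (f : N -> opensub V) :
  smooth_map (opensub_in V \o f) -> smooth_map f.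
Proof. by move=> sf i j; exact: (sf i j). Qed.

Lemma smooth_map_cst N P (p : P) : smooth_map (fun _ : N => p).
Proof.
move=> i j; apply: smooth_in_charts_local => [|x dx dp]; first exact: cmap_inj.
exists (cmap N i @` cdom N i), (cst (cmap P j p)); split=> //.
  exact: open_cdom.
by move=> k; exact: Ck_cst.
Qed.

Definition smap_cst N P (p : P) : smap N P := Smap (@smooth_map_cst N P p).

Lemma opensub_eq M (V : opens M) (x y : opensub V) : sval x = sval y -> x = y.
Proof.
by apply: eq_sig_hprop => a p q; exact: Prop_irrelevance.
Qed.

Lemma open_sval_image M (V : opens M) (A : set (opensub V)) :
  open A -> open (sval @` A : set M).
Proof.
rewrite !atlas_openE => oA i; have := oA i; congr open; apply/seteqP; split.
  by move=> _ [x [Ax dx] <-]; exists (sval x) => //; split=> //; exists x.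
by move=> _ [_ [[x Ax <-] dx] <-]; exists x.
Qed.

Definition preim_opens N P (f : smap N P) (V : opens P) : opens N :=
  Opens (smooth_map_open (smap_smooth f) (oset_open V)).

(** The third clause stands for smoothness of the inverse on the range. In this form it serves
    directly to lift maps through [e]; [open_emb_opensub] recovers the diffeomorphism onto an open
    submanifold. *)
Definition open_emb N P (e : smap N P) : Prop :=
  [/\ forall x y, e x = e y -> x = y, open (range e) &
      forall X (f : X -> N), smooth_map (e \o f) -> smooth_map f].

Lemma open_emb_inj N P (e : smap N P) x y : open_emb e -> e x = e y -> x = y.
Proof. by move=> [+ _ _]; apply. Qed.

Lemma open_emb_lift N P X (e : smap N P) (f : smap X P) : open_emb e ->
  (forall x, range e (f x)) -> exists g : smap X N, forall x, e (g x) = f x.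
Proof.
move=> [_ _ refl] H.
have ex x : exists y, e y = f x by have [y _ ey] := H x; exists y.
pose g x := sval (cid (ex x)).
have gE x : e (g x) = f x by exact: svalP (cid (ex x)).
have sg : smooth_map g.
  apply: refl; rewrite (_ : e \o g = f); first exact: smap_smooth.
  exact/funext.
by exists (Smap sg).
Qed.

Lemma open_emb_opensub_in M (V : opens M) : open_emb (opensub_in V).
Proof.
split=> [x y /opensub_eq //||X f]; last exact: smooth_map_opensub.
rewrite (_ : range _ = oset V); first exact: oset_open.
by apply/seteqP; split=> [_ [x _ <-]|x Vx]; [exact: svalP|exists (exist _ x Vx)].
Qed.

Lemma open_emb_bij N P (e : smap N P) (e' : smap P N) :
  (forall x, e' (e x) = x) -> (forall x, e (e' x) = x) -> open_emb e.
Proof.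
move=> eK e'K; split=> [x y exy||X f sf].
- by rewrite -(eK x) exy eK.
- rewrite (_ : range e = setT); first exact: openT.
  by apply/seteqP; split=> // x _; exists (e' x).
have := smooth_map_comp sf (smap_smooth e').
by rewrite (_ : _ \o _ = f) //; apply/funext => x; exact: eK.
Qed.

Lemma open_emb_comp N P Q (e : smap N P) (e' : smap P Q) :
  open_emb e -> open_emb e' -> open_emb (smap_comp e' e).
Proof.
move=> He He'; have [inj op refl] := He; have [inj' op' refl'] := He'.
split=> [x y /inj'/inj //||X f sf]; last exact/refl/refl'.
pose U := Opens op; pose U' := Opens op'.
(* [g] inverts [e'] on its range, so the range of the composite is the image in [Q] of the open set
   of points that [g] sends into [range e]. *)
have [g gE] : exists g : smap (opensub U') P, forall x, e' (g x) = sval x.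
  by apply: (open_emb_lift (f := opensub_in U') He') => x; exact: svalP.
rewrite (_ : range _ = sval @` (g @^-1` range e)).
  by apply: open_sval_image; exact: smooth_map_open (smap_smooth g) op.
apply/seteqP; split=> [_ [x _ <-]|_ [x [y _ yx] <-]].
  have r : range e' (e' (e x)) by exists (e x).
  exists (exist _ _ r) => //=; exists x => //.
  by apply: inj'; rewrite gE.
by exists y => //=; rewrite yx gE.
Qed.

(** Lets a formula [L] be differentiated instead of [chart_expr]: the two agree on the open image of
    the chart, hence near the foot of [v]. *)
Lemma tcoord_tangent_smap N P (f : smap N P) (v : tangent_bundle N) i j
    (L : 'rV[R]_(cdim i) -> 'rV[R]_(cdim j)) :
  (forall x, cdom N i x -> cdom P j (f x) /\ cmap P j (f x) = L (cmap N i x)) ->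
  cdom N i (tfoot v) ->
  tcoord (tangent_smap f v) j = 'D_(tcoord v i) L (cmap N i (tfoot v)).
Proof.
move=> fL di; have dj := (fL _ di).1.
have -> := @tvec_map_coord _ _ _ f v i j di dj; apply: near_eq_derive.
have Hx : (cmap N i @` cdom N i) (cmap N i (tfoot v)) by exists (tfoot v).
apply: filterS (open_nbhs_nbhs (conj (@open_cdom _ N i) Hx)) => _ [y dy <-].
have [djy e] := fL y dy; rewrite chart_exprE //; exact: cmap_inj.
Qed.

(* An open subset has the charts of the ambient manifold, in which its inclusion and the
   derivative of the latter are identities. *)
Lemma tcoord_opensub_in M (V : opens M) (v : tangent_bundle (opensub V)) i :
  cdom M i (sval (tfoot v)) ->
  tcoord (tangent_smap (opensub_in V) v) i = tcoord v i.
Proof.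
move=> di; rewrite (@tcoord_tangent_smap _ _ (opensub_in V) v i i id) //.
exact: derive_id.
Qed.

Lemma tcoord_tangent_opensub_in M (V : opens M)
    (w : tangent_bundle (tangent_bundle (opensub V))) (i : cidx M) :
  cdom M i (sval (tfoot (tfoot w))) ->
  tcoord (tangent_smap (tangent_smap (opensub_in V)) w) i = tcoord w i.
Proof.
move=> di; rewrite (@tcoord_tangent_smap _ _ (tangent_smap (opensub_in V)) w i i id) //.
  exact: derive_id.
move=> v dv; split=> //.
by rewrite /= /tcmap tcoord_opensub_in.
Qed.

Lemma range_tangent_opensub_in M (V : opens M) (v : tangent_bundle M) :
  oset V (tfoot v) -> range (tangent_smap (opensub_in V)) v.
Proof.
move=> Vv; have [i di] := cdom_cover (tfoot v).
exists (push (smap_id (opensub V)) (i := i) (x := exist _ (tfoot v) Vv) (tcoord v i) di) => //.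
apply: (@tvec_eq_chart _ _ _ _ i) => //.
by rewrite tcoord_opensub_in // push_coordE // derive_id_chart.
Qed.

(** The tangent map of the inclusion does not change coordinates, so [f] and its composite with this
    map have equal chart expressions. The range is the part of [TM] over [V]. *)
Lemma open_emb_tangent_opensub_in M (V : opens M) :
  open_emb (tangent_smap (opensub_in V)).
Proof.
split=> [v w e||X f sf i j].
- have et : sval (tfoot v) = sval (tfoot w) by have := congr1 (@tfoot _ M) e.
  have [i di] := cdom_cover (sval (tfoot v)).
  apply: (@tvec_eq_chart _ (opensub V) _ _ i) => //; first exact: opensub_eq.
  by rewrite -!tcoord_opensub_in -?et // e.
- rewrite (_ : range _ = preim_opens (tangent_proj M) V); first exact: oset_open.
  apply/seteqP; split=> [_ [v _ <-]|v]; last exact: range_tangent_opensub_in.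
  exact: svalP (tfoot v).
have E x : cdom M j (sval (tfoot (f x))) ->
    cmap (tangent_bundle M) j (tangent_smap (opensub_in V) (f x)) =
    cmap (tangent_bundle (opensub V)) j (f x).
  by move=> dx; rewrite /= /tcmap tcoord_opensub_in.
have := sf i j; rewrite /smooth_in_charts; set c := chart_expr _ _ _ _ _.
set c' := chart_expr _ _ _ _ f.
suff -> : c = c' by [].
apply/funext => y; congr (xget 0 _); apply/seteqP.
by split=> z [x [dx dfx <- ->]]; exists x; split=> //; rewrite E.
Qed.

Lemma tangent_smap_comp N P Q (g : smap P Q) (f : smap N P) v :
  tangent_smap (smap_comp g f) v = tangent_smap g (tangent_smap f v).
Proof. exact: tvec_map_comp. Qed.

Lemma tangent_smap_eq N P (f g : smap N P) v :
  (forall x, f x = g x) -> tangent_smap f v = tangent_smap g v.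
Proof. by move=> /smap_eq ->. Qed.

Lemma tangent_smap_square N P N' P' (f : smap N P) (g : smap P P')
    (f' : smap N N') (g' : smap N' P') v : (forall x, g (f x) = g' (f' x)) ->
  tangent_smap g (tangent_smap f v) = tangent_smap g' (tangent_smap f' v).
Proof.
move=> e; rewrite -!tangent_smap_comp; exact: tangent_smap_eq.
Qed.

Lemma tangent_smap_id N (f : smap N N) v : (forall x, f x = x) -> tangent_smap f v = v.
Proof.
by move=> e; rewrite (_ : f = smap_id N) ?[LHS]tvec_map_id //; exact: smap_eq.
Qed.

(** Factors an open embedding as a diffeomorphism followed by the inclusion of an open submanifold,
    which reduces its tangent map to that of an inclusion. *)
Lemma open_emb_opensub N P (e : smap N P) (He : open_emb e) :
  exists (U : opens P) (a : smap N (opensub U)) (b : smap (opensub U) N),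
  [/\ oset U = range e, forall x, sval (a x) = e x, forall x, b (a x) = x &
      forall y, a (b y) = y].
Proof.
have [inj op refl] := He; pose U := Opens op.
have [b bE] : exists b : smap (opensub U) N, forall x, e (b x) = sval x.
  by apply: (open_emb_lift (f := opensub_in U) He) => x; exact: svalP.
have [a aE] : exists a : smap N (opensub U), forall x, sval (a x) = e x.
  by apply: (open_emb_lift (open_emb_opensub_in U) (f := e)) => x;
    exists (exist _ (e x) (ex_intro2 _ _ x I erefl)).
exists U, a, b; split=> // x; first by apply: inj; rewrite bE aE.
by apply: opensub_eq; rewrite aE bE.
Qed.

Lemma range_tangent N P (e : smap N P) (v : tangent_bundle P) : open_emb e ->
  range (tangent_smap e) v <-> range e (tfoot v).
Proof.
move=> He; split=> [[w _ <-]|]; first by exists (tfoot w).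
have [U [a [b [rU aE ba ab]]]] := open_emb_opensub He.
rewrite -rU => /range_tangent_opensub_in [w _ wv].
exists (tangent_smap b w) => //; rewrite -wv -tangent_smap_comp.
by apply: tangent_smap_eq => x /=; rewrite -aE ab.
Qed.

Lemma open_emb_tangent N P (e : smap N P) : open_emb e -> open_emb (tangent_smap e).
Proof.
move=> He; have [U [a [b [rU aE ba ab]]]] := open_emb_opensub He.
have -> : e = smap_comp (opensub_in U) a by apply: smap_eq => x /=.
have -> : tangent_smap (smap_comp (opensub_in U) a) =
    smap_comp (tangent_smap (opensub_in U)) (tangent_smap a).
  by apply: smap_eq => v; exact: tangent_smap_comp.
apply: open_emb_comp; last exact: open_emb_tangent_opensub_in.
by apply: (@open_emb_bij _ _ _ (tangent_smap b)) => v;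
  rewrite -tangent_smap_comp; exact: tangent_smap_id.
Qed.

End SmoothMaps.

(** * Pullbacks of manifolds in terms of points; their restriction and gluing along open covers *)

Section Pullbacks.
Context {R : realType}.
Implicit Types (A B C P X : manifold R).

(** A form of the universal property that localizes: [P] is the fibre product on points and carries
    the initial smooth structure for [u] and [v]. *)
Definition pb_points A B C P (f : smap A C) (g : smap B C) (u : smap P A)
    (v : smap P B) : Prop :=
  [/\ forall p, f (u p) = g (v p),
      forall a b, f a = g b -> exists p, u p = a /\ v p = b,
      forall p q, u p = u q -> v p = v q -> p = q &
      forall X (k : X -> P), smooth_map (u \o k) -> smooth_map (v \o k) -> smooth_map k].

(** Points are maps out of the one-point manifold [euclid R 0], so the universal property against it
    gives the fibre product on points. *)
Lemma pullbackP A B C P (f : smap A C) (g : smap B C) (u : smap P A) (v : smap P B) :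
  is_pullback (C := SMan R) f g u v <-> pb_points f g u v.
Proof.
pose pt : euclid R 0 := (0 : 'rV[R]_0).
split=> [[fg univ]|[fg ex inj sm]].
  split=> [p|a b fab|p q eu ev|X k su sv].
  - by have := congr1 (fun h : smap P C => h p) fg.
  - have [|k [[ku kv] _]] := univ (euclid R 0) (smap_cst _ a)
      (smap_cst _ b); first exact: smap_eq.
    exists (k pt); split.
      by have := congr1 (fun h : smap _ A => h pt) ku.
    by have := congr1 (fun h : smap _ B => h pt) kv.
  - have [|k [_ ku]] := univ (euclid R 0) (smap_cst _ (u p))
      (smap_cst _ (v p)).
      apply: smap_eq => x /=; by have := congr1 (fun h : smap P C => h p) fg.
    have kp : k = smap_cst _ p by apply: ku; split; exact: smap_eq.
    have kq : k = smap_cst _ q.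
      by apply: ku; split; apply: smap_eq => x /=.
    by have := congr1 (fun h : smap _ P => h pt) (etrans (esym kp) kq).
  - have [|h [[hu hv] _]] := univ X (Smap su) (Smap sv).
      apply: smap_eq => x /=; by have := congr1 (fun h : smap P C => h (k x)) fg.
    suff -> : k = h by exact: smap_smooth.
    apply/funext => x.
    have hux : u (h x) = u (k x) by have := congr1 (fun h : smap X A => h x) hu.
    have hvx : v (h x) = v (k x) by have := congr1 (fun h : smap X B => h x) hv.
    (* [k] is only a function so far, so uniqueness is applied one point at a time, to the constant
       maps at [h x] and [k x]. *)
    have [|l [_ lu]] := univ (euclid R 0) (smap_cst _ (u (k x)))
      (smap_cst _ (v (k x))).
      apply: smap_eq => y /=; by have := congr1 (fun h : smap P C => h (k x)) fg.
    have l1 : l = smap_cst _ (h x).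
      by apply: lu; split; apply: smap_eq => y /=.
    have l2 : l = smap_cst _ (k x).
      by apply: lu; split; apply: smap_eq => y /=.
    by have := congr1 (fun h : smap _ P => h pt) (etrans (esym l2) l1).
split=> [|X a b ab]; first by apply: smap_eq => p; exact: fg.
have exk x : exists p, u p = a x /\ v p = b x.
  by apply: ex; have := congr1 (fun h : smap X C => h x) ab.
pose k x := sval (cid (exk x)).
have ku x : u (k x) = a x by have [] := svalP (cid (exk x)).
have kv x : v (k x) = b x by have [] := svalP (cid (exk x)).
have sk : smooth_map k.
  apply: sm.
    by rewrite (_ : u \o k = a); [exact: smap_smooth|exact/funext].
  by rewrite (_ : v \o k = b); [exact: smap_smooth|exact/funext].
exists (Smap sk); split; first by split; apply: smap_eq => x /=.
move=> h [hu hv]; apply: smap_eq => x /=; apply: inj.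
  by rewrite ku -hu.
by rewrite kv -hv.
Qed.

(* The inner square (primed) sits over an open part of the outer one, as the full
   preimage of the open part of the base [C]. *)
Record open_square A B C P (f : smap A C) (g : smap B C) (u : smap P A) (v : smap P B)
    A' B' C' P' (f' : smap A' C') (g' : smap B' C') (u' : smap P' A') (v' : smap P' B')
    (eA : smap A' A) (eB : smap B' B) (eC : smap C' C) (eP : smap P' P) : Prop :=
  OpenSquare {
    os_A : open_emb eA; os_B : open_emb eB; os_C : open_emb eC; os_P : open_emb eP;
    os_f : forall x, eC (f' x) = f (eA x);
    os_g : forall x, eC (g' x) = g (eB x);
    os_u : forall x, eA (u' x) = u (eP x);
    os_v : forall x, eB (v' x) = v (eP x);
    os_cA : forall x, range eC (f x) -> range eA x;
    os_cB : forall x, range eC (g x) -> range eB x;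
    os_cP : forall x, range eA (u x) -> range eP x }.

(** By [range_tangent] the range of [T e] is everything over the range of [e], so the conditions on
    ranges pass to [T]. Iteration then reaches every [T^m]. *)
Lemma open_square_tangent A B C P (f : smap A C) (g : smap B C) (u : smap P A)
    (v : smap P B) A' B' C' P' (f' : smap A' C') (g' : smap B' C') (u' : smap P' A')
    (v' : smap P' B') eA eB eC eP :
  open_square f g u v f' g' u' v' eA eB eC eP ->
  open_square (tangent_smap f) (tangent_smap g) (tangent_smap u) (tangent_smap v)
    (tangent_smap f') (tangent_smap g') (tangent_smap u') (tangent_smap v')
    (tangent_smap eA) (tangent_smap eB) (tangent_smap eC) (tangent_smap eP).
Proof.
case=> oA oB oC oP ef eg eu ev cA cB cP; split; try exact: open_emb_tangent.
- by move=> x; exact: tangent_smap_square.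
- by move=> x; exact: tangent_smap_square.
- by move=> x; exact: tangent_smap_square.
- by move=> x; exact: tangent_smap_square.
- by move=> x /(range_tangent _ oC) /cA ?; apply/range_tangent.
- by move=> x /(range_tangent _ oC) /cB ?; apply/range_tangent.
- by move=> x /(range_tangent _ oA) /cP ?; apply/range_tangent.
Qed.

Lemma pb_points_restrict A B C P (f : smap A C) (g : smap B C) (u : smap P A)
    (v : smap P B) A' B' C' P' (f' : smap A' C') (g' : smap B' C') (u' : smap P' A')
    (v' : smap P' B') eA eB eC eP :
  open_square f g u v f' g' u' v' eA eB eC eP ->
  pb_points f g u v -> pb_points f' g' u' v'.
Proof.
case=> oA oB oC oP ef eg eu ev cA cB cP [fg ex inj sm]; split.
- by move=> p; apply: (open_emb_inj oC); rewrite ef eg eu ev.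
- move=> a b e; have [|p [pa pb]] := ex (eA a) (eB b); first by rewrite -ef -eg e.
  have [|q _ qp] := cP p; first by rewrite pa; exists a.
  exists q; split; first by apply: (open_emb_inj oA); rewrite eu qp.
  by apply: (open_emb_inj oB); rewrite ev qp.
- move=> p q pq pq'; apply: (open_emb_inj oP).
  by apply: inj; rewrite -?eu -?ev ?pq ?pq'.
move=> X k su sv; have [_ _] := oP; apply; apply: sm.
  rewrite (_ : _ \o _ = eA \o (u' \o k)); last by apply/funext => x /=.
  exact: smooth_map_comp su (smap_smooth eA).
rewrite (_ : _ \o _ = eB \o (v' \o k)); last by apply/funext => x /=.
exact: smooth_map_comp sv (smap_smooth eB).
Qed.

Lemma pullback_restrict_iter m A B C P (f : smap A C) (g : smap B C) (u : smap P A)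
    (v : smap P B) A' B' C' P' (f' : smap A' C') (g' : smap B' C') (u' : smap P' A')
    (v' : smap P' B') eA eB eC eP :
  open_square f g u v f' g' u' v' eA eB eC eP ->
  is_pullback_iter (C := SMan R) tangent_functor m f g u v ->
  is_pullback_iter (C := SMan R) tangent_functor m f' g' u' v'.
Proof.
elim: m => [|m IH] in A B C P f g u v A' B' C' P' f' g' u' v' eA eB eC eP *.
  by move=> sq /pullbackP pb; apply/pullbackP; exact: pb_points_restrict sq pb.
by move=> /open_square_tangent sq; exact: IH sq.
Qed.

(** A cover of [C] induces covers of [A], [B] and [P], because each piece is the full preimage of
    its part of [C]. Two points of [P] with the same image in [A] therefore lie in one common
    piece. *)
Lemma pb_points_glue (J : Type) A B C P (f : smap A C) (g : smap B C) (u : smap P A)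
    (v : smap P B) (A' B' C' P' : J -> manifold R) (f' : forall j, smap (A' j) (C' j))
    (g' : forall j, smap (B' j) (C' j)) (u' : forall j, smap (P' j) (A' j))
    (v' : forall j, smap (P' j) (B' j)) eA eB eC eP :
  (forall j, open_square f g u v (f' j) (g' j) (u' j) (v' j) (eA j) (eB j) (eC j) (eP j)) ->
  (forall c, exists j, range (eC j) c) ->
  (forall j, pb_points (f' j) (g' j) (u' j) (v' j)) -> pb_points f g u v.
Proof.
move=> sq cov pb.
have covP p : exists j, range (eP j) p.
  have [j rj] := cov (f (u p)); exists j.
  by case: (sq j) => oA oB oC oP ef eg eu ev cA cB cP; exact/cP/cA.
split.
- move=> p; have [j [q _ <-]] := covP p.
  case: (sq j) => oA oB oC oP ef eg eu ev cA cB cP; have [fg _ _ _] := pb j.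
  by rewrite -eu -ev -ef -eg fg.
- move=> a b fab; have [j rj] := cov (f a).
  case: (sq j) => oA oB oC oP ef eg eu ev cA cB cP; have [_ ex _ _] := pb j.
  have [a' _ ea] := cA _ rj; rewrite fab in rj; have [b' _ eb] := cB _ rj.
  have [|p [pa pb']] := ex a' b'.
    by apply: (open_emb_inj oC); rewrite ef eg ea eb.
  by exists (eP j p); rewrite -eu -ev pa pb'.
- move=> p q upq vpq; have [j [p' _ ep]] := covP p.
  case: (sq j) => oA oB oC oP ef eg eu ev cA cB cP; have [_ _ inj _] := pb j.
  have [|q' _ eq] := cP q; first by rewrite -upq -ep -eu; exists (u' j p').
  rewrite -ep -eq; congr (eP j _); apply: inj.
    by apply: (open_emb_inj oA); rewrite !eu ep eq.
  by apply: (open_emb_inj oB); rewrite !ev ep eq.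
move=> X k su sv; apply: smooth_map_local => x.
have [j rj] := covP (k x).
case: (sq j) => oA oB oC oP ef eg eu ev cA cB cP; have [_ _ _ sm] := pb j.
(* On the open set where [u \o k] falls into the piece [j], [k] itself lifts to [P' j], where the
   hypothesis on pieces applies. *)
have [_ rA _] := oA; pose O := preim_opens (Smap su) (Opens rA).
have ex y : exists p, eP j p = k (sval (y : opensub O)).
  by have [p _ e] := cP _ (svalP y); exists p.
pose h y := sval (cid (ex y)).
have hE y : eP j (h y) = k (sval y) by exact: svalP (cid (ex y)).
exists O; split; first by case: rj => p _ e; exists (u' j p) => //=; rewrite eu e.
rewrite (_ : k \o sval = eP j \o h); last by apply/funext => y /=; rewrite hE.
apply: smooth_map_comp (smap_smooth _); apply: sm.
  have [_ _] := oA; apply.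
  rewrite (_ : _ \o _ = (u \o k) \o sval); last by apply/funext => y /=; rewrite eu hE.
  exact: smooth_map_comp (@sval_smooth _ _ O) su.
have [_ _] := oB; apply.
rewrite (_ : _ \o _ = (v \o k) \o sval); last by apply/funext => y /=; rewrite ev hE.
exact: smooth_map_comp (@sval_smooth _ _ O) sv.
Qed.

Lemma pullback_glue_iter m (J : Type) A B C P (f : smap A C) (g : smap B C) (u : smap P A)
    (v : smap P B) (A' B' C' P' : J -> manifold R) (f' : forall j, smap (A' j) (C' j))
    (g' : forall j, smap (B' j) (C' j)) (u' : forall j, smap (P' j) (A' j))
    (v' : forall j, smap (P' j) (B' j)) eA eB eC eP :
  (forall j, open_square f g u v (f' j) (g' j) (u' j) (v' j) (eA j) (eB j) (eC j) (eP j)) ->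
  (forall c, exists j, range (eC j) c) ->
  (forall j, is_pullback_iter (C := SMan R) tangent_functor m
     (f' j) (g' j) (u' j) (v' j)) ->
  is_pullback_iter (C := SMan R) tangent_functor m f g u v.
Proof.
elim: m => [|m IH] in A B C P f g u v A' B' C' P' f' g' u' v' eA eB eC eP *.
  move=> sq cov pb; apply/pullbackP; apply: (pb_points_glue sq cov) => j.
  by have /pullbackP := pb j.
move=> sq cov; apply: IH => [j|c]; first exact: open_square_tangent (sq j).
have [j rj] := cov (tfoot c); exists j; apply/range_tangent => //.
exact: os_C (sq j).
Qed.

Lemma pullback_iso (D : category) (A B C P P' : D) (f : hom A C) (g : hom B C)
    (u : hom P A) (v : hom P B) (u' : hom P' A) (v' : hom P' B) :
  is_pullback f g u v -> is_pullback f g u' v' ->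
  exists k : hom P P', [/\ is_iso k, u' ∘ k = u & v' ∘ k = v].
Proof.
move=> [fg univ] [fg' univ'].
have [k [[ku kv] _]] := univ' _ _ _ fg; have [l [[lu lv] _]] := univ _ _ _ fg'.
have uniq (E Q : D) (a : hom E A) (b : hom E B) (h h' : hom Q E) :
    is_pullback f g a b -> a ∘ h = a ∘ h' -> b ∘ h = b ∘ h' -> h = h'.
  move=> [ab univE] ea eb; have [|w [_ wu]] := univE _ (a ∘ h') (b ∘ h').
    by rewrite !compmA ab.
  by rewrite -(wu h) // -(wu h').
exists k; split=> //; exists l; split.
  by apply: (uniq _ _ u v); rewrite // compmA ?lu ?lv ?ku ?kv compm1.
by apply: (uniq _ _ u' v'); rewrite // compmA ?ku ?kv ?lu ?lv compm1.
Qed.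

End Pullbacks.

(** * Gluing manifolds along smooth overlaps *)

Section Glueing.
Context {R : realType}.
Variables (J : Type) (A : J -> manifold R) (Z : Type) (e : forall j, A j -> Z).
Hypothesis e_inj : forall j (x y : A j), e x = e y -> x = y.
Hypothesis e_cover : forall z, exists j x, @e j x = z.
Hypothesis e_overlap : forall j k (x : A j) (y : A k), e x = e y ->
  exists (U : opens (A j)) (t : smap (opensub U) (A k)),
    oset U x /\ forall w, e (t w) = e (sval w).

Definition glue_idx := {j : J & cidx (A j)}.

Definition glue_dom (c : glue_idx) : set Z := @e (tag c) @` cdom _ (tagged c).

(** A chart of some [A j] carried over to [Z] by the injection [e]; outside the range of [e] it
    takes the default value 0. *)
Definition glue_map (c : glue_idx) (z : Z) : 'rV[R]_(cdim (tagged c)) :=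
  xget 0 [set y | exists x : A (tag c), e x = z /\ y = cmap (A (tag c)) (tagged c) x].

Lemma glue_mapE j (i : cidx (A j)) (x : A j) :
  glue_map (Tagged (fun j => cidx (A j)) i) (e x) = cmap (A j) i x.
Proof.
rewrite /glue_map; case: xgetP => [_ -> [y [/e_inj -> ->]] //|].
by move=> /(_ (cmap (A j) i x)) []; exists x.
Qed.

Lemma glue_map_inj c z w : glue_dom c z -> glue_dom c w ->
  glue_map c z = glue_map c w -> z = w.
Proof.
case: c => j i [x dx <-] [y dy <-]; rewrite !glue_mapE.
by move=> /(cmap_inj dx dy) ->.
Qed.

Lemma glue_cover z : exists c, glue_dom c z.
Proof.
have [j [x <-]] := e_cover z; have [i di] := cdom_cover x.
by exists (Tagged (fun j => cidx (A j)) i); exists x.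
Qed.

(** Around a point common to two pieces, the transition is the coordinate expression of the smooth
    map [t] provided by [e_overlap]. *)
Lemma glue_compat c d :
  smooth_in_charts (glue_dom c) (glue_map c) (glue_dom d) (glue_map d) id.
Proof.
case: c d => [j i] [k l]; apply: smooth_in_charts_local => [|z].
  exact: glue_map_inj.
move=> [x /= dx xz] [y /= dy yz]; rewrite -{z}xz in yz *.
have [U [t [Ux tE]]] := e_overlap (esym yz); have [oW sW] := smap_smooth t i l.
have ty (w : opensub U) : sval w = x -> t w = y.
  by move=> wx; apply: e_inj; rewrite tE wx yz.
do 2!eexists; split; [exact: oW | | | | exact: sW].
- by rewrite glue_mapE; exists (exist _ x Ux) => //; split=> //=; rewrite ty.
- move=> _ [w [dw _] <-]; exists (e (sval w)); first by exists (sval w).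
  by rewrite glue_mapE.
move=> _ [w dw <-]; rewrite glue_mapE => -[v [dv dtv] vw].
have vw' : sval v = w by exact: (@cmap_inj _ (A j) i (sval v) w dv dw vw).
rewrite -vw' -tE; split; first by exists (t v).
rewrite glue_mapE -[cmap _ _ (sval v)]/(cmap (opensub U) i v) chart_exprE //.
exact: (@cmap_inj _ (opensub U) i).
Qed.

Definition glue_atlas : atlas R := Atlas glue_map_inj glue_cover glue_compat.

(** The atlas topology is the final one for the maps [e]: in a chart coming from [A j], a set and
    its preimage in [A j] have the same image. *)
Lemma glue_open (O : set glue_atlas) : open O <-> forall j, open (@e j @^-1` O).
Proof.
have E j i : glue_map (Tagged (fun j => cidx (A j)) i) @`
    (O `&` glue_dom (Tagged (fun j => cidx (A j)) i)) =
    cmap (A j) i @` (@e j @^-1` O `&` cdom (A j) i).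
  apply/seteqP; split=> [_ [z [Oz [x dx xz]] <-]|_ [x [Ox dx] <-]].
    by rewrite -{z}xz in Oz *; rewrite glue_mapE; exists x.
  by exists (e x); rewrite ?glue_mapE //; split=> //; exists x.
split=> [oO j|oO].
  by move=> i; rewrite -E; exact: (oO (Tagged (fun j => cidx (A j)) i)).
by rewrite atlas_openE => -[j i]; rewrite /= E; exact: (oO j i).
Qed.

(** In another piece, the preimage of the image contains, around each of its points, the open set of
    points that a transition map [t] sends into [O]. *)
Lemma glue_open_image j (O : set (A j)) : open O -> open (@e j @` O : set glue_atlas).
Proof.
move=> oO; apply/glue_open => k; rewrite openE => y [x Ox xy].
have [U [t [Uy tE]]] := e_overlap (esym xy).
pose T : set (A k) := sval @` (t @^-1` O).
have oT : open T by apply: open_sval_image; exact: smooth_map_open (smap_smooth t) oO.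
rewrite /interior; apply: (@filterS _ _ _ T).
  by move=> _ [w Ow <-]; exists (t w).
apply: open_nbhs_nbhs; split=> //; exists (exist _ y Uy) => //=.
by rewrite (_ : t _ = x) //; apply: e_inj; rewrite tE.
Qed.

Lemma glue_in_smooth j : smooth_map (@e j : A j -> glue_atlas).
Proof.
move=> i [k l]; apply: smooth_in_charts_local => [|x dx [y /= dy yx]].
  exact: cmap_inj.
have [U [t [Ux tE]]] := e_overlap (esym yx); have [oW sW] := smap_smooth t i l.
have tx (w : opensub U) : sval w = x -> t w = y.
  by move=> wx; apply: e_inj; rewrite tE wx yx.
do 2!eexists; split; [exact: oW | | | | exact: sW].
- by exists (exist _ x Ux) => //; split=> //=; rewrite tx.
- by move=> _ [w [dw _] <-]; exists (sval w).
move=> w dw [v [dv dtv] vw].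
have vw' : sval v = w by exact: (@cmap_inj _ (A j) i (sval v) w dv dw vw).
rewrite -vw' -tE; split; first by exists (t v).
rewrite /= glue_mapE -[cmap _ _ (sval v)]/(cmap (opensub U) i v) chart_exprE //.
exact: (@cmap_inj _ (opensub U) i).
Qed.

Variables (M : manifold R) (pi : Z -> M).
Hypothesis pi_smooth : forall j, smooth_map (pi \o @e j : A j -> M).
Hypothesis pi_fibre : forall z w, pi z = pi w -> exists j (x y : A j), e x = z /\ e y = w.
Hypothesis e_countable :
  exists2 C : set J, countable C & forall z, exists2 j, C j & exists x, @e j x = z.

Lemma glue_hausdorff : hausdorff_space glue_atlas.
Proof.
apply: atlas_hausdorff => z w zw.
have [/pi_fibre [j [x [y [xz yw]]]]|ne] := pselect (pi z = pi w); last first.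
  have [O [O' [oO oO' Oz Ow OO']]] := @hausdorff_sep _ M _ _ (@man_hausdorff _ M) ne.
  exists (pi @^-1` O), (pi @^-1` O'); split=> //.
  - by apply/glue_open => j; exact: smooth_map_open (@pi_smooth j) oO.
  - by apply/glue_open => j; exact: smooth_map_open (@pi_smooth j) oO'.
  by rewrite -preimage_setI OO' preimage_set0.
have xy : x <> y by move=> xy; apply: zw; rewrite -xz xy.
have [O [O' [oO oO' Ox Oy OO']]] := @hausdorff_sep _ _ _ _ (@man_hausdorff _ (A j)) xy.
exists (@e j @` O), (@e j @` O'); split; rewrite -?xz -?yw.
- exact: glue_open_image.
- exact: glue_open_image.
- by exists x.
- by exists y.
apply/seteqP; split=> // _ [[a Oa <-] [b Ob /e_inj ba]].
have : (O `&` O') a by split=> //; rewrite -ba.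
by rewrite OO'.
Qed.

Lemma glue_second_countable : @second_countable glue_atlas.
Proof.
apply/second_countable_charts; have [C cC HC] := e_countable.
have HA j := (second_countable_charts (A j)).1 (@man_second_countable _ (A j)).
pose D j := s2val (cid2 (HA j)).
have cD j : countable (D j) by exact: s2valP (cid2 (HA j)).
have HD j x : exists2 i, D j i & cdom (A j) i x by exact: s2valP' (cid2 (HA j)) x.
exists (\bigcup_(j in C) (Tagged (fun j => cidx (A j)) @` D j)).
  apply: bigcup_countable => // j _.
  exact: (sub_countable (card_image_le _ _)).
move=> z; have [j Cj [x xz]] := HC z; have [i Di dx] := HD j x.
exists (Tagged (fun j => cidx (A j)) i); first by exists j => //; exists i.
by exists x.
Qed.

Definition glue : manifold R := Manifold glue_hausdorff glue_second_countable.

Definition glue_in j : smap (A j) glue := Smap (@glue_in_smooth j : @smooth_map _ _ glue _).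

(** In the charts of the glued manifold coming from [A j], [f] and [glue_in j \o f] have the same
    coordinate expression on the same domain. *)
Lemma open_emb_glue_in j : open_emb (glue_in j).
Proof.
split=> [x y /e_inj //||X f sf i k]; first exact/glue_open_image/openT.
have := sf i (Tagged (fun j => cidx (A j)) k).
rewrite /smooth_in_charts /=.
pose d := glue_dom (Tagged (fun j => cidx (A j)) k).
have dE : (glue_in j \o f) @^-1` d = f @^-1` cdom (A j) k.
  apply/seteqP; split=> [x [y dy /e_inj yx]|x dx]; first by rewrite /preimage /= -yx.
  by exists (f x).
rewrite /chart_dom dE; set c := chart_expr _ _ _ _ _.
set c' := chart_expr _ _ _ _ f.
suff -> : c = c' by [].
apply/funext => y; congr (xget 0 _); apply/seteqP.
split=> z [x [dx dfx <- ->]]; exists x; split=> //.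
- by have : ((glue_in j \o f) @^-1` d) x by []; rewrite dE.
- by rewrite /= glue_mapE.
- by have : (f @^-1` cdom (A j) k) x by []; rewrite -dE.
- by rewrite /= glue_mapE.
Qed.

Lemma smooth_map_glue (N : manifold R) (f : glue -> N) :
  (forall j, smooth_map (f \o glue_in j)) -> @smooth_map _ glue N f.
Proof.
move=> H; apply: smooth_map_local => z; have [j [x xz]] := e_cover z.
have [U [a [b [UE aE ba ab]]]] := open_emb_opensub (open_emb_glue_in j).
exists U; split; first by rewrite UE -xz; exists x.
rewrite (_ : f \o sval = (f \o glue_in j) \o b).
  exact: smooth_map_comp (smap_smooth b) (@H j).
by apply/funext => y /=; congr f; rewrite -{1}(ab y) aE.
Qed.

End Glueing.

(** * Base change along open embeddings, and isomorphisms in slices *)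

Section PullbackOfOpen.
Context {R : realType}.

Lemma pb_points_open_emb (A B C P : manifold R) (f : smap A C) (g : smap B C)
    (u : smap P A) (v : smap P B) : pb_points f g u v -> open_emb g ->
  open_emb u /\ forall a, range u a <-> range g (f a).
Proof.
move=> [fg ex inj sm] og.
have rE a : range u a <-> range g (f a).
  split=> [[p _ <-]|[b _ /esym/ex[p [pa _]]]]; last by exists p.
  by rewrite fg; exists (v p).
split=> //; have [gi go gr] := og; split.
- by move=> x y uxy; apply: inj => //; apply: gi; rewrite -!fg uxy.
- rewrite (_ : range u = f @^-1` range g); last by apply/seteqP; split=> a /rE.
  exact: smooth_map_open (smap_smooth f) go.
move=> X k su; apply: sm => //; apply: gr.
rewrite (_ : _ \o _ = f \o (u \o k)); last by apply/funext => x /=; rewrite -fg.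
exact: smooth_map_comp su (smap_smooth f).
Qed.

Lemma pb_points_of_open_emb (A B C P : manifold R) (f : smap A C) (g : smap B C)
    (u : smap P A) (v : smap P B) : open_emb g -> open_emb u ->
  (forall p, f (u p) = g (v p)) -> (forall a, range g (f a) -> range u a) ->
  pb_points f g u v.
Proof.
move=> og ou fg ru; split=> // [a b ab|p q upq _|X k su _].
- have [|p _ pa] := ru a; first by rewrite ab; exists b.
  by exists p; split=> //; apply: (open_emb_inj og); rewrite -fg pa ab.
- exact: open_emb_inj upq.
by have [_ _] := ou; apply.
Qed.

Lemma open_emb_opensub_incl (M : manifold R) (V W : opens M) (VW : V `<=` W) :
  open_emb (opensub_incl VW).
Proof.
have E : smap_comp (opensub_in W) (opensub_incl VW) = opensub_in V by exact: smap_eq.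
split=> [x y xy||X k sk].
- exact/opensub_eq/(congr1 (@sval M _) xy).
- rewrite (_ : range _ = preim_opens (opensub_in W) V); first exact: oset_open.
  apply/seteqP; split=> [_ [x _ <-]|x Vx]; first exact: (svalP x).
  by exists (exist _ (sval x) Vx) => //; exact: opensub_eq.
apply: smooth_map_opensub; exact: smooth_map_comp sk (@sval_smooth _ _ W).
Qed.

Lemma slice_homP (M : manifold R) (A B : slice M) (h : hom A B) x :
  sl_map B (sh_map h x) = sl_map A x.
Proof. by have := congr1 (fun k : smap _ _ => k x) (sh_over h). Qed.

Lemma slice_isoP (M : manifold R) (A B : slice M) (h : hom A B) : is_iso h ->
  exists k : hom B A, (forall x, sh_map k (sh_map h x) = x) /\
    forall y, sh_map h (sh_map k y) = y.
Proof.
move=> [k [kh hk]]; exists k; split=> x.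
  by have := congr1 (fun l : slice_hom A A => sh_map l x) kh.
by have := congr1 (fun l : slice_hom B B => sh_map l x) hk.
Qed.

Lemma slice_iso_open_emb (M : manifold R) (A B : slice M) (h : hom A B) :
  open_emb (sh_map h) -> (forall y, exists x, sh_map h x = y) -> is_iso h.
Proof.
move=> oh sh; have [|k kE] := open_emb_lift oh (f := smap_id B).
  by move=> y; have [x xy] := sh y; exists x.
have ko : smap_comp (sl_map A) k = sl_map B.
  by apply: smap_eq => y /=; rewrite -(slice_homP h) kE.
exists (SliceHom ko); split; apply: slice_hom_eq => x /=; last exact: kE.
by apply: (open_emb_inj oh); rewrite kE.
Qed.

Lemma tangent_smap_zero (N P : manifold R) (f : smap N P) (x : N) :
  tangent_smap f (zero_section N x) = zero_section P (f x) :> tangent_bundle P.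
Proof.
have [i di] := cdom_cover (f x); have [k dk] := cdom_cover x.
apply: (@tvec_eq_chart _ _ _ _ i) => //.
by have -> := @tvec_map_coord _ _ _ f (zero_vec x) k i dk di; rewrite derive0.
Qed.

(** Reduces the comparison of two squares defining relative tangent bundles to conditions on [Z] and
    [Y]. It serves both to restrict a relative tangent bundle to an open set and to glue one. *)
Lemma rel_tangent_restrict (N M Z Y Z' Y' : manifold R) (j : smap N M) (f : smap Z M)
    (iota : smap Y (tangent_bundle Z)) (q : smap Y M) (f' : smap Z' N)
    (iota' : smap Y' (tangent_bundle Z')) (q' : smap Y' N)
    (eZ : smap Z' Z) (eY : smap Y' Y) :
  open_emb j -> open_emb eZ -> open_emb eY ->
  (forall z, j (f' z) = f (eZ z)) -> (forall y, j (q' y) = q (eY y)) ->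
  (forall y, tangent_smap eZ (iota' y) = iota (eY y)) ->
  (forall z, range j (f z) -> range eZ z) -> (forall y, range j (q y) -> range eY y) ->
  (forall z, range eZ (tfoot (iota z)) -> range j (q z)) ->
  open_square (tangent_smap f) (zero_section M) iota q
    (tangent_smap f') (zero_section N) iota' q' (tangent_smap eZ) j (tangent_smap j) eY.
Proof.
move=> oj oZ oY ef eq ei cZ cY cq; split=> //; try exact: open_emb_tangent.
- by move=> v; exact: tangent_smap_square.
- by move=> x; exact: tangent_smap_zero.
- by move=> v /range_tangent; move=> /(_ oj) /cZ ?; apply/range_tangent.
- by move=> x /range_tangent; apply.
- by move=> y /range_tangent; move=> /(_ oZ) /cq; exact: cY.
Qed.

End PullbackOfOpen.

(** * Objects of the pseudolimit as diagrams of open embeddings over [M] *)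

Section LimitObjects.
Context {R : realType}.
Variables (M : manifold R) (I : Type) (B : I -> opens M).
Variable TT : forall N : manifold R, rel_tangent N.
Variable F : pseudofunctor (slice_over (B := B) TT).
Variable HF : pullback_pseudofunctor F.
Local Notation U := (sublattice B).
Implicit Types (L : lim_obj F) (V W Y : U).

Definition base_pt L V (z : sl_dom (L V)) : M := sval (sl_map (L V) z).

Lemma base_pt_in L V (z : sl_dom (L V)) : oset V (base_pt z).
Proof. exact: svalP. Qed.

Lemma pp_pr_open_emb V W (g : hom V W) (A : slice_over TT W) :
  open_emb (pp_pr HF g A) /\
  forall a, range (pp_pr HF g A) a <-> oset V (sval (sl_map A a)).
Proof.
have /pullbackP pb := pp_pullback HF g A.
have [op rE] := pb_points_open_emb pb (open_emb_opensub_incl g).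
split=> // a; rewrite rE; split=> [[x _ <-]|Va]; first exact: (svalP x).
by exists (exist _ _ Va) => //; exact: opensub_eq.
Qed.

Lemma pp_pr_over V W (g : hom V W) (A : slice_over TT W) y :
  sval (sl_map A (pp_pr HF g A y)) = sval (sl_map (pf_mor F g A) y).
Proof.
have /pullbackP [fg _ _ _] := pp_pullback HF g A.
by rewrite fg.
Qed.

(** The inverse of the isomorphism [lo_tr L g] from [g^*(L W)] to [L V], followed by the pullback
    projection: the transition data becomes a map of manifolds in the direction of [g]. *)
Lemma lim_rho_ex L V W (g : hom V W) : exists r : smap (sl_dom (L V)) (sl_dom (L W)),
  forall y, r (sh_map (lo_tr L g) y) = pp_pr HF g (L W) y.
Proof.
have [k [kl lk]] := slice_isoP (lo_iso L g).
by exists (smap_comp (pp_pr HF g (L W)) (sh_map k)) => y /=; rewrite kl.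
Qed.

Definition lim_rho L V W (g : hom V W) : smap (sl_dom (L V)) (sl_dom (L W)) :=
  sval (cid (lim_rho_ex L g)).

Lemma lim_rhoE L V W (g : hom V W) y :
  lim_rho L g (sh_map (lo_tr L g) y) = pp_pr HF g (L W) y.
Proof. exact: svalP (cid (lim_rho_ex L g)) y. Qed.

Lemma lo_tr_surj L V W (g : hom V W) (z : sl_dom (L V)) :
  exists y, z = sh_map (lo_tr L g) y.
Proof. by have [k [kl lk]] := slice_isoP (lo_iso L g); exists (sh_map k z). Qed.

Lemma base_pt_rho L V W (g : hom V W) (z : sl_dom (L V)) :
  base_pt (lim_rho L g z) = base_pt z.
Proof.
have [y ->] := lo_tr_surj g z; rewrite lim_rhoE /base_pt pp_pr_over.
by rewrite (slice_homP (lo_tr L g)).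
Qed.

Lemma lim_rho_open_emb L V W (g : hom V W) : open_emb (lim_rho L g).
Proof.
have [k [kl lk]] := slice_isoP (lo_iso L g).
have -> : lim_rho L g = smap_comp (pp_pr HF g (L W)) (sh_map k).
  by apply: smap_eq => z; rewrite /= -{1}(lk z) lim_rhoE.
apply: open_emb_comp; last exact: (pp_pr_open_emb g (L W)).1.
exact: open_emb_bij lk kl.
Qed.

Lemma range_rho L V W (g : hom V W) (w : sl_dom (L W)) :
  oset V (base_pt w) -> range (lim_rho L g) w.
Proof.
move=> /(pp_pr_open_emb g (L W)).2 [y _ <-].
by exists (sh_map (lo_tr L g) y) => //; exact: lim_rhoE.
Qed.

Lemma lim_rho_comp L V W Y (g : hom V W) (h : hom W Y) (k : hom V Y) z :
  lim_rho L h (lim_rho L g z) = lim_rho L k z.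
Proof.
(* Morphisms of the lattice are proofs of inclusion, so any [k] is the composite. *)
have e : k = h ∘ g by exact: (@Prop_irrelevance (oset V `<=` oset Y)).
have [y ->] := lo_tr_surj k z.
(* The compositor is invertible, so [y] may be taken in its image, where [pp_comp] and [lo_comp]
   apply. *)
have [c [ck kc]] := slice_isoP (svalP (pf_comp F e) (L Y)).
rewrite -(kc y); set x := sh_map c y.
rewrite lim_rhoE (pp_comp HF e).
have -> : sh_map (lo_tr L k) (sh_map (sval (pf_comp F e) (L Y)) x) =
    sh_map (lo_tr L g) (sh_map (fmap (pf_mor F g) (lo_tr L h)) x).
  by have := congr1 (fun l : slice_hom _ _ => sh_map l x) (lo_comp L e).
by rewrite lim_rhoE (pp_map HF) lim_rhoE.
Qed.

(** The map is idempotent by [lim_rho_comp] and injective. *)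
Lemma lim_rho_id L V (g : hom V V) z : lim_rho L g z = z.
Proof. by apply: (open_emb_inj (lim_rho_open_emb L g)); exact: lim_rho_comp. Qed.

(** Replaces the compatibility required of a morphism of the pseudolimit by commutation with the
    maps [lim_rho], which can be checked on points. *)
Lemma lim_homP L L' (u : forall V, hom (L V) (L' V)) :
  (forall V W (g : hom V W), u V ∘ lo_tr L g = lo_tr L' g ∘ fmap (pf_mor F g) (u W)) <->
  (forall V W (g : hom V W) z,
     lim_rho L' g (sh_map (u V) z) = sh_map (u W) (lim_rho L g z)).
Proof.
split=> H V W g => [z|].
  have [y ->] := lo_tr_surj g z.
  have -> : sh_map (u V) (sh_map (lo_tr L g) y) =
      sh_map (lo_tr L' g) (sh_map (fmap (pf_mor F g) (u W)) y).
    by have := congr1 (fun l : slice_hom _ _ => sh_map l y) (H V W g).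
  by rewrite !lim_rhoE (pp_map HF).
apply: slice_hom_eq => y; apply: (open_emb_inj (lim_rho_open_emb L' g)).
by rewrite /= H !lim_rhoE (pp_map HF).
Qed.

(** The transition maps of the tangent object are restrictions of the tangent maps of [lim_rho];
    [pp_dist] and [rt_nat] combine to give this. *)
Lemma lim_rho_tangent L V W (g : hom V W) w :
  rt_in (TT (opensub W)) (L W) (lim_rho (limT_obj L) g w) =
  tangent_smap (lim_rho L g) (rt_in (TT (opensub V)) (L V) w).
Proof.
have [x ->] := lo_tr_surj (L := limT_obj L) g w.
rewrite lim_rhoE -(pp_dist HF).
have -> : rt_in (TT (opensub V)) (L V) (sh_map (lo_tr (limT_obj L) g) x) =
    tangent_smap (sh_map (lo_tr L g))
      (rt_in (TT (opensub V)) _ (sh_map (tm_dist (pf_mor F g) (L W)) x)) by exact: rt_nat.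
by rewrite -tangent_smap_comp; apply: tangent_smap_eq => y; rewrite /= lim_rhoE.
Qed.

Lemma lim_iso L L' (u : @hom (lim_cat F) L L') : (forall V, is_iso (u V)) -> is_iso u.
Proof.
move=> ui; pose v V := sval (cid (ui V)).
have vu V : v V ∘ u V = idm _ by have [] := svalP (cid (ui V)).
have uv V : u V ∘ v V = idm _ by have [] := svalP (cid (ui V)).
have vP V W (g : hom V W) : v V ∘ lo_tr L' g = lo_tr L g ∘ fmap (pf_mor F g) (v W).
  rewrite -[LHS]compm1 -(fmap1 (pf_mor F g)) -(uv W) fmapM.
  by rewrite -compmA (compmA (lo_tr L' g)) -lh_tr !compmA vu comp1m.
by exists (LimHom vP); split; apply: lim_hom_eq => V; [exact: vu|exact: uv].
Qed.

Section Build.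
Variables (ob : forall V : U, slice_over TT V).
Variable r : forall V W (g : hom V W), smap (sl_dom (ob V)) (sl_dom (ob W)).
Hypothesis r_pullback : forall V W (g : hom V W),
  is_pullback (C := SMan R) (sl_map (ob W)) (opensub_incl g) (r g) (sl_map (ob V)).
Hypothesis r_id : forall V (g : hom V V) z, r g z = z.
Hypothesis r_comp : forall V W Y (g : hom V W) (h : hom W Y) (k : hom V Y) z,
  r h (r g z) = r k z.

(** Source and target are two pullbacks of [ob W] along the inclusion of [V], and the comparison
    between them lies over [V]. *)
Lemma build_tr_ex V W (g : hom V W) : exists t : hom (pf_mor F g (ob W)) (ob V),
  is_iso t /\ forall y, r g (sh_map t y) = pp_pr HF g (ob W) y.
Proof.
have [k [[l [lk kl]] rk vk]] := pullback_iso (pp_pullback HF g (ob W)) (r_pullback g).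
have klE y : k (l y) = y by have := congr1 (fun l : smap _ _ => l y) kl.
have vkE x : sl_map (ob V) (k x) = sl_map (pf_mor F g (ob W)) x.
  by have := congr1 (fun l : smap _ _ => l x) vk.
have vl : smap_comp (sl_map (pf_mor F g (ob W))) l = sl_map (ob V).
  by apply: smap_eq => y /=; rewrite -vkE klE.
exists (SliceHom (vk : smap_comp _ _ = _)); split.
  exists (SliceHom vl); split; apply: slice_hom_eq => y /=.
    by have := congr1 (fun l : smap _ _ => l y) lk.
  exact: klE.
by move=> y; have := congr1 (fun l : smap _ _ => l y) rk.
Qed.

Definition build_tr V W (g : hom V W) := sval (cid (build_tr_ex g)).

Lemma build_tr_iso V W (g : hom V W) : is_iso (build_tr g).
Proof. by have [] := svalP (cid (build_tr_ex g)). Qed.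

Lemma build_trE V W (g : hom V W) y : r g (sh_map (build_tr g) y) = pp_pr HF g (ob W) y.
Proof. by have [_ ] := svalP (cid (build_tr_ex g)). Qed.

Lemma r_inj V W (g : hom V W) x y : r g x = r g y -> x = y.
Proof.
have /pullbackP pb := r_pullback g.
have [op _] := pb_points_open_emb pb (open_emb_opensub_incl g).
exact: open_emb_inj op.
Qed.

(** Converse to [lim_rho]: a strictly functorial diagram of pullbacks gives an object of the
    pseudolimit. The coherence laws may be checked after the injective maps [r]. *)
Program Definition build_lim : lim_obj F := @LimObj _ _ F ob build_tr build_tr_iso _ _.
Next Obligation.
move=> V i ei; apply: slice_hom_eq => y; apply: (@r_inj _ _ i).
by rewrite build_trE r_id; exact/esym/(pp_id HF).
Qed.
Next Obligation.
move=> V W Y g h k e; apply: slice_hom_eq => y; apply: (@r_inj _ _ k).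
rewrite /= build_trE -(r_comp g h k) build_trE (pp_map HF) build_trE.
exact: (pp_comp HF).
Qed.

Lemma build_rho V W (g : hom V W) z : lim_rho build_lim g z = r g z.
Proof.
by have [y ->] := lo_tr_surj (L := build_lim) g z; rewrite lim_rhoE build_trE.
Qed.

End Build.
End LimitObjects.

(** * Uniqueness and locality of sum, lift and flip *)

Section TangentRelations.
Context {R : realType}.
Implicit Types (M N : manifold R).

(** [rel_tangent] specifies its operations by relations in the ambient bundles; uniqueness of the
    related vector turns two such specifications into an equation. *)
Lemma is_tsum_uniq M (v w s s' : tangent_bundle M) : is_tsum v w s -> is_tsum v w s' -> s = s'.
Proof.
by move=> [_ fs cs] [_ fs' cs']; apply: tvec_eq => [|i]; rewrite ?fs ?cs.
Qed.

Lemma is_tlift_uniq M (v : tangent_bundle M) w w' : is_tlift v w -> is_tlift v w' -> w = w'.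
Proof.
move=> [fw cw] [fw' cw']; have [i di] := cdom_cover (tfoot v).
have dw : cdom (tangent_bundle M) i (tfoot w) by rewrite fw.
by apply: (@tvec_eq_chart _ (tangent_bundle M) w w' i dw); rewrite ?fw ?fw' ?cw ?cw'.
Qed.

Lemma is_tflip_uniq M (u : tangent_bundle (tangent_bundle M)) w w' :
  is_tflip u w -> is_tflip u w' -> w = w'.
Proof.
move=> [fw cw] [fw' cw']; have [i di] := cdom_cover (tfoot (tfoot u)).
have dw : cdom (tangent_bundle M) i (tfoot w) by rewrite /= /tdom fw.
have [c1 c2] := cw i di; have [c1' c2'] := cw' i di.
apply: (@tvec_eq_chart _ (tangent_bundle M) w w' i dw); last by rewrite c2 c2'.
by apply: (@tvec_eq_chart _ _ _ _ i); rewrite ?fw ?fw' ?c1 ?c1'.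
Qed.

Lemma is_tsum_opensub_in M (V : opens M) (v w s : tangent_bundle (opensub V)) :
  is_tsum v w s -> is_tsum (tangent_smap (opensub_in V) v)
    (tangent_smap (opensub_in V) w) (tangent_smap (opensub_in V) s).
Proof.
move=> [fw fs cs].
split; [by rewrite /= fw|by rewrite /= fs|move=> i].
have [di|di] := pselect (cdom M i (sval (tfoot v))).
  by rewrite !tcoord_opensub_in ?fw ?fs ?cs.
by rewrite !tcoord_out ?addr0 //= ?fw ?fs.
Qed.

Lemma is_tlift_opensub_in M (V : opens M) (v : tangent_bundle (opensub V)) w :
  is_tlift v w -> is_tlift (tangent_smap (opensub_in V) v)
    (tangent_smap (tangent_smap (opensub_in V)) w).
Proof.
move=> [fw cw]; split=> [|i di].
  by rewrite -[LHS]/(tangent_smap (opensub_in V) (tfoot w)) fw; exact: tangent_smap_zero.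
by rewrite tcoord_tangent_opensub_in ?fw // cw // tcoord_opensub_in.
Qed.

Lemma is_tflip_opensub_in M (V : opens M)
    (u w : tangent_bundle (tangent_bundle (opensub V))) :
  is_tflip u w -> is_tflip (tangent_smap (tangent_smap (opensub_in V)) u)
    (tangent_smap (tangent_smap (opensub_in V)) w).
Proof.
move=> [fw cw]; split=> [|i di]; first by rewrite /= fw.
have [c1 c2] := cw i di.
rewrite !tcoord_tangent_opensub_in ?fw // c2 -c1.
rewrite -[tfoot (tangent_smap _ w)]/(tangent_smap (opensub_in V) (tfoot w)).
rewrite -[tfoot (tangent_smap _ u)]/(tangent_smap (opensub_in V) (tfoot u)).
by rewrite !tcoord_opensub_in ?fw.
Qed.

Lemma zero_section_inj M (x y : M) : zero_section M x = zero_section M y -> x = y.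
Proof. by move=> /(congr1 (@tfoot _ M)). Qed.

Lemma tangent_zero_section_inj M (v w : tangent_bundle M) :
  tangent_smap (zero_section M) v = tangent_smap (zero_section M) w -> v = w.
Proof.
move=> /(congr1 (tangent_smap (tangent_proj M))); rewrite -!tangent_smap_comp.
by rewrite !tangent_smap_id.
Qed.

Section RelativeBundle.
Variables (M Z Y : manifold R) (f : smap Z M) (iota : smap Y (tangent_bundle Z))
  (q : smap Y M).
Hypothesis H : is_rel_tangent_bundle f iota q.

Lemma rel_tangent_comm y : tangent_smap f (iota y) = zero_section M (q y).
Proof. by have /pullbackP [+ _ _ _] := H 0; apply. Qed.

Lemma rel_tangent_foot y : f (tfoot (iota y)) = q y.
Proof. by have := congr1 (@tfoot _ M) (rel_tangent_comm y). Qed.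

Lemma rel_tangent_inj x y : iota x = iota y -> x = y.
Proof.
move=> e; have /pullbackP [_ _ + _] := H 0; apply=> //.
by apply: zero_section_inj; rewrite -!rel_tangent_comm e.
Qed.

(** Uses preservation of the defining pullback by [T]. Lift and flip have values in second iterates,
    which are thereby embedded in [TTZ]. *)
Lemma rel_tangent_inj2 v w : tangent_smap iota v = tangent_smap iota w -> v = w.
Proof.
have /pullbackP [comm _ inj _] := H 1 => e; apply: inj => //.
by apply: tangent_zero_section_inj; rewrite -!comm e.
Qed.

End RelativeBundle.
End TangentRelations.

(** * Restriction of slice objects and relative tangent bundles to an open subset *)

Section Restriction.
Context {R : realType}.
Variables (M : manifold R) (V : opens M).

Lemma restr_smooth (Z : manifold R) (f : smap Z M) :
  @smooth_map _ (opensub (preim_opens f V)) (opensub V)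
    (fun z => exist _ (f (sval z)) (svalP z)).
Proof.
apply: smooth_map_opensub.
exact: smooth_map_comp (@sval_smooth _ _ _) (smap_smooth f).
Qed.

Definition restr_smap (Z : manifold R) (f : smap Z M) :
  smap (opensub (preim_opens f V)) (opensub V) := Smap (@restr_smooth Z f).

Lemma opensub_in_range (N : manifold R) (W : opens N) (x : N) :
  range (opensub_in W) x <-> oset W x.
Proof. by split=> [[y _ <-]|Wx]; [exact: (svalP y)|exists (exist _ x Wx)]. Qed.

(** A relative tangent vector over a point of [V] has its foot in the part of [Z] over [V], so
    [iota] lifts; the restricted square is then an open part of the original one. *)
Lemma restr_rel (Z Y : manifold R) (f : smap Z M) (iota : smap Y (tangent_bundle Z))
    (q : smap Y M) : is_rel_tangent_bundle f iota q ->
  exists iota' : smap (opensub (preim_opens q V))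
      (tangent_bundle (opensub (preim_opens f V))),
    (forall y, tangent_smap (opensub_in _) (iota' y) = iota (sval y)) /\
    is_rel_tangent_bundle (restr_smap f) iota' (restr_smap q).
Proof.
move=> H.
have oZ := open_emb_opensub_in (preim_opens f V).
have [|iota' iE] := open_emb_lift (open_emb_tangent oZ)
    (f := smap_comp iota (opensub_in (preim_opens q V))).
  move=> y; apply/range_tangent => //; apply/opensub_in_range.
  by rewrite /= /preimage /= (rel_tangent_foot H); exact: (svalP y).
exists iota'; split=> // m; apply: pullback_restrict_iter (H m).
apply: (@rel_tangent_restrict _ _ _ _ _ _ _ (opensub_in V) _ _ _ _ _ _ (opensub_in _)
  (opensub_in _)) => //; try exact: open_emb_opensub_in.
- by move=> z /opensub_in_range ?; apply/opensub_in_range.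
- by move=> z /opensub_in_range ?; apply/opensub_in_range.
move=> y /opensub_in_range; rewrite /= /preimage /= (rel_tangent_foot H) => ?.
exact/opensub_in_range.
Qed.

Program Definition restr_obj (A : slice M) : slice (opensub V) :=
  @SliceObj _ _ _ (restr_smap (sl_map A)) _.
Next Obligation.
move=> A; have [Y [iota [q H]]] := sl_rel A.
by have [iota' [_ H']] := restr_rel H; exists _, iota', (restr_smap q).
Qed.

Definition restr_in (A : slice M) : smap (restr_obj A) A :=
  opensub_in (preim_opens (sl_map A) V).

Lemma restr_hom_ex (A B : slice M) (h : hom A B) :
  exists k : hom (restr_obj A) (restr_obj B),
    forall x, restr_in B (sh_map k x) = sh_map h (restr_in A x).
Proof.
have [|k kE] := open_emb_lift (open_emb_opensub_in (preim_opens (sl_map B) V))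
    (f := smap_comp (sh_map h) (restr_in A)).
  move=> x; apply/opensub_in_range.
  by rewrite /= /preimage /= (slice_homP h); exact: (svalP x).
have ko : smap_comp (restr_smap (sl_map B)) k = restr_smap (sl_map A).
  apply: smap_eq => x; apply: opensub_eq => /=.
  by have /= -> := kE x; exact: slice_homP.
by exists (SliceHom (ko : smap_comp (sl_map (restr_obj B)) _ = _)).
Qed.

Definition restr_hom (A B : slice M) (h : hom A B) := sval (cid (restr_hom_ex h)).

Lemma restr_homE (A B : slice M) (h : hom A B) x :
  restr_in B (sh_map (restr_hom h) x) = sh_map h (restr_in A x).
Proof. exact: svalP (cid (restr_hom_ex h)) x. Qed.

Lemma restr_in_inj (A : slice M) x y : restr_in A x = restr_in A y -> x = y.
Proof. exact: opensub_eq. Qed.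

Variable TT : forall N : manifold R, rel_tangent N.

(** Source and target are relative tangent bundles of the same restricted object, hence pullbacks of
    the same cospan. *)
Lemma restr_dist_ex (A : slice_tan (TT M)) :
  exists k : hom (restr_obj (tfun (TT M) A)) (tfun (TT (opensub V)) (restr_obj A)),
    is_iso k /\ forall x,
      tangent_smap (restr_in A) (rt_in (TT (opensub V)) (restr_obj A) (sh_map k x)) =
      rt_in (TT M) A (restr_in _ x).
Proof.
have [iota [iE H]] := restr_rel (rt_pullback (TT M) A).
have [k [[l [lk kl]] rk vk]] :=
  pullback_iso (H 0) (rt_pullback (TT (opensub V)) (restr_obj A) 0).
have klE y : k (l y) = y by have := congr1 (fun l : smap _ _ => l y) kl.
have vkE x := congr1 (fun l : smap _ _ => l x) vk.
have vl : smap_comp (sl_map (restr_obj (tfun (TT M) A))) l =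
    sl_map (tfun (TT (opensub V)) (restr_obj A)).
  by apply: smap_eq => y; rewrite /= -[LHS]vkE /= klE.
exists (@SliceHom _ _ (restr_obj (tfun (TT M) A)) (tfun (TT (opensub V)) (restr_obj A)) k vk).
split.
  exists (SliceHom vl); split; apply: slice_hom_eq => y /=; last exact: klE.
  by have := congr1 (fun l : smap _ _ => l y) lk.
by move=> x; rewrite -iE -rk.
Qed.

Definition restr_dist (A : slice_tan (TT M)) := sval (cid (restr_dist_ex A)).

Lemma restr_dist_iso A : is_iso (restr_dist A).
Proof. by have [] := svalP (cid (restr_dist_ex A)). Qed.

Definition restr_rt_in (A : slice_tan (TT M)) :
    smap (tfun (TT (opensub V)) (restr_obj A)) (tangent_bundle A) :=
  smap_comp (tangent_smap (restr_in A)) (rt_in (TT (opensub V)) (restr_obj A)).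

Lemma restr_distE A x :
  restr_rt_in A (sh_map (restr_dist A) x) = rt_in (TT M) A (restr_in _ x).
Proof. by have [_ H] := svalP (cid (restr_dist_ex A)); exact: H. Qed.

Lemma restr_rt_in_inj A x y : restr_rt_in A x = restr_rt_in A y -> x = y.
Proof.
move=> /(open_emb_inj (open_emb_tangent_opensub_in _)).
exact: (rel_tangent_inj (rt_pullback (TT (opensub V)) (restr_obj A))).
Qed.

Lemma restr_rt_in_inj2 A x y :
  tangent_smap (restr_rt_in A) x = tangent_smap (restr_rt_in A) y -> x = y.
Proof.
rewrite !tangent_smap_comp.
move=> /(open_emb_inj (open_emb_tangent (open_emb_tangent_opensub_in _))).
exact: (rel_tangent_inj2 (rt_pullback (TT (opensub V)) (restr_obj A))).
Qed.

End Restriction.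
Arguments restr_rt_in {R M} V TT A.
Arguments restr_dist {R M} V TT A.

(** * The restriction functor to the pseudolimit: tangent structure, faithfulness, fullness *)

Section Localization.
Context {R : realType}.
Variables (M : manifold R) (I : Type) (B : I -> opens M).
Variable TT : forall N : manifold R, rel_tangent N.
Variable F : pseudofunctor (slice_over (B := B) TT).
Variable HF : pullback_pseudofunctor F.
Local Notation U := (sublattice B).
Local Notation X := (slice_tan (TT M)).
Local Notation Y := (pseudolim F).
Implicit Types (V W : U) (A : X).

Lemma loc_incl_sub A V W (g : hom V W) :
  preim_opens (sl_map A) V `<=` preim_opens (sl_map A) W.
Proof. by move=> x; exact: g. Qed.

Definition loc_incl A V W (g : hom V W) : smap (restr_obj V A) (restr_obj W A) :=
  opensub_incl (@loc_incl_sub A V W g).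

Lemma loc_incl_pullback A V W (g : hom V W) :
  is_pullback (C := SMan R) (sl_map (restr_obj W A)) (opensub_incl g) (loc_incl A g)
    (sl_map (restr_obj V A)).
Proof.
apply/pullbackP; apply: pb_points_of_open_emb.
- exact: open_emb_opensub_incl.
- exact: open_emb_opensub_incl.
- by move=> p; exact: opensub_eq.
move=> a [x _ xa]; have Va : oset V (sl_map A (sval a)).
  by have := congr1 (@sval M _) xa => /= <-; exact: (svalP x).
by exists (exist _ (sval a) Va) => //; exact: opensub_eq.
Qed.

Lemma loc_incl_id A V (g : hom V V) z : loc_incl A g z = z.
Proof. exact: opensub_eq. Qed.

Lemma loc_incl_comp A V W W' (g : hom V W) (h : hom W W') (k : hom V W') z :
  loc_incl A h (loc_incl A g z) = loc_incl A k z.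
Proof. exact: opensub_eq. Qed.

Definition loc_obj A : lim_obj F :=
  build_lim HF (@loc_incl_pullback A) (@loc_incl_id A) (@loc_incl_comp A).

Lemma loc_rho A V W (g : hom V W) z :
  restr_in W A (lim_rho HF (loc_obj A) g z) = restr_in V A z.
Proof. by rewrite build_rho. Qed.

Lemma loc_map_tr A A' (h : hom A A') V W (g : hom V W) :
  restr_hom V h ∘ lo_tr (loc_obj A) g =
  lo_tr (loc_obj A') g ∘ fmap (pf_mor F g) (restr_hom W h).
Proof.
apply: (lim_homP HF (L := loc_obj A) (L' := loc_obj A') (fun V => restr_hom V h)).2.
move=> {}V {}W {}g z; apply: (@restr_in_inj _ _ W A').
by rewrite loc_rho !restr_homE loc_rho.
Qed.

Definition loc_map A A' (h : hom A A') : lim_hom (loc_obj A) (loc_obj A') :=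
  @LimHom _ _ F (loc_obj A) (loc_obj A') (fun V => restr_hom V h) (@loc_map_tr A A' h).

Program Definition loc_functor : functor X Y := @Functor X Y loc_obj loc_map _ _.
Next Obligation.
move=> A; apply: lim_hom_eq => V; apply: slice_hom_eq => x.
by apply: (@restr_in_inj _ _ V A); exact: restr_homE.
Qed.
Next Obligation.
move=> A A' A'' g f; apply: lim_hom_eq => V; apply: slice_hom_eq => x.
apply: (@restr_in_inj _ _ V A''); rewrite [LHS]restr_homE /=.
by rewrite [RHS]restr_homE restr_homE.
Qed.

Lemma restr_rt_in_rho A V W (g : hom V W) w :
  restr_rt_in W TT A (lim_rho HF (limT_obj (loc_obj A)) g w) = restr_rt_in V TT A w.
Proof.
rewrite /restr_rt_in /= -[LHS]/(tangent_smap _ (rt_in (TT (opensub W)) (loc_obj A W) _)).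
rewrite lim_rho_tangent -[RHS]/(tangent_smap _ _) -tangent_smap_comp.
by apply: tangent_smap_eq => z; exact: loc_rho.
Qed.

Lemma loc_dist_tr A V W (g : hom V W) :
  restr_dist V TT A ∘ lo_tr (loc_obj (tfun (TT M) A)) g =
  lo_tr (limT_obj (loc_obj A)) g ∘ fmap (pf_mor F g) (restr_dist W TT A).
Proof.
apply: (lim_homP HF (L := loc_obj _) (L' := limT_obj (loc_obj A))
  (fun V => restr_dist V TT A)).2.
move=> {}V {}W {}g z; apply: (@restr_rt_in_inj _ _ W TT A).
rewrite restr_rt_in_rho !restr_distE.
by rewrite loc_rho.
Qed.

Definition loc_dist A : lim_hom (loc_obj (tfun (TT M) A)) (limT_obj (loc_obj A)) :=
  @LimHom _ _ F (loc_obj (tfun (TT M) A)) (limT_obj (loc_obj A))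
    (fun V => restr_dist V TT A) (@loc_dist_tr A).

Lemma restr_rt_in_map A A' (h : hom A A') V w :
  restr_rt_in V TT A' (sh_map (fmap (tfun (TT (opensub V))) (restr_hom V h)) w) =
  tangent_smap (sh_map h) (restr_rt_in V TT A w).
Proof.
rewrite /restr_rt_in -[LHS]/(tangent_smap _ (rt_in _ _ _)) rt_nat.
by apply: tangent_smap_square => x; exact: restr_homE.
Qed.

Lemma lim_hom_pt (L L' : lim_obj F) (u v : lim_hom L L') V x :
  u = v -> sh_map (u V) x = sh_map (v V) x.
Proof. by move->. Qed.

(** Seen inside [TTA], the twofold distributive law is the inclusion of the part over [V]. This is
    the form in which the axioms for lift and flip are checked. *)
Lemma restr_rt_in2 A V w :
  tangent_smap (restr_rt_in V TT A)
    (rt_in _ _ (sh_map (fmap (tfun (TT (opensub V))) (restr_dist V TT A))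
      (sh_map (restr_dist V TT (tfun (TT M) A)) w))) =
  tangent_smap (rt_in (TT M) A) (rt_in (TT M) (tfun (TT M) A) (restr_in V _ w)).
Proof.
rewrite rt_nat -restr_distE; apply: tangent_smap_square => x.
exact: restr_distE.
Qed.

(** Both sides of each axiom are compared after injecting them into [A], [TA] or [TTA]. For sum,
    lift and flip they then satisfy the same relation and agree by uniqueness. *)
Program Definition loc_tan_mor : tan_mor X Y :=
  @TanMor X Y loc_functor loc_dist _ _ _ _ _ _.
Next Obligation.
move=> A A' h; apply: lim_hom_eq => V; apply: slice_hom_eq => x.
apply: (@restr_rt_in_inj _ _ V TT A').
rewrite [LHS]restr_distE [RHS]restr_rt_in_map restr_distE.
rewrite [X in rt_in _ _ X = _](restr_homE (fmap (tfun (TT M)) h) x).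
exact: rt_nat.
Qed.
Next Obligation.
move=> A; apply: lim_hom_eq => V; apply: slice_hom_eq => x.
apply: (@restr_in_inj _ _ V A); rewrite [RHS]restr_homE.
rewrite [sh_map _ x]/= rt_p rt_p -restr_distE.
by [].
Qed.
Next Obligation.
move=> A; apply: lim_hom_eq => V; apply: slice_hom_eq => x.
apply: (@restr_rt_in_inj _ _ V TT A).
rewrite [LHS]restr_distE restr_homE rt_zero.
rewrite -[RHS]/(tangent_smap _ (rt_in _ _ _)) rt_zero.
by rewrite [RHS]tangent_smap_zero.
Qed.
Next Obligation.
move=> A u ue; apply: lim_hom_eq => V; apply: slice_hom_eq => x.
have uE i : sh_map (tpr (TT (opensub V)) (restr_obj V A) i) (sh_map (u V) x) =
    sh_map (restr_dist V TT A) (sh_map (restr_hom V (tpr (TT M) A i)) x).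
  exact: (@lim_hom_pt _ _ _ _ V x (ue i)).
apply: (@restr_rt_in_inj _ _ V TT A); rewrite [LHS]restr_distE restr_homE.
apply: is_tsum_uniq (rt_plus _) _.
have := is_tsum_opensub_in (rt_plus (r := TT (opensub V)) (sh_map (u V) x)).
rewrite !uE -!restr_homE -!restr_distE.
by [].
Qed.
Next Obligation.
move=> A; apply: lim_hom_eq => V; apply: slice_hom_eq => x.
apply: (rel_tangent_inj (rt_pullback (TT (opensub V)) _)).
apply: (@restr_rt_in_inj2 _ _ V TT A).
rewrite [RHS]restr_rt_in2 restr_homE; apply: is_tlift_uniq (rt_lift _).
have := is_tlift_opensub_in (rt_lift (sh_map (restr_dist V TT A) x)).
by rewrite -tangent_smap_comp -restr_distE.
Qed.
Next Obligation.
move=> A; apply: lim_hom_eq => V; apply: slice_hom_eq => x.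
apply: (rel_tangent_inj (rt_pullback (TT (opensub V)) _)).
apply: (@restr_rt_in_inj2 _ _ V TT A).
rewrite [RHS]restr_rt_in2 restr_homE; apply: is_tflip_uniq (rt_flip _).
set w := sh_map (fmap (tfun (TT (opensub V))) (restr_dist V TT A))
  (sh_map (restr_dist V TT (tfun (TT M) A)) x).
have := is_tflip_opensub_in (rt_flip w).
rewrite -!tangent_smap_comp; have -> := restr_rt_in2 x.
by [].
Qed.

Hypothesis cover : forall x : M, exists V : U, oset V x.

Lemma loc_faithful A A' (f g : hom A A') : loc_map f = loc_map g -> f = g.
Proof.
move=> fg; apply: slice_hom_eq => x; have [V Vx] := cover (sl_map A x).
pose z : restr_obj V A := exist _ x Vx.
have := @lim_hom_pt (loc_obj A) (loc_obj A') _ _ V z fg => /(congr1 (restr_in V A')).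
by rewrite !restr_homE.
Qed.

Lemma generated_capI V W : generated B (opens_cap V W).
Proof. by apply: generated_cap; exact: lat_in. Qed.

Definition lat_cap V W : U := LatObj (generated_capI V W).
Definition lat_capl V W : @hom U (lat_cap V W) V := @subIsetl _ _ _.
Definition lat_capr V W : @hom U (lat_cap V W) W := @subIsetr _ _ _.

Lemma loc_full A A' (u : lim_hom (loc_obj A) (loc_obj A')) : exists h, loc_map h = u.
Proof.
pose Vx (x : A) := sval (cid (cover (sl_map A x))).
have VP x : oset (Vx x) (sl_map A x) by exact: svalP (cid (cover (sl_map A x))).
pose pt V (x : A) (v : oset V (sl_map A x)) : restr_obj V A := exist _ x v.
pose h (x : A) : A' := restr_in (Vx x) A' (sh_map (u (Vx x)) (pt _ x (VP x))).
have uP := (lim_homP HF u).1 (lh_tr u).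
(* The value does not depend on the open set chosen around [sl_map A x]: two choices are compared on
   their intersection, which belongs to the lattice. *)
have hE V x (v : oset V (sl_map A x)) :
    h x = restr_in V A' (sh_map (u V) (pt V x v)).
  have sub W (g : @hom U (lat_cap V (Vx x)) W) w :
      restr_in W A' (sh_map (u W) (pt W x w)) =
      restr_in _ A' (sh_map (u _) (pt (lat_cap V (Vx x)) x (conj v (VP x)))).
    have e : pt W x w = lim_rho HF (loc_obj A) g (pt (lat_cap V (Vx x)) x (conj v (VP x))).
      by apply: (@restr_in_inj _ _ W A); rewrite loc_rho.
    by rewrite e -uP loc_rho.
  by rewrite /h (sub _ (@lat_capr _ _)) (sub _ (@lat_capl _ _)).
have hr V (z : restr_obj V A) : h (restr_in V A z) = restr_in V A' (sh_map (u V) z).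
  by rewrite (hE V _ (svalP z)); congr (restr_in V A' (sh_map (u V) _)); exact: opensub_eq.
have sh : smooth_map h.
  apply: smooth_map_local => x; exists (preim_opens (sl_map A) (Vx x)); split; first exact: VP.
  pose k := smap_comp (restr_in (Vx x) A') (sh_map (u (Vx x))).
  have e : h \o restr_in (Vx x) A = k by apply/funext => z; exact: hr.
  by rewrite [X in smooth_map X]e; exact: smap_smooth k.
have ho : smap_comp (sl_map A') (Smap sh) = sl_map A.
  apply: smap_eq => x; have [V Vs] := cover (sl_map A x).
  rewrite /= (hE V x Vs).
  by have := congr1 (@sval M _) (slice_homP (u V) (pt V x Vs)).
exists (SliceHom ho); apply: lim_hom_eq => V; apply: slice_hom_eq => z.
by apply: (@restr_in_inj _ _ V A'); rewrite [LHS]restr_homE; exact: hr.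
Qed.

End Localization.

(** * Essential surjectivity: gluing an object of the pseudolimit *)

Lemma second_countable_subcover (R : realType) (M : manifold R) (J : Type)
    (O : J -> opens M) : (forall x, exists j, oset (O j) x) ->
  exists2 C : set J, countable C & forall x, exists2 j, C j & oset (O j) x.
Proof.
move=> cov; have [D cD [oD bD]] := @man_second_countable _ M.
(* Lindelöf argument: one index is kept for each basic open set contained in a member of the cover;
   other basic sets contribute none. *)
pose pick (S : set M) : option J :=
  if pselect (exists j, S `<=` oset (O j)) is left e then Some (sval (cid e)) else None.
exists (\bigcup_(S in D) [set j | pick S = Some j]).
  apply: bigcup_countable => // S _; case: (pick S) => [j|].
    by apply: (@sub_countable _ _ _ [set j]) => //; apply: subset_card_le => k [->].
  by apply: (@sub_countable _ _ _ set0) => //; apply: subset_card_le => k.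
move=> x; have [j Ox] := cov x.
have [|S [DS Sx] SO] := bD x (oset (O j)).
  by apply: open_nbhs_nbhs; split=> //; exact: oset_open.
have [k pk kS] : exists2 k, pick S = Some k & S `<=` oset (O k).
  rewrite /pick; case: pselect => [e|[]]; last by exists j.
  by exists (sval (cid e)) => //; exact: svalP (cid e).
by exists k; [exists S|exact: kS].
Qed.

Section GlueLimit.
Context {R : realType}.
Variables (M : manifold R) (I : Type) (B : I -> opens M).
Variable TT : forall N : manifold R, rel_tangent N.
Variable F : pseudofunctor (slice_over (B := B) TT).
Variable HF : pullback_pseudofunctor F.
Hypothesis cover : forall x : M, exists V : sublattice B, oset V x.
Local Notation U := (sublattice B).
Implicit Types (V W Y : U) (L : lim_obj F).

Definition germ_rel L V W (z : sl_dom (L V)) (w : sl_dom (L W)) : Prop :=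
  exists Y (g : hom Y V) (h : hom Y W) (u : sl_dom (L Y)),
    lim_rho HF L g u = z /\ lim_rho HF L h u = w.

Lemma germ_rel_refl L V (z : sl_dom (L V)) : germ_rel z z.
Proof. by exists V, (idm V), (idm V), z; rewrite lim_rho_id. Qed.

Lemma germ_rel_sym L V W (z : sl_dom (L V)) (w : sl_dom (L W)) :
  germ_rel z w -> germ_rel w z.
Proof. by move=> [Y [g [h [u [uz uw]]]]]; exists Y, h, g, u. Qed.

(** The two witnesses lie over the same point of [M], so [u] comes from a point over the
    intersection of [Y] and [Y']. Injectivity of the map into [L W] shows that [u'] comes from the
    same point. *)
Lemma germ_rel_trans L V W W' (z : sl_dom (L V)) (w : sl_dom (L W)) (w' : sl_dom (L W')) :
  germ_rel z w -> germ_rel w w' -> germ_rel z w'.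
Proof.
move=> [Y [g [h [u [uz uw]]]]] [Y' [g' [h' [u' [uw' uw'']]]]].
have bu : oset Y' (base_pt u).
  by rewrite -(base_pt_rho HF h) uw -uw' base_pt_rho; exact: base_pt_in.
have [t _ tu] : range (lim_rho HF L (@lat_capl _ _ _ _ Y Y')) u.
  by apply: range_rho; split=> //; exact: base_pt_in.
have tu' : lim_rho HF L (@lat_capr _ _ _ _ Y Y') t = u'.
  apply: (open_emb_inj (lim_rho_open_emb HF L g')); rewrite uw' -uw -tu.
  pose k : hom (lat_cap Y Y') W := h ∘ @lat_capl _ _ _ _ Y Y'.
  by rewrite !(lim_rho_comp HF _ _ k).
exists (lat_cap Y Y'), (g ∘ @lat_capl _ _ _ _ Y Y'), (h' ∘ @lat_capr _ _ _ _ Y Y'), t.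
rewrite -(lim_rho_comp HF (@lat_capl _ _ _ _ Y Y') g) tu.
by rewrite -(lim_rho_comp HF (@lat_capr _ _ _ _ Y Y') h') tu'.
Qed.

Definition germ_class L V (z : sl_dom (L V)) : set {V : lat_obj B & sl_dom (L V)} :=
  fun p => germ_rel z (projT2 p).

(* The colimit of the sets [L V]. The index type is written [lat_obj B], not [U]: the
   latter unfolds to an [obj] projection, whose universe is too large for a manifold. *)
Definition germ L :=
  {S : set {V : lat_obj B & sl_dom (L V)} |
    exists V (z : sl_dom (L V)), S = germ_class z}.

Definition germ_in L V (z : sl_dom (L V)) : germ L :=
  exist _ (germ_class z) (ex_intro _ V (ex_intro _ z erefl)).

Lemma germ_inP L V W (z : sl_dom (L V)) (w : sl_dom (L W)) :
  germ_in z = germ_in w <-> germ_rel z w.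
Proof.
split=> [/(congr1 sval) /= e|zw].
  have : germ_class w (existT (fun V : lat_obj B => sl_dom (L V)) W w) by exact: germ_rel_refl.
  by rewrite -e.
apply: eq_sig_hprop => [S p q|]; first exact: Prop_irrelevance.
apply/seteqP; split=> p; last exact: germ_rel_trans.
exact/germ_rel_trans/germ_rel_sym.
Qed.

Lemma germ_in_rho L V W (g : hom V W) (z : sl_dom (L V)) :
  germ_in (lim_rho HF L g z) = germ_in z.
Proof. by apply/germ_inP; exists V, g, (idm V), z; rewrite lim_rho_id. Qed.

Lemma germP L (s : germ L) : exists V (z : sl_dom (L V)), germ_in z = s.
Proof.
have [V [z Sz]] := svalP s; exists V, z.
by apply: eq_sig_hprop => // S p q; exact: Prop_irrelevance.
Qed.

Lemma germ_desc L (N : Type) (f : forall V, sl_dom (L V) -> N) :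
  (forall V W (g : hom V W) z, f W (lim_rho HF L g z) = f V z) ->
  exists phi : germ L -> N, forall V (z : sl_dom (L V)), phi (germ_in z) = f V z.
Proof.
move=> fE.
have ex s : exists y, exists V (z : sl_dom (L V)), germ_in z = s /\ f V z = y.
  by have [V [z zs]] := germP s; exists (f V z), V, z.
exists (fun s => sval (cid (ex s))) => V z.
have [W [w [/germ_inP [Y [g [h [u [uw uz]]]]] <-]]] := svalP (cid (ex (germ_in z))).
by rewrite -uw -uz !fE.
Qed.

(** The two inclusions of [Y] in [V] that witness the relation are equal, so both points are the
    image of [u] under one map. *)
Lemma germ_in_inj L V (z w : sl_dom (L V)) : germ_in z = germ_in w -> z = w.
Proof.
move=> /germ_inP [Y [g [h [u [<- <-]]]]].
by rewrite (@Prop_irrelevance (oset Y `<=` oset V) g h).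
Qed.

(** The overlap contains the open image of [L Y] in [L V]; the change of piece goes back to [L Y]
    and then on to [L W]. *)
Lemma germ_overlap L V W (z : sl_dom (L V)) (w : sl_dom (L W)) : germ_in z = germ_in w ->
  exists (O : opens (sl_dom (L V))) (t : smap (opensub O) (sl_dom (L W))),
    oset O z /\ forall x, germ_in (t x) = germ_in (sval x).
Proof.
move=> /germ_inP [Y [g [h [u [uz uw]]]]].
have [O [a [b [OE aE ba ab]]]] := open_emb_opensub (lim_rho_open_emb HF L g).
exists O, (smap_comp (lim_rho HF L h) b); split; first by rewrite OE -uz; exists u.
by move=> x; rewrite -{2}(ab x) aE !germ_in_rho.
Qed.

Lemma germ_base_ex L :
  exists phi : germ L -> M, forall V (z : sl_dom (L V)), phi (germ_in z) = base_pt z.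
Proof. by apply: germ_desc => V W g z; exact: base_pt_rho. Qed.

Definition germ_base L := sval (cid (germ_base_ex L)).

Lemma germ_baseE L V (z : sl_dom (L V)) : germ_base (germ_in z) = base_pt z.
Proof. exact: svalP (cid (germ_base_ex L)) V z. Qed.

Lemma germ_base_smooth L V : smooth_map (@germ_base L \o @germ_in L V : sl_dom (L V) -> M).
Proof.
rewrite (_ : _ \o _ = smap_comp (opensub_in V) (sl_map (L V))); first exact: smap_smooth.
by apply/funext => z; exact: germ_baseE.
Qed.

(** A representative in [L W] whose base point lies in [V] comes from the intersection of [V] and
    [W], and so from [L V]. Hence points of one fibre share a piece. *)
Lemma germ_in_over L V (s : germ L) : oset V (germ_base s) ->
  exists z : sl_dom (L V), germ_in z = s.
Proof.
have [W [w <-]] := germP s; rewrite germ_baseE => Vw.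
have [t _ tw] : range (lim_rho HF L (@lat_capr _ _ _ _ V W)) w.
  by apply: range_rho; split=> //; exact: base_pt_in.
exists (lim_rho HF L (@lat_capl _ _ _ _ V W) t).
by rewrite -tw !germ_in_rho.
Qed.

Lemma germ_fibre L (s t : germ L) : germ_base s = germ_base t ->
  exists V (z w : sl_dom (L V)), germ_in z = s /\ germ_in w = t.
Proof.
move=> st; have [V Vs] := cover (germ_base s).
have [z zs] := germ_in_over Vs; rewrite st in Vs; have [w wt] := germ_in_over Vs.
by exists V, z, w.
Qed.

Lemma germ_countable L : exists2 C : set (lat_obj B), countable C &
  forall s : germ L, exists2 V, C V & exists z : sl_dom (L V), germ_in z = s.
Proof.
have [C cC CP] := second_countable_subcover (J := lat_obj B) cover; exists C => // s.
by have [V CV Vs] := CP (germ_base s); exists V => //; exact: germ_in_over.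
Qed.

Definition lim_glue L : manifold R :=
  @glue R (lat_obj B) (fun V => sl_dom (L V)) (germ L) (@germ_in L)
    (@germ_in_inj L) (@germP L) (@germ_overlap L)
    M (@germ_base L) (@germ_base_smooth L) (@germ_fibre L) (germ_countable L).

Definition lim_glue_in L V : smap (sl_dom (L V)) (lim_glue L) :=
  glue_in (J := lat_obj B) _ _ _ _ _ _ V.

Lemma lim_glue_in_emb L V : open_emb (lim_glue_in L V).
Proof. exact: (open_emb_glue_in (J := lat_obj B)). Qed.

Lemma lim_glueP L (s : lim_glue L) : exists V z, lim_glue_in L V z = s.
Proof. exact: germP. Qed.

Lemma lim_glue_in_rho L V W (g : hom V W) z :
  lim_glue_in L W (lim_rho HF L g z) = lim_glue_in L V z.
Proof. exact: germ_in_rho. Qed.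

Lemma lim_glue_desc L (N : manifold R) (f : forall V, smap (sl_dom (L V)) N) :
  (forall V W (g : hom V W) z, f W (lim_rho HF L g z) = f V z) ->
  exists phi : smap (lim_glue L) N, forall V z, phi (lim_glue_in L V z) = f V z.
Proof.
move=> /germ_desc [phi phiE].
have sphi : @smooth_map _ (lim_glue L) N phi.
  apply: (smooth_map_glue (J := lat_obj B)) => V.
  rewrite (_ : _ \o _ = f V); first exact: smap_smooth.
  by apply/funext => z; exact: phiE.
by exists (Smap sphi).
Qed.

Lemma lim_glue_map_ex L : exists phi : smap (lim_glue L) M,
  forall V z, phi (lim_glue_in L V z) = sval (sl_map (L V) z).
Proof.
apply: (lim_glue_desc (f := fun V => smap_comp (opensub_in V) (sl_map (L V)))).
by move=> V W g z; exact: base_pt_rho.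
Qed.

Definition lim_glue_map L := sval (cid (lim_glue_map_ex L)).

Lemma lim_glue_mapE L V z : lim_glue_map L (lim_glue_in L V z) = sval (sl_map (L V) z).
Proof. exact: svalP (cid (lim_glue_map_ex L)) V z. Qed.

Lemma range_lim_glue_in L V s : oset V (lim_glue_map L s) -> range (lim_glue_in L V) s.
Proof.
move=> Vs; have [|z zs] := @germ_in_over L V s; last by exists z.
have [W [w ws]] := germP s; move: Vs; rewrite -ws germ_baseE.
by have := lim_glue_mapE w => /= ->.
Qed.

(** The inclusions of the bundles of the [L V] into the tangent bundle of the glued manifold agree
    by [lim_rho_tangent] and descend to [iota]. The pullback property is then glued along the cover
    of [TM] by the tangent bundles of the [V]. *)
Lemma lim_glue_rel L : exists N iota q,
  is_rel_tangent_bundle (lim_glue_map L) (iota : smap N (tangent_bundle (lim_glue L))) q.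
Proof.
pose f V := smap_comp (tangent_smap (lim_glue_in L V)) (rt_in (TT (opensub V)) (L V)).
have [|iota iE] := lim_glue_desc (L := limT_obj L) (f := f).
  move=> V W g z; rewrite /f /= -[LHS]/(tangent_smap _ (rt_in _ _ _)) lim_rho_tangent.
  rewrite -tangent_smap_comp; apply: tangent_smap_eq => x; exact: lim_glue_in_rho.
exists (lim_glue (limT_obj L)), iota, (lim_glue_map (limT_obj L)) => m.
apply: (pullback_glue_iter (J := lat_obj B) (eC := fun V => tangent_smap (opensub_in V))
  (eA := fun V => tangent_smap (lim_glue_in L V)) (eB := fun V => opensub_in V)
  (eP := fun V => lim_glue_in (limT_obj L) V)) => [V|c|V]; last 1 first.
- exact: (rt_pullback (TT (opensub V)) (L V) m).
- apply: rel_tangent_restrict => //; try exact: lim_glue_in_emb.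
  + exact: open_emb_opensub_in.
  + by move=> z; rewrite lim_glue_mapE.
  + by move=> z; rewrite lim_glue_mapE.
  + by move=> z /opensub_in_range; exact: range_lim_glue_in.
  + by move=> z /opensub_in_range; exact: range_lim_glue_in.
  (* A vector whose foot lies in the piece of [V] must itself lie over [V]. Its representative may
     live over another [W], so the base points are compared through [lim_glue_map]. *)
  move=> y [x _ xy]; apply/opensub_in_range.
  have [W [w wy]] := lim_glueP y; move: xy; rewrite -wy lim_glue_mapE iE /f /=.
  move=> /(congr1 (lim_glue_map L)); rewrite !lim_glue_mapE => e.
  rewrite -(rel_tangent_foot (rt_pullback (TT (opensub W)) (L W))) -e.
  exact: (svalP (sl_map (L V) x)).
have [V Vc] := cover (tfoot c); exists V.
exact: range_tangent_opensub_in.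
Qed.

Definition lim_glue_obj L : slice M := SliceObj (lim_glue_rel L).

(** The restriction of the glued object to [V] and [L V] are both openly embedded as the part over
    [V], so each embedding lifts through the other. *)
Lemma loc_ess_surj L : exists (A : slice_tan (TT M))
  (u : @hom (lim_cat F) (loc_obj HF A) L), is_iso u.
Proof.
pose A := lim_glue_obj L; exists A.
have ex V : exists k : hom (restr_obj V A) (L V), is_iso k /\
    forall x, lim_glue_in L V (sh_map k x) = restr_in V A x.
  have [|k kE] := open_emb_lift (lim_glue_in_emb L V) (f := restr_in V A).
    by move=> x; apply: range_lim_glue_in; exact: (svalP x).
  have [|l lE] := open_emb_lift (open_emb_opensub_in (preim_opens (sl_map A) V))
      (f := lim_glue_in L V).
    move=> x; apply/opensub_in_range; rewrite /= /preimage /= lim_glue_mapE.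
    exact: (svalP (sl_map (L V) x)).
  have lk x : l (k x) = x by apply: (@restr_in_inj _ _ V A); rewrite -[RHS]kE; exact: lE.
  have kl x : k (l x) = x by apply: (open_emb_inj (lim_glue_in_emb L V)); rewrite kE; exact: lE.
  have ko : smap_comp (sl_map (L V)) k = sl_map (restr_obj V A).
    apply: smap_eq => x; apply: opensub_eq => /=; rewrite -lim_glue_mapE kE.
    by [].
  exists (SliceHom ko); split; last exact: kE.
  apply: slice_iso_open_emb; first exact: open_emb_bij lk kl.
  by move=> y; exists (l y); exact: kl.
pose u V := sval (cid (ex V)).
have ui V : is_iso (u V) by have [] := svalP (cid (ex V)).
have uE V x : lim_glue_in L V (sh_map (u V) x) = restr_in V A x.
  by have [_ H] := svalP (cid (ex V)); exact: H.
have utr V W (g : hom V W) :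
    u V ∘ lo_tr (loc_obj HF A) g = lo_tr L g ∘ fmap (pf_mor F g) (u W).
  apply: (lim_homP HF (L := loc_obj HF A) (L' := L) u).2 => {}V {}W {}g z.
  apply: (open_emb_inj (lim_glue_in_emb L W)).
  by rewrite lim_glue_in_rho uE [RHS]uE loc_rho.
exists (@LimHom _ _ F (loc_obj HF A) L u utr).
exact: lim_iso.
Qed.

Lemma slice_equivalent_pseudolim : tan_equivalent (slice_tan (TT M)) (pseudolim F).
Proof.
apply: (tan_equivalent_of_ff (H := loc_tan_mor HF)).
- by move=> A; apply: (@lim_iso _ _ _ _ _ F) => V; exact: restr_dist_iso.
- by move=> A A' f g; exact: loc_faithful.
- by move=> A A' g; exact: loc_full.
exact: loc_ess_surj.
Qed.

End GlueLimit.

Theorem proposition1p7 (R : realType) (M : manifold R) (I : Type) (U : I -> chart M)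
    (atlasU : smooth_atlas U) (TT : forall N : manifold R, rel_tangent N)
    (F : pseudofunctor (slice_over (B := fun i => ch_img (U i)) TT))
    (HF : pullback_pseudofunctor F) :
  tan_equivalent (slice_tan (TT M)) (pseudolim F).
Proof.
(* The generators of the lattice, being the chart images, already cover [M]. *)
apply: (slice_equivalent_pseudolim HF) => x; have [i Ui] := atlasU x.
by exists (LatObj (generated_base (fun i => ch_img (U i)) i)).
Qed.
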